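(* The series $\displaystyle\sum_{n=0}^{\infty} \frac{1}{(2n+1)^3 \binom{2n}{n}}$ equals \[ \frac{32\mathcal{G}}{3} - \frac{4\pi \operatorname{Li}_2\bigl(2-\sqrt{3}\bigr)}{3} -\frac{\pi^3}{9} - \frac{\pi \bigl(\log 2-\log(2+\sqrt3)\bigr)^2}{3}, \] where $\mathcal G=\operatorname{Im}\operatorname{Li}_3\bigl(\frac{1+i}{2}\bigr)$. Moreover, this number belongs to the $\mathbb Q$-vector space $i\,\mathfrak Z_3(12)$.
   Context: For $|z|\le 1$ and integer $s\ge 2$ (or $|z|<1$, $s=1$), $\operatorname{Li}_s(z)=\sum_{n\ge1} z^n/n^s$. For positive integers $s_1,\dots,s_m$ and complex $z_1,\dots,z_m$, define (when convergent) $\operatorname{Li}_{s_1,\dots,s_m}(z_1,\dots,z_m)=\sum_{n_1>\cdots>n_m\ge1} \frac{z_1^{n_1}\cdots z_m^{n_m}}{n_1^{s_1}\cdots n_m^{s_m}}$. For positive integers $k,N$, $\mathfrak Z_k(N)$ denotes the $\mathbb Q$-linear span of all $\operatorname{Li}_{s_1,\dots,s_m}(z_1,\dots,z_m)$ with $s_j\in\mathbb Z_{>0}$, $\sum_j s_j=k$, $z_j^N=1$ for all $j$, and $(s_1,z_1)\ne(1,1)$ (cyclotomic multiple zeta values of weight $k$ and level $N$); $\mathfrak Z_0(N)=\mathbb Q$. $i\,\mathfrak Z_3(12)=\{ix: x\in\mathfrak Z_3(12)\}$. *)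

(* Defs.v *)
From Stdlib Require Import Reals QArith Qreals List.
From Coquelicot Require Import Coquelicot.
Open Scope R_scope.

(** Complex sum of a series, computed componentwise (= the complex sum when
    the series converges). *)
Definition CSeries (a : nat -> C) : C :=
  (Series (fun n => Re (a n)), Series (fun n => Im (a n))).

Definition Li (s : nat) (z : C) : C :=
  CSeries (fun n => (z ^ (S n) / RtoC (INR (S n) ^ s))%C).

Fixpoint csum1 (f : nat -> C) (N : nat) : C :=
  match N with
  | O => RtoC 0
  | S N' => (csum1 f N' + f (S N'))%C
  end.

(** Truncated multiple polylogarithm: for data [(s1,z1);...;(sm,zm)],
    mpl_trunc data N = sum_{N >= n1 > n2 > ... > nm >= 1}
                         prod_j z_j^{n_j} / n_j^{s_j}. *)
Fixpoint mpl_trunc (data : list (nat * C)) (N : nat) : C :=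
  match data with
  | nil => RtoC 1
  | (s, z) :: rest =>
      csum1 (fun n => ((z ^ n / RtoC (INR n ^ s)) * mpl_trunc rest (pred n))%C) N
  end.

Definition is_mpl (data : list (nat * C)) (v : C) : Prop :=
  filterlim (mpl_trunc data) eventually (locally v).

Definition admissible (k N : nat) (data : list (nat * C)) : Prop :=
  (forall p, In p data -> (0 < fst p)%nat /\ (snd p ^ N)%C = RtoC 1) /\
  fold_right (fun p acc => (fst p + acc)%nat) O data = k /\
  match data with
  | nil => True
  | (s1, z1) :: _ => ~ (s1 = 1%nat /\ z1 = RtoC 1)
  end.

Definition in_CMZV (k N : nat) (x : C) : Prop :=
  exists l : list (Q * list (nat * C) * C),
    (forall t, In t l -> admissible k N (snd (fst t)) /\ is_mpl (snd (fst t)) (snd t)) /\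
    x = fold_right (fun t acc => (RtoC (Q2R (fst (fst t))) * snd t + acc)%C) (RtoC 0) l.

Definition in_iCMZV (k N : nat) (x : C) : Prop :=
  exists y, in_CMZV k N y /\ x = (Ci * y)%C.

Definition GG : R := Im (Li 3 ((RtoC 1 + Ci) / RtoC 2)%C).

Definition rhs_value : R :=
  32 * GG / 3
  - 4 * PI * Re (Li 2 (RtoC (2 - sqrt 3))) / 3
  - PI ^ 3 / 9
  - PI * (ln 2 - ln (2 + sqrt 3)) ^ 2 / 3.

(* Main.v *)
Require Import Defs.
From Stdlib Require Import Reals QArith Qreals List Lra Lia.
From Coquelicot Require Import Coquelicot.
Import ListNotations.
Open Scope R_scope.

(** Substituting [k = 2 r / (1 + r^2)] in the iterated integrals of the arcsine-type series
    [sum 4^n k^(2n+1) / ((2n+1) C(2n, n))] turns them into polylogarithms; at [k = 1/2], that is at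
    [r = a := 2 - sqrt 3], the series becomes [Re (4 i B(- i a))], where [B] is a combination of
    multiple polylogarithms of weight 3 with [B'(w) = chi_2(w) (log (w / (1 - w^2)))'].

    Closed form: along [Y = s (1 + i)], [r = 2 s^2], comparison of derivatives expresses [Re (4 i B(- i r))]
    through logarithms, [Li_2(i r)] and [Li_3] at [Y / (Y - 1)], [1 / (1 + Y)], [+- Y], [+- (1 - Y) / (1 + Y)].
    At [s = (sqrt 3 - 1) / 2] [Y] and [(1 - Y) / (1 + Y)] are conjugate, and the first two have modulus [1 / sqrt 2] and
    arguments [7 pi / 12], [pi / 12] up to sign; a relation between the values [Im Li_3] on the curves
    [e^(i (k t + f)) / (2 cos t)] at [t = pi / 4] reduces them to [Im Li_3 ((1 + i) / 2)].

    Membership: with [w = (1 - u) / (1 + u)], the derivative of [B(w)] equals that of an explicit polynomial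
    [F(u)] in [pi^2], logarithms and multiple polylogarithms with arguments [u] and [- u].  On the arc
    [u = rho e^(i t)] the imaginary parts agree at [t = 0], hence at [t = pi / 6]; as [rho -> 1],
    [w] tends to [- i a] and, by Abel's theorem, [F(u)] tends to an element [v] of [Z_3(12)] (closed under
    products by the quasi-shuffle relation).  So the sum of the series is [- 4 Im v = i (2 (v - conj v))]. *)

(** The level is forced by the point: [a = tan (pi / 12)], and [(1 - u) / (1 + u) = - i tan (t / 2)]
    for [u = e^(i t)]. This map sends the forms [dw / w], [dw / (1 - w)], [dw / (1 + w)] to
    combinations of [du / u], [du / (1 - u)], [du / (1 + u)], so a level-2 iterated integral is
    evaluated at a primitive 12th root of unity. The closed form rests on a coincidence. On the
    diagonal [Y = s (1 + i)] the equation [(1 - Y) / (1 + Y) = conj Y] reads [2 s^2 + 2 s = 1], and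
    its positive root satisfies [2 s^2 = 2 - sqrt 3]. There the imaginary parts of the [chi_3] terms
    cancel. The obstacle is multivaluedness. Analytic continuation is avoided: each identity is
    checked along a path with real parameter inside the unit disc, logarithms being taken only in
    the right half-plane, and the constant is read off from one-sided limits, which may lie on the
    unit circle. Several identities compare only real or only imaginary parts; this removes real
    constants, such as [zeta(3)] or the regularized value of [B] at 1, that would otherwise have to
    be computed. *)

Lemma filterlim_C_iff {T : Type} (F : (T -> Prop) -> Prop) {FF : Filter F} (f : T -> C) (l : C) :
  filterlim f F (locally l) <->
  filterlim (fun t => Re (f t)) F (locally (Re l)) /\
  filterlim (fun t => Im (f t)) F (locally (Im l)).
Proof.
  rewrite !filterlim_locally; split.
  - intros H; split; intros eps; generalize (H eps); apply filter_imp; intros t [H1 H2]; assumption.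
  - intros [H1 H2] eps; generalize (filter_and _ _ (H1 eps) (H2 eps)).
    apply filter_imp; intros t [H3 H4]; split; assumption.
Qed.

Lemma Re_sum_n (a : nat -> C) (n : nat) : Re (sum_n a n) = sum_n (fun k => Re (a k)) n.
Proof. induction n; [now rewrite !sum_O | rewrite !sum_Sn, <- IHn; reflexivity]. Qed.

Lemma Im_sum_n (a : nat -> C) (n : nat) : Im (sum_n a n) = sum_n (fun k => Im (a k)) n.
Proof. induction n; [now rewrite !sum_O | rewrite !sum_Sn, <- IHn; reflexivity]. Qed.

(** * Convergent series of complex numbers *)

Definition is_Cseries (a : nat -> C) (l : C) : Prop :=
  is_series (fun n => Re (a n)) (Re l) /\ is_series (fun n => Im (a n)) (Im l).

Lemma is_Cseries_iff (a : nat -> C) (l : C) :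
  is_Cseries a l <-> filterlim (fun n => sum_n a n) eventually (locally l).
Proof.
  rewrite filterlim_C_iff by apply eventually_filter; unfold is_Cseries, is_series.
  split; intros [H1 H2]; split.
  - eapply filterlim_ext; [|exact H1]; intros n; symmetry; apply Re_sum_n.
  - eapply filterlim_ext; [|exact H2]; intros n; symmetry; apply Im_sum_n.
  - eapply filterlim_ext; [|exact H1]; intros n; apply Re_sum_n.
  - eapply filterlim_ext; [|exact H2]; intros n; apply Im_sum_n.
Qed.

Lemma is_Cseries_unique (a : nat -> C) (l : C) : is_Cseries a l -> CSeries a = l.
Proof.
  intros [H1 H2]; unfold CSeries; rewrite (is_series_unique _ _ H1), (is_series_unique _ _ H2).
  now destruct l.
Qed.

Lemma is_Cseries_ext (a b : nat -> C) (l : C) :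
  (forall n, a n = b n) -> is_Cseries a l -> is_Cseries b l.
Proof. intros E [H1 H2]; split; eapply is_series_ext; eauto; intros n; simpl; now rewrite E. Qed.

Lemma is_Cseries_plus (a b : nat -> C) (la lb : C) :
  is_Cseries a la -> is_Cseries b lb -> is_Cseries (fun n => a n + b n)%C (la + lb)%C.
Proof.
  intros [H1 H2] [H3 H4]; split; [exact (is_series_plus _ _ _ _ H1 H3) | exact (is_series_plus _ _ _ _ H2 H4)].
Qed.

Lemma is_Cseries_scal (k : C) (a : nat -> C) (l : C) :
  is_Cseries a l -> is_Cseries (fun n => k * a n)%C (k * l)%C.
Proof.
  intros [H1 H2]; split.
  - generalize (is_series_minus _ _ _ _ (is_series_scal (Re k) _ _ H1) (is_series_scal (Im k) _ _ H2)).
    apply is_series_ext; intros n; reflexivity.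
  - generalize (is_series_plus _ _ _ _ (is_series_scal (Re k) _ _ H2) (is_series_scal (Im k) _ _ H1)).
    apply is_series_ext; intros n; reflexivity.
Qed.

Lemma is_Cseries_incr_1 (a : nat -> C) (l : C) :
  is_Cseries (fun n => a (S n)) l -> is_Cseries a (a O + l)%C.
Proof.
  intros [H1 H2]; split; apply is_series_decr_1.
  - replace (plus _ _) with (Re l); [exact H1|].
    change (Re l = Re (a O) + Re l + - Re (a O)); ring.
  - replace (plus _ _) with (Im l); [exact H2|].
    change (Im l = Im (a O) + Im l + - Im (a O)); ring.
Qed.

Lemma im_le_Cmod (c : C) : Rabs (Im c) <= Cmod c.
Proof. eapply Rle_trans; [apply Rmax_r | apply Rmax_Cmod]. Qed.

Lemma CSeries_correct (a : nat -> C) (b : nat -> R) :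
  (forall n, Cmod (a n) <= b n) -> ex_series b -> is_Cseries a (CSeries a).
Proof.
  intros H Hb; split; apply Series_correct; apply ex_series_Rabs;
    apply (@ex_series_le R_AbsRing R_CompleteNormedModule _ b); auto; intros n; unfold norm; simpl;
    unfold abs; simpl; rewrite Rabs_Rabsolu; (eapply Rle_trans; [|apply H]).
  - apply re_le_Cmod.
  - apply im_le_Cmod.
Qed.

Lemma Cmod_sum_n_le (a : nat -> C) (b : nat -> R) (n : nat) :
  (forall n, Cmod (a n) <= b n) -> Cmod (sum_n a n) <= sum_n b n.
Proof.
  intros H; induction n; [now rewrite !sum_O|].
  rewrite !sum_Sn; eapply Rle_trans; [apply Cmod_triangle|].
  apply Rplus_le_compat; auto.
Qed.

Lemma is_Cseries_Cmod_le (a : nat -> C) (b : nat -> R) (l : C) (B : R) :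
  (forall n, Cmod (a n) <= b n) -> is_Cseries a l -> is_series b B -> Cmod l <= B.
Proof.
  intros H Ha Hb.
  apply (is_lim_seq_le (fun n => Cmod (sum_n a n)) (sum_n b) (Cmod l) B).
  - intros n; now apply Cmod_sum_n_le.
  - apply is_Cseries_iff in Ha.
    exact (filterlim_comp _ _ _ _ _ _ _ _ Ha (filterlim_norm (V := C_NormedModule) l)).
  - exact Hb.
Qed.

(** * Power series with complex coefficients *)

Definition PS (c : nat -> C) (x : C) : C := CSeries (fun n => c n * x ^ n)%C.

Lemma PS_bound (c : nat -> C) (M : R) (x : C) (r : R) (n : nat) :
  (forall n, Cmod (c n) <= M) -> Cmod x <= r -> Cmod (c n * x ^ n)%C <= M * r ^ n.
Proof.
  intros Hc Hx; rewrite Cmod_mult, Cmod_pow.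
  apply Rmult_le_compat; auto using Cmod_ge_0, pow_le.
  apply pow_incr; split; auto using Cmod_ge_0.
Qed.

Lemma ex_series_geom_M (M r : R) : 0 <= r < 1 -> ex_series (fun n => M * r ^ n).
Proof.
  intros Hr; apply (@ex_series_scal_l R_AbsRing).
  exists (/ (1 - r)); apply is_series_geom; rewrite Rabs_pos_eq; lra.
Qed.

Lemma PS_correct (c : nat -> C) (M : R) (x : C) :
  (forall n, Cmod (c n) <= M) -> Cmod x < 1 -> is_Cseries (fun n => c n * x ^ n)%C (PS c x).
Proof.
  intros Hc Hx; apply (CSeries_correct _ (fun n => M * Cmod x ^ n)).
  - intros n; apply PS_bound; auto; apply Rle_refl.
  - apply ex_series_geom_M; split; auto using Cmod_ge_0.
Qed.

(** Second-order Taylor bound for [x^n], by induction on [n]. Multiplying by [r^2] on the left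
    avoids the exponent [n - 2] on the right. *)
Lemma pow_remainder (x y : C) (r : R) (n : nat) :
  0 < r -> Cmod x <= r -> Cmod y <= r ->
  Cmod (y ^ n - x ^ n - RtoC (INR n) * x ^ pred n * (y - x))%C * r ^ 2
    <= INR n ^ 2 * r ^ n * Cmod (y - x) ^ 2.
Proof.
  intros Hr Hx Hy; induction n as [|n IH].
  - replace (_ - _ - _)%C with (RtoC 0) by (simpl; ring).
    rewrite Cmod_0; simpl; lra.
  - replace (y ^ S n - x ^ S n - RtoC (INR (S n)) * x ^ pred (S n) * (y - x))%C with
      (y * (y ^ n - x ^ n - RtoC (INR n) * x ^ pred n * (y - x))
        + RtoC (INR n) * x ^ pred n * ((y - x) * (y - x)))%C.
    2:{ rewrite S_INR, RtoC_plus; destruct n; simpl; ring. }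
    assert (H1 : Cmod (RtoC (INR n) * x ^ pred n * ((y - x) * (y - x)))%C * r ^ 2
       <= INR n * r ^ S n * Cmod (y - x) ^ 2).
    { rewrite !Cmod_mult, Cmod_R, Cmod_pow, Rabs_pos_eq by apply pos_INR.
      destruct n as [|n]; [simpl; lra|].
      replace (INR (S n) * Cmod x ^ pred (S n) * (Cmod (y - x) * Cmod (y - x)) * r ^ 2)
        with (INR (S n) * Cmod (y - x) ^ 2 * r ^ 2 * Cmod x ^ n) by (simpl; ring).
      replace (INR (S n) * r ^ S (S n) * Cmod (y - x) ^ 2)
        with (INR (S n) * Cmod (y - x) ^ 2 * r ^ 2 * r ^ n) by (simpl; ring).
      apply Rmult_le_compat_l.
      - apply Rmult_le_pos; [|apply pow2_ge_0]; apply Rmult_le_pos; [apply pos_INR|apply pow2_ge_0].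
      - apply pow_incr; split; auto using Cmod_ge_0. }
    assert (H2 : Cmod (y * (y ^ n - x ^ n - RtoC (INR n) * x ^ pred n * (y - x)))%C * r ^ 2
       <= INR n ^ 2 * r ^ S n * Cmod (y - x) ^ 2).
    { rewrite Cmod_mult, Rmult_assoc.
      replace (INR n ^ 2 * r ^ S n * Cmod (y - x) ^ 2) with
        (r * (INR n ^ 2 * r ^ n * Cmod (y - x) ^ 2)) by (simpl; ring).
      apply Rmult_le_compat; auto using Cmod_ge_0.
      apply Rmult_le_pos; [apply Cmod_ge_0|apply pow2_ge_0]. }
    eapply Rle_trans.
    + apply Rmult_le_compat_r; [apply pow2_ge_0|apply Cmod_triangle].
    + rewrite Rmult_plus_distr_r; eapply Rle_trans; [apply Rplus_le_compat; eassumption|].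
      rewrite S_INR.
      replace ((INR n + 1) ^ 2 * r ^ S n * Cmod (y - x) ^ 2) with
        (INR n ^ 2 * r ^ S n * Cmod (y - x) ^ 2 + INR n * r ^ S n * Cmod (y - x) ^ 2
         + (INR n + 1) * r ^ S n * Cmod (y - x) ^ 2) by ring.
      assert (0 <= (INR n + 1) * r ^ S n * Cmod (y - x) ^ 2).
      { apply Rmult_le_pos; [|apply pow2_ge_0]; apply Rmult_le_pos.
        - generalize (pos_INR n); lra.
        - apply pow_le; lra. }
      lra.
Qed.

Lemma ex_series_poly_geom (r : R) : 0 < r < 1 -> ex_series (fun n => INR n ^ 2 * r ^ n).
Proof.
  intros Hr; apply ex_series_incr_1.
  apply (ex_series_ext (fun n => Rabs (INR (S n) ^ 2 * r ^ S n))).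
  { intros n; apply Rabs_pos_eq; apply Rmult_le_pos; apply pow_le; [apply pos_INR|lra]. }
  apply (ex_series_DAlembert _ r); [lra| |].
  - intros n; apply Rmult_integral_contrapositive_currified; apply pow_nonzero; [apply not_0_INR; lia|lra].
  - apply (is_lim_seq_ext (fun n => (1 + / INR (S n)) * (1 + / INR (S n)) * r)).
    { intros n; rewrite Rabs_pos_eq.
      - rewrite (S_INR (S n)), <- (tech_pow_Rmult r (S n)).
        assert (H1 : INR (S n) <> 0) by (apply not_0_INR; lia).
        assert (H2 : r ^ S n <> 0) by (apply pow_nonzero; lra).
        field; auto.
      - apply Rmult_le_pos; [apply Rmult_le_pos; apply pow_le; [apply pos_INR|lra]|].
        left; apply Rinv_0_lt_compat; apply Rmult_lt_0_compat; apply pow_lt; [apply lt_0_INR; lia|lra]. }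
    assert (H : is_lim_seq (fun n => / INR (S n)) 0).
    { apply (is_lim_seq_incr_1 (fun n => / INR n)).
      replace (Finite 0) with (Rbar_inv p_infty) by reflexivity.
      apply is_lim_seq_inv; [apply is_lim_seq_INR|easy]. }
    replace (Finite r) with (Finite ((1 + 0) * (1 + 0) * r)) by (f_equal; ring).
    apply (is_lim_seq_mult' _ (fun _ => r)); [|apply is_lim_seq_const].
    apply is_lim_seq_mult'; apply is_lim_seq_plus'; auto using is_lim_seq_const.
Qed.

Definition PSd (c : nat -> C) (x : C) : C :=
  CSeries (fun n => c n * (RtoC (INR n) * x ^ pred n))%C.

Lemma PSd_correct (c : nat -> C) (M : R) (x : C) :
  (forall n, Cmod (c n) <= M) -> Cmod x < 1 ->
  is_Cseries (fun n => c n * (RtoC (INR n) * x ^ pred n))%C (PSd c x).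
Proof.
  intros Hc Hx.
  assert (HM : 0 <= M) by (eapply Rle_trans; [apply Cmod_ge_0|apply (Hc O)]).
  pose (r := (Cmod x + 1) / 2).
  assert (Hr : Cmod x <= r /\ 0 < r < 1) by (generalize (Cmod_ge_0 x); unfold r; lra).
  apply (CSeries_correct _ (fun n => (M / r) * (INR n ^ 2 * r ^ n))).
  - intros n; rewrite !Cmod_mult, Cmod_R, Cmod_pow, Rabs_pos_eq by apply pos_INR.
    replace (M / r * (INR n ^ 2 * r ^ n)) with (M * (INR n ^ 2 * (r ^ n / r))) by (field; lra).
    apply Rmult_le_compat; auto using Cmod_ge_0.
    { apply Rmult_le_pos; [apply pos_INR|apply pow_le, Cmod_ge_0]. }
    destruct n as [|n]; [simpl; lra|].
    replace (r ^ S n / r) with (r ^ n) by (simpl; field; lra).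
    apply Rmult_le_compat; auto using pos_INR; [apply pow_le, Cmod_ge_0| |].
    + rewrite S_INR; generalize (pos_INR n); intros; nra.
    + simpl; apply pow_incr; split; [apply Cmod_ge_0|tauto].
  - apply (@ex_series_scal_l R_AbsRing), ex_series_poly_geom; tauto.
Qed.

Lemma PS_remainder (c : nat -> C) (M r : R) : (forall n, Cmod (c n) <= M) -> 0 < r < 1 ->
  exists K, forall x y, Cmod x <= r -> Cmod y <= r ->
    Cmod (PS c y - PS c x - PSd c x * (y - x))%C <= K * Cmod (y - x) ^ 2.
Proof.
  intros Hc Hr.
  assert (HM : 0 <= M) by (eapply Rle_trans; [apply Cmod_ge_0|apply (Hc O)]).
  destruct (ex_series_poly_geom r Hr) as [B HB].
  exists (M / r ^ 2 * B); intros x y Hx Hy.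
  apply (is_Cseries_Cmod_le
    (fun n => c n * y ^ n + (- (1)) * (c n * x ^ n) + - (y - x) * (c n * (RtoC (INR n) * x ^ pred n)))%C
    (fun n => (M / r ^ 2 * Cmod (y - x) ^ 2) * (INR n ^ 2 * r ^ n))).
  - intros n.
    replace (_ + _ + _)%C with
      (c n * (y ^ n - x ^ n - RtoC (INR n) * x ^ pred n * (y - x)))%C by ring.
    rewrite Cmod_mult.
    replace (M / r ^ 2 * Cmod (y - x) ^ 2 * (INR n ^ 2 * r ^ n)) with
      (M * ((INR n ^ 2 * r ^ n * Cmod (y - x) ^ 2) / r ^ 2)) by (field; lra).
    apply Rmult_le_compat; auto using Cmod_ge_0.
    apply Rle_div_r; [apply pow_lt; lra|]. apply pow_remainder; tauto.
  - replace (PS c y - PS c x - PSd c x * (y - x))%C with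
      (PS c y + (- (1)) * PS c x + - (y - x) * PSd c x)%C by ring.
    apply is_Cseries_plus; [apply is_Cseries_plus|]; [|apply is_Cseries_scal|apply is_Cseries_scal].
    + apply (PS_correct c M); auto; lra.
    + apply (PS_correct c M); auto; lra.
    + apply (PSd_correct c M); auto; lra.
  - replace (M / r ^ 2 * B * Cmod (y - x) ^ 2) with (M / r ^ 2 * Cmod (y - x) ^ 2 * B) by ring.
    now apply (@is_series_scal_l R_AbsRing).
Qed.

(** * Complex functions of a real variable *)

(** Only paths with a real parameter are ever differentiated, so complex differentiability is not
    developed; componentwise derivatives make the real mean value theorem available. *)
Definition dC (f : R -> C) (t : R) (l : C) : Prop :=
  is_derive (fun s => Re (f s)) t (Re l) /\ is_derive (fun s => Im (f s)) t (Im l).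

Lemma dC_ext (f g : R -> C) (t : R) (l : C) :
  (forall s, f s = g s) -> dC f t l -> dC g t l.
Proof. intros E [H1 H2]; split; eapply is_derive_ext; eauto; intros s; simpl; now rewrite E. Qed.

Lemma dC_eq (f : R -> C) (t : R) (l l' : C) : l = l' -> dC f t l -> dC f t l'.
Proof. now intros ->. Qed.

Lemma dC_const (c : C) (t : R) : dC (fun _ => c) t 0%C.
Proof. split; apply (@is_derive_const R_AbsRing). Qed.

Lemma dC_plus (f g : R -> C) (t : R) (l m : C) :
  dC f t l -> dC g t m -> dC (fun s => f s + g s)%C t (l + m)%C.
Proof. intros [H1 H2] [H3 H4]; split; now apply (@is_derive_plus R_AbsRing R_NormedModule). Qed.

Lemma dC_opp (f : R -> C) (t : R) (l : C) : dC f t l -> dC (fun s => - f s)%C t (- l)%C.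
Proof. intros [H1 H2]; split; now apply (@is_derive_opp R_AbsRing R_NormedModule). Qed.

Lemma dC_minus (f g : R -> C) (t : R) (l m : C) :
  dC f t l -> dC g t m -> dC (fun s => f s - g s)%C t (l - m)%C.
Proof. intros H1 H2; now apply dC_plus, dC_opp. Qed.

Lemma dC_mult (f g : R -> C) (t : R) (l m : C) :
  dC f t l -> dC g t m -> dC (fun s => f s * g s)%C t (l * g t + f t * m)%C.
Proof.
  intros [H1 H2] [H3 H4]; split.
  - evar_last.
    + apply (@is_derive_minus R_AbsRing R_NormedModule); [apply (is_derive_mult _ _ _ _ _ H1 H3)|apply (is_derive_mult _ _ _ _ _ H2 H4)];
        intros; apply Rmult_comm.
    + unfold minus, plus, opp, mult; simpl; unfold Re, Im; ring.
  - evar_last.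
    + apply (@is_derive_plus R_AbsRing R_NormedModule); [apply (is_derive_mult _ _ _ _ _ H1 H4)|apply (is_derive_mult _ _ _ _ _ H2 H3)];
        intros; apply Rmult_comm.
    + unfold minus, plus, opp, mult; simpl; unfold Re, Im; ring.
Qed.

Lemma dC_RtoC (f : R -> R) (t l : R) : is_derive f t l -> dC (fun s => RtoC (f s)) t (RtoC l).
Proof. intros H; split; [exact H|]; exact (@is_derive_const R_AbsRing R_NormedModule 0 t). Qed.

Lemma dC_scal (c : C) (f : R -> C) (t : R) (l : C) : dC f t l -> dC (fun s => c * f s)%C t (c * l)%C.
Proof.
  intros H; apply (dC_eq _ _ (0 * f t + c * l)%C); [ring|].
  apply (dC_mult (fun _ => c)); auto using dC_const.
Qed.

(** The difference quotient of [f] is dominated by [K] times that of [q], which tends to 0. It is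
    applied to Taylor remainders, with [q] a squared distance. *)
Lemma is_derive_squeeze_0 (f q : R -> R) (K t : R) :
  locally t (fun s => Rabs (f s) <= K * q s) -> (forall s, 0 <= q s) -> f t = 0 -> q t = 0 ->
  is_derive q t 0 -> is_derive f t 0.
Proof.
  intros [d Hd] Hp Hf Hq Dq.
  apply is_derive_Reals; apply is_derive_Reals in Dq.
  intros eps Heps.
  pose (K' := Rmax K 1).
  assert (HK : 0 < K') by (generalize (Rmax_r K 1); unfold K'; lra).
  destruct (Dq (eps / K')) as [d2 Hd2]; [now apply Rdiv_lt_0_compat|].
  assert (Hm : 0 < Rmin d d2) by (apply Rmin_pos; apply cond_pos).
  exists (mkposreal _ Hm); intros h Hh0 Hh; simpl in Hh.
  specialize (Hd2 h Hh0 (Rlt_le_trans _ _ _ Hh (Rmin_r _ _))).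
  rewrite Hq, !Rminus_0_r in Hd2; rewrite Hf, !Rminus_0_r.
  assert (B : Rabs (f (t + h)) <= K * q (t + h)).
  { apply Hd; unfold ball; simpl; unfold AbsRing_ball, abs, minus, plus, opp; simpl.
    replace (t + h + - t) with h by ring; eapply Rlt_le_trans; [exact Hh|apply Rmin_l]. }
  assert (B2 : Rabs (f (t + h)) <= K' * Rabs (q (t + h))).
  { rewrite (Rabs_pos_eq (q (t + h))) by auto.
    eapply Rle_trans; [exact B|]; apply Rmult_le_compat_r; [auto|apply Rmax_l]. }
  unfold Rdiv; rewrite Rabs_mult; unfold Rdiv in Hd2; rewrite Rabs_mult in Hd2.
  eapply Rle_lt_trans; [apply Rmult_le_compat_r; [apply Rabs_pos|exact B2]|].
  replace eps with (K' * (eps * / K')) by (field; lra).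
  rewrite Rmult_assoc; now apply Rmult_lt_compat_l.
Qed.

Lemma is_derive_sqr_diff (f : R -> R) (t l : R) :
  is_derive f t l -> is_derive (fun s => (f s - f t) ^ 2) t 0.
Proof.
  intros H; evar_last.
  - apply is_derive_pow; apply (@is_derive_minus R_AbsRing R_NormedModule); [exact H|exact (@is_derive_const R_AbsRing R_NormedModule (f t) t)].
  - simpl; ring.
Qed.

Lemma dC_PS (c : nat -> C) (M : R) (x : R -> C) (t : R) (x' : C) :
  (forall n, Cmod (c n) <= M) -> Cmod (x t) < 1 -> dC x t x' ->
  dC (fun s => PS c (x s)) t (PSd c (x t) * x')%C.
Proof.
  intros Hc Hx [D1 D2].
  pose (r := (Cmod (x t) + 1) / 2).
  assert (Hr : Cmod (x t) < r /\ 0 < r < 1) by (generalize (Cmod_ge_0 (x t)); unfold r; lra).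
  destruct (PS_remainder c M r Hc (proj2 Hr)) as [K HK].
  (* The squared distance from [x t] is a polynomial in the coordinates, hence differentiable with
     derivative 0 at [t]; the Taylor remainder of the power series is at most [K * q]. *)
  pose (q := fun s => (Re (x s) - Re (x t)) ^ 2 + (Im (x s) - Im (x t)) ^ 2).
  assert (Hq : forall s, q s = Cmod (x s - x t) ^ 2).
  { intros s; rewrite Cmod2_alt; reflexivity. }
  assert (Dq : is_derive q t 0).
  { unfold q; rewrite <- (Rplus_0_r 0).
    apply (@is_derive_plus R_AbsRing R_NormedModule); eapply is_derive_sqr_diff; eassumption. }
  assert (Hloc : locally t (fun s => Cmod (x s) <= r)).
  { assert (Cq : filterlim q (locally t) (locally (q t))).
    { apply (ex_derive_continuous (K := R_AbsRing) (V := R_NormedModule) q t); eexists; exact Dq. }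
    assert (E : 0 < (r - Cmod (x t)) ^ 2) by (apply pow_lt; lra).
    assert (L : locally t (fun s => q s < (r - Cmod (x t)) ^ 2)).
    { apply (Cq (fun y => y < (r - Cmod (x t)) ^ 2)); apply (open_lt _ (q t)).
      replace (q t) with 0 by (unfold q; ring); lra. }
    revert L; apply filter_imp; intros s Hs; rewrite Hq in Hs.
    assert (Hs' : Cmod (x s - x t)%C < r - Cmod (x t)).
    { apply Rnot_le_lt; intros H; apply (Rlt_irrefl (Cmod (x s - x t) ^ 2)).
      eapply Rlt_le_trans; [exact Hs|]; apply pow_incr; lra. }
    replace (x s) with ((x s - x t) + x t)%C by ring.
    eapply Rle_trans; [apply Cmod_triangle|lra]. }
  pose (g := fun s => (PS c (x s) - PS c (x t) - PSd c (x t) * (x s - x t))%C).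
  assert (Bg : locally t (fun s => Cmod (g s) <= K * q s)).
  { revert Hloc; apply filter_imp; intros s Hs; rewrite Hq; unfold g.
    exact (HK (x t) (x s) (Rlt_le _ _ (proj1 Hr)) Hs). }
  assert (g0 : g t = RtoC 0) by (unfold g; ring).
  assert (q0 : q t = 0) by (unfold q; ring).
  assert (Dg : dC g t 0%C).
  { split; apply (is_derive_squeeze_0 _ q K); auto; try (now rewrite g0);
      try (intros s; rewrite Hq; apply pow2_ge_0);
      revert Bg; apply filter_imp; intros s Hs; eapply Rle_trans; [|exact Hs| |exact Hs].
    - apply re_le_Cmod.
    - apply im_le_Cmod. }
  apply (dC_ext (fun s => g s + (PSd c (x t) * x s + (PS c (x t) - PSd c (x t) * x t)))%C).
  { intros s; unfold g; ring. }
  apply (dC_eq _ _ (0 + (PSd c (x t) * x' + 0))%C); [ring|].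
  apply dC_plus; [exact Dg|]; apply dC_plus; [|apply dC_const].
  apply dC_scal; split; assumption.
Qed.

(** * Limits along a real parameter *)

Lemma dC_filterlim (f : R -> C) (t : R) (l : C) : dC f t l -> filterlim f (locally t) (locally (f t)).
Proof.
  intros [H1 H2]; apply filterlim_C_iff; [apply locally_filter|]; split;
    apply (ex_derive_continuous (K := R_AbsRing) (V := R_NormedModule)); eexists; eassumption.
Qed.

Lemma at_right_le_locally (t : R) : filter_le (at_right t) (locally t).
Proof. intros P H; unfold at_right, within; revert H; apply filter_imp; auto. Qed.

Lemma at_left_le_locally (t : R) : filter_le (at_left t) (locally t).
Proof. intros P H; unfold at_left, within; revert H; apply filter_imp; auto. Qed.

Lemma dC_at_left (f : R -> C) (t : R) (l : C) : dC f t l -> filterlim f (at_left t) (locally (f t)).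
Proof. intros H; eapply filterlim_filter_le_1; [apply at_left_le_locally|]; eapply dC_filterlim; eauto. Qed.

Lemma dC_at_right (f : R -> C) (t : R) (l : C) : dC f t l -> filterlim f (at_right t) (locally (f t)).
Proof. intros H; eapply filterlim_filter_le_1; [apply at_right_le_locally|]; eapply dC_filterlim; eauto. Qed.

Section Clim.
Context {T : Type} (F : (T -> Prop) -> Prop) {FF : Filter F}.

Lemma Clim_eq (f : T -> C) (l m : C) : l = m ->
  filterlim f F (locally l) -> filterlim f F (locally m).
Proof. now intros ->. Qed.

Lemma Clim_plus (f g : T -> C) (l m : C) :
  filterlim f F (locally l) -> filterlim g F (locally m) ->
  filterlim (fun t => f t + g t)%C F (locally (l + m)%C).
Proof. intros H1 H2; exact (filterlim_comp_2 (F := F) f g (plus (G := C_AbelianMonoid)) H1 H2 (filterlim_plus (V := C_NormedModule) l m)). Qed.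

Lemma Clim_mult (f g : T -> C) (l m : C) :
  filterlim f F (locally l) -> filterlim g F (locally m) ->
  filterlim (fun t => f t * g t)%C F (locally (l * m)%C).
Proof.
  rewrite !filterlim_C_iff by assumption; intros [H1 H2] [H3 H4]; split.
  - exact (filterlim_comp_2 (F := F) _ _ Rplus
      (filterlim_comp_2 (F := F) _ _ Rmult H1 H3 (filterlim_mult (K := R_AbsRing) (Re l) (Re m)))
      (filterlim_comp _ _ _ _ _ _ _ _
        (filterlim_comp_2 (F := F) _ _ Rmult H2 H4 (filterlim_mult (K := R_AbsRing) (Im l) (Im m)))
        (filterlim_opp (V := R_NormedModule) (Im l * Im m)))
      (filterlim_plus (V := R_NormedModule) _ _)).
  - exact (filterlim_comp_2 (F := F) _ _ Rplus
      (filterlim_comp_2 (F := F) _ _ Rmult H1 H4 (filterlim_mult (K := R_AbsRing) (Re l) (Im m)))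
      (filterlim_comp_2 (F := F) _ _ Rmult H2 H3 (filterlim_mult (K := R_AbsRing) (Im l) (Re m)))
      (filterlim_plus (V := R_NormedModule) _ _)).
Qed.

Lemma Clim_opp (f : T -> C) (l : C) :
  filterlim f F (locally l) -> filterlim (fun t => - f t)%C F (locally (- l)%C).
Proof. intros H; exact (filterlim_comp _ _ _ _ _ _ _ _ H (filterlim_opp (V := C_NormedModule) l)). Qed.

Lemma Clim_minus (f g : T -> C) (l m : C) :
  filterlim f F (locally l) -> filterlim g F (locally m) ->
  filterlim (fun t => f t - g t)%C F (locally (l - m)%C).
Proof. intros H1 H2; now apply Clim_plus, Clim_opp. Qed.

Lemma Clim_unique (f : T -> C) (l m : C) : ProperFilter F ->
  filterlim f F (locally l) -> filterlim f F (locally m) -> l = m.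
Proof. intros PF; exact (filterlim_locally_unique (V := C_R_NormedModule) f l m). Qed.

End Clim.

(** Differentiability is assumed only on the open interval. This is what permits endpoints on the
    unit circle, where polylogarithms are merely continuous, and endpoints where a logarithm
    diverges but the whole expression converges. *)
Lemma deriv_0_limits (f : R -> R) (a b la lb : R) : a < b ->
  (forall t, a < t < b -> is_derive f t 0) ->
  filterlim f (at_right a) (locally la) -> filterlim f (at_left b) (locally lb) -> la = lb.
Proof.
  intros Hab Hd Ha Hb.
  pose (m := (a + b) / 2); assert (Hm : a < m < b) by (unfold m; lra).
  assert (Hc : forall t, a < t < b -> f t = f m).
  { intros t Ht.
    assert (Hin : forall x, Rmin t m <= x <= Rmax t m -> a < x < b).
    { intros x Hx; revert Hx; unfold Rmin, Rmax; destruct (Rle_dec t m); lra. }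
    destruct (MVT_gen f t m (fun _ => 0)) as [c [_ Hc]].
    - intros x Hx; apply Hd, Hin; lra.
    - intros x Hx; apply continuity_pt_filterlim.
      apply (ex_derive_continuous (K := R_AbsRing) (V := R_NormedModule)); eexists; apply Hd, Hin; lra.
    - lra. }
  transitivity (f m); [|symmetry].
  - apply (filterlim_locally_unique (F := at_right a) (V := R_NormedModule) f); [exact Ha|].
    apply (filterlim_ext_loc (fun _ => f m)); [|apply filterlim_const].
    exists (mkposreal (b - a) ltac:(lra)); intros y Hy Hay; symmetry; apply Hc; split; [exact Hay|].
    unfold ball in Hy; simpl in Hy; unfold AbsRing_ball, abs, minus, plus, opp in Hy; simpl in Hy.
    apply Rabs_def2 in Hy; lra.
  - apply (filterlim_locally_unique (F := at_left b) (V := R_NormedModule) f); [exact Hb|].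
    apply (filterlim_ext_loc (fun _ => f m)); [|apply filterlim_const].
    exists (mkposreal (b - a) ltac:(lra)); intros y Hy Hay; symmetry; apply Hc; split; [|exact Hay].
    unfold ball in Hy; simpl in Hy; unfold AbsRing_ball, abs, minus, plus, opp in Hy; simpl in Hy.
    apply Rabs_def2 in Hy; lra.
Qed.

Lemma dC_0_limits (f : R -> C) (a b : R) (la lb : C) : a < b ->
  (forall t, a < t < b -> dC f t 0%C) ->
  filterlim f (at_right a) (locally la) -> filterlim f (at_left b) (locally lb) -> la = lb.
Proof.
  intros Hab Hd Ha Hb.
  rewrite filterlim_C_iff in Ha by typeclasses eauto; rewrite filterlim_C_iff in Hb by typeclasses eauto.
  rewrite (surjective_pairing la), (surjective_pairing lb); f_equal.
  - apply (deriv_0_limits (fun t => Re (f t)) a b); [auto|intros; now apply Hd|tauto|tauto].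
  - apply (deriv_0_limits (fun t => Im (f t)) a b); [auto|intros; now apply Hd|tauto|tauto].
Qed.

(** The principal logarithm on the right half-plane; elsewhere the value is junk. *)
Definition Clog (z : C) : C := (ln (Re z ^ 2 + Im z ^ 2) / 2, atan (Im z / Re z)).

Arguments Clog : simpl never.

Lemma dC_Clog (f : R -> C) (t : R) (l : C) :
  0 < Re (f t) -> dC f t l -> dC (fun s => Clog (f s)) t (l / f t)%C.
Proof.
  intros Hp [H1 H2].
  assert (Hq : 0 < Re (f t) ^ 2 + Im (f t) ^ 2) by nra.
  split; unfold Clog; simpl Re; simpl Im.
  - evar_last.
    + refine (is_derive_scal_l (V := R_NormedModule) (fun s => ln (Re (f s) ^ 2 + Im (f s) ^ 2)) t _ (/ 2) _).
      apply (is_derive_comp (V := R_NormedModule) ln); [now apply is_derive_ln|].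
      apply (@is_derive_plus R_AbsRing R_NormedModule); apply is_derive_pow; eassumption.
    + unfold scal, plus, mult; simpl; unfold mult; simpl; unfold Re, Im in *. field. simpl in Hq; lra.
  - evar_last.
    + apply (is_derive_comp (V := R_NormedModule) atan); [apply is_derive_atan|].
      apply is_derive_div; try eassumption; lra.
    + unfold scal, plus, mult; simpl; unfold mult, Rsqr; simpl; unfold Re, Im in *. field.
      repeat split; nra.
Qed.

Lemma Re_gt_1_sub (z : C) : Cmod z < 1 -> 0 < Re (1 - z)%C.
Proof.
  intros H; generalize (re_le_Cmod z); intros H1; apply Rle_lt_trans with (2 := H) in H1.
  apply Rabs_def2 in H1; unfold Re in *; simpl; lra.
Qed.

Lemma dC_div (f g : R -> C) (t : R) (l m : C) : g t <> 0%C ->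
  dC f t l -> dC g t m -> dC (fun s => f s / g s)%C t ((l * g t - f t * m) / (g t * g t))%C.
Proof.
  intros Hn Hf [H1 H2].
  assert (Hq : 0 < Re (g t) ^ 2 + Im (g t) ^ 2).
  { rewrite <- Cmod2_alt; apply pow_lt; now apply Cmod_gt_0. }
  apply (dC_eq _ _ (l * / g t + f t * (- m / (g t * g t)))%C); [field; exact Hn|].
  apply dC_mult; [exact Hf|].
  assert (Dq : is_derive (fun s => Re (g s) ^ 2 + Im (g s) ^ 2) t (2 * Re (g t) * Re m + 2 * Im (g t) * Im m)).
  { evar_last.
    - apply (@is_derive_plus R_AbsRing R_NormedModule); apply is_derive_pow; eassumption.
    - unfold plus; simpl; ring. }
  assert (D2 : is_derive (fun s => - Im (g s)) t (- Im m)) by now apply (@is_derive_opp R_AbsRing R_NormedModule).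
  split.
  - evar_last.
    + unfold Cinv; simpl; apply is_derive_div; [exact H1|exact Dq|apply Rgt_not_eq; exact Hq].
    + unfold Re, Im in *; simpl in *; field; split; apply Rgt_not_eq; [|nra].
      match goal with |- ?e > 0 => replace e with ((fst (g t) * (fst (g t) * 1) + snd (g t) * (snd (g t) * 1)) ^ 2) by ring end.
      now apply pow_lt.
  - evar_last.
    + unfold Cinv; simpl; apply is_derive_div; [exact D2|exact Dq|apply Rgt_not_eq; exact Hq].
    + unfold Re, Im in *; simpl in *; field; split; apply Rgt_not_eq; [|nra].
      match goal with |- ?e > 0 => replace e with ((fst (g t) * (fst (g t) * 1) + snd (g t) * (snd (g t) * 1)) ^ 2) by ring end.
      now apply pow_lt.
Qed.

(** * Multiple polylogarithms as power series in the outermost variable *)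

Definition wf (d : list (nat * C)) : Prop :=
  List.Forall (fun p => (0 < fst p)%nat /\ Cmod (snd p) <= 1) d.

(** A variable [x] is attached to the largest index: [cf d n] is the coefficient of [x^n], and
    [x = 1] gives back the multiple polylogarithm. *)
Definition cf (d : list (nat * C)) (n : nat) : C :=
  match d with
  | [] => 0%C
  | (s, z) :: r => (z ^ n / RtoC (INR n ^ s) * mpl_trunc r (pred n))%C
  end.

Lemma mpl_trunc_S (s : nat) (z : C) (r : list (nat * C)) (n : nat) :
  mpl_trunc ((s, z) :: r) (S n) = (mpl_trunc ((s, z) :: r) n + cf ((s, z) :: r) (S n))%C.
Proof. reflexivity. Qed.

Lemma mpl_trunc_0 (p : nat * C) (r : list (nat * C)) : mpl_trunc (p :: r) 0 = 0%C.
Proof. now destruct p. Qed.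

Lemma Cinv_0 : (/ 0)%C = 0%C.
Proof. unfold Cinv, RtoC; simpl; f_equal; unfold Rdiv; ring. Qed.

(** A positive exponent makes the denominator [0 ^ s] vanish, and the inverse of 0 is 0; so the
    series effectively starts at 1. *)
Lemma cf_0 (d : list (nat * C)) : wf d -> cf d 0 = 0%C.
Proof.
  destruct d as [|[s z] r]; [easy|]; intros H; inversion_clear H as [|? ? [H1 _] _]; simpl in H1.
  unfold cf, Cdiv; rewrite pow_i by exact H1; rewrite Cinv_0; ring.
Qed.

Lemma sqrt_S_INR_step (n : nat) : 2 * sqrt (INR n) + / sqrt (INR (S n)) <= 2 * sqrt (INR (S n)).
Proof.
  assert (H0 : 0 <= sqrt (INR n)) by apply sqrt_pos.
  assert (H1 : 0 < sqrt (INR (S n))) by (apply sqrt_lt_R0, lt_0_INR; lia).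
  assert (E0 : sqrt (INR n) * sqrt (INR n) = INR n) by (apply sqrt_sqrt, pos_INR).
  assert (E1 : sqrt (INR (S n)) * sqrt (INR (S n)) = INR n + 1).
  { rewrite sqrt_sqrt by apply pos_INR; apply S_INR. }
  apply (Rmult_le_reg_r (sqrt (INR (S n)))); [exact H1|].
  rewrite Rmult_plus_distr_r, Rinv_l by lra.
  nra.
Qed.

Lemma sqrt_INR_le_S (n : nat) : sqrt (INR n) <= sqrt (INR (S n)).
Proof. apply sqrt_le_1_alt; rewrite S_INR; lra. Qed.

Lemma INR_pow_ge_1 (n s : nat) : (0 < n)%nat -> 1 <= INR n ^ s.
Proof. intros H; apply pow_R1_Rle; apply (le_INR 1); lia. Qed.

Lemma wf_cons (s : nat) (z : C) (r : list (nat * C)) :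
  wf ((s, z) :: r) -> (0 < s)%nat /\ Cmod z <= 1 /\ wf r.
Proof. intros H; inversion_clear H as [|? ? [H1 H2] H3]; auto. Qed.

Lemma RtoC_neq_0 (x : R) : x <> 0 -> RtoC x <> 0%C.
Proof. intros H E; apply H; now apply RtoC_inj. Qed.

Lemma cf_bound_of_trunc (s : nat) (z : C) (r : list (nat * C)) (M : R) (n : nat) :
  Cmod z <= 1 -> Cmod (mpl_trunc r n) <= M * sqrt (INR (S n)) ->
  Cmod (cf ((s, z) :: r) (S n)) <= M * sqrt (INR (S n)) / INR (S n) ^ s.
Proof.
  intros Hz HM.
  assert (Hs : 1 <= INR (S n) ^ s) by (apply INR_pow_ge_1; lia).
  unfold cf; rewrite Cmod_mult, Cmod_div, Cmod_pow, Cmod_R, (Rabs_pos_eq (INR _ ^ _)) by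
    (lra || (apply RtoC_neq_0; lra)).
  simpl pred.
  assert (Hp : 0 <= Cmod z ^ S n <= 1).
  { split; [apply pow_le, Cmod_ge_0|]; rewrite <- (pow1 (S n)); apply pow_incr; auto using Cmod_ge_0. }
  replace (Cmod z ^ S n / INR (S n) ^ s * Cmod (mpl_trunc r n)) with
    (Cmod z ^ S n * Cmod (mpl_trunc r n) / INR (S n) ^ s) by (unfold Rdiv; ring).
  apply Rmult_le_compat_r; [left; apply Rinv_0_lt_compat; lra|].
  generalize (Cmod_ge_0 (mpl_trunc r n)); nra.
Qed.

(** The true growth is a power of [log n]. The bound by a square root is chosen because it is stable
    under induction on the depth: a further index with exponent at least 1 contributes at most the
    sum of [1 / sqrt k], which is at most [2 sqrt n]. It still makes the coefficients [O(n^(-3/2))]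
    when the outermost exponent is at least 2. *)
Lemma mpl_trunc_bound (d : list (nat * C)) (n : nat) :
  wf d -> Cmod (mpl_trunc d n) <= 2 ^ length d * sqrt (INR (S n)).
Proof.
  revert n; induction d as [|[s z] r IH]; intros n Hd.
  - simpl mpl_trunc; rewrite Cmod_1; simpl length; rewrite pow_O, Rmult_1_l.
    rewrite <- sqrt_1 at 1; apply sqrt_le_1_alt; rewrite S_INR; generalize (pos_INR n); lra.
  - destruct (wf_cons _ _ _ Hd) as [Hs [Hz Hr]].
    assert (P : 0 < 2 ^ length r) by (apply pow_lt; lra).
    enough (H : Cmod (mpl_trunc ((s, z) :: r) n) <= 2 ^ length r * (2 * sqrt (INR n))).
    { eapply Rle_trans; [exact H|]; simpl length; simpl (2 ^ S _).
      generalize (sqrt_INR_le_S n); nra. }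
    induction n as [|n IHn].
    + rewrite mpl_trunc_0, Cmod_0; simpl INR; rewrite sqrt_0; lra.
    + rewrite mpl_trunc_S; eapply Rle_trans; [apply Cmod_triangle|].
      eapply Rle_trans; [apply Rplus_le_compat; [exact IHn|apply cf_bound_of_trunc; [exact Hz|now apply IH]]|].
      apply Rle_trans with (2 ^ length r * (2 * sqrt (INR n) + / sqrt (INR (S n)))).
      * rewrite Rmult_plus_distr_l; apply Rplus_le_compat_l.
        unfold Rdiv; rewrite Rmult_assoc; apply Rmult_le_compat_l; [lra|].
        assert (Q : 0 < sqrt (INR (S n))) by (apply sqrt_lt_R0, lt_0_INR; lia).
        apply (Rmult_le_reg_r (sqrt (INR (S n)))); [exact Q|].
        rewrite Rinv_l by lra.
        replace (sqrt (INR (S n)) * / INR (S n) ^ s * sqrt (INR (S n))) with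
          ((sqrt (INR (S n)) * sqrt (INR (S n))) * / INR (S n) ^ s) by ring.
        rewrite sqrt_sqrt by apply pos_INR.
        apply Rle_div_l; [apply Rlt_gt, Rlt_le_trans with 1; [lra|apply INR_pow_ge_1; lia]|].
        rewrite Rmult_1_l; destruct s as [|s]; [lia|]; rewrite <- tech_pow_Rmult.
        rewrite <- (Rmult_1_r (INR (S n))) at 1; apply Rmult_le_compat_l; [apply pos_INR|].
        apply INR_pow_ge_1; lia.
      * apply Rmult_le_compat_l; [lra|apply sqrt_S_INR_step].
Qed.

Lemma cf_bound (s : nat) (z : C) (r : list (nat * C)) (n : nat) :
  wf ((s, z) :: r) ->
  Cmod (cf ((s, z) :: r) (S n)) <= 2 ^ length r * sqrt (INR (S n)) / INR (S n) ^ s.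
Proof.
  intros H; destruct (wf_cons _ _ _ H) as [_ [Hz Hr]].
  apply cf_bound_of_trunc; [exact Hz|now apply mpl_trunc_bound].
Qed.

Lemma cf_bounded (d : list (nat * C)) (n : nat) : wf d -> Cmod (cf d n) <= 2 ^ length d.
Proof.
  intros H; destruct n as [|n].
  { rewrite cf_0, Cmod_0 by exact H; apply pow_le; lra. }
  destruct d as [|[s z] r]; [simpl; rewrite Cmod_0; lra|].
  destruct (wf_cons _ _ _ H) as [Hs _].
  eapply Rle_trans; [now apply cf_bound|].
  assert (P : 0 < 2 ^ length r) by (apply pow_lt; lra).
  apply Rle_trans with (2 ^ length r * 1).
  - unfold Rdiv; rewrite Rmult_assoc; apply Rmult_le_compat_l; [lra|].
    apply Rle_div_l; [apply Rlt_gt, Rlt_le_trans with 1; [lra|apply INR_pow_ge_1; lia]|].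
    rewrite Rmult_1_l; destruct s as [|s]; [lia|].
    assert (Q : 1 <= INR (S n)) by (apply (le_INR 1); lia).
    apply Rle_trans with (INR (S n)).
    + rewrite <- (sqrt_square (INR (S n))) at 2 by apply pos_INR.
      apply sqrt_le_1_alt; nra.
    + rewrite <- tech_pow_Rmult; rewrite <- (Rmult_1_r (INR (S n))) at 1.
      apply Rmult_le_compat_l; [lra|apply INR_pow_ge_1; lia].
  - simpl; lra.
Qed.

Definition Mp (d : list (nat * C)) (x : C) : C := PS (cf d) x.

Lemma Mp_correct (d : list (nat * C)) (x : C) : wf d -> Cmod x < 1 ->
  is_Cseries (fun n => cf d n * x ^ n)%C (Mp d x).
Proof. intros H; apply (PS_correct _ (2 ^ length d)); intros; now apply cf_bounded. Qed.

Lemma PSd_cf_SS (k : nat) (z : C) (r : list (nat * C)) (x : C) :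
  wf ((S (S k), z) :: r) -> Cmod x < 1 ->
  (PSd (cf ((S (S k), z) :: r)) x * x)%C = Mp ((S k, z) :: r) x.
Proof.
  intros H Hx; symmetry; apply is_Cseries_unique.
  apply (is_Cseries_ext (fun n => x * (cf ((S (S k), z) :: r) n * (RtoC (INR n) * x ^ pred n)))%C).
  - intros n; destruct n as [|n].
    + rewrite !cf_0; [simpl; ring| |exact H].
      destruct (wf_cons _ _ _ H) as [_ [Hz Hr]]; constructor; [split; [simpl; lia|exact Hz]|exact Hr].
    + assert (N : RtoC (INR (S n)) <> 0%C) by (apply RtoC_neq_0, not_0_INR; lia).
      unfold cf; rewrite !RtoC_pow; simpl pred.
      generalize dependent (RtoC (INR (S n))); intros u Hu.
      assert (Hk : (u ^ k)%C <> 0%C) by now apply Cpow_nz.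
      rewrite !Cpow_S; generalize dependent (u ^ k)%C; intros v Hv; field; auto.
  - rewrite Cmult_comm; apply is_Cseries_scal.
    apply (PSd_correct _ (2 ^ length ((S (S k), z) :: r))); [|exact Hx].
    intros n; now apply cf_bounded.
Qed.

(** Differentiation cancels the factor [1 / n] of the outermost index. The term of index 0 vanishes,
    so the sum can be reindexed by [S], which turns [pred n] into [n]. *)
Lemma PSd_cf_1_shift (z : C) (r : list (nat * C)) (x : C) :
  wf ((1%nat, z) :: r) -> Cmod x < 1 ->
  is_Cseries (fun n => z ^ S n * mpl_trunc r n * x ^ n)%C (PSd (cf ((1%nat, z) :: r)) x).
Proof.
  intros H Hx.
  generalize (PSd_correct (cf ((1%nat, z) :: r)) (2 ^ length ((1%nat, z) :: r)) x
    (fun n => cf_bounded _ n H) Hx); intros HS.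
  apply is_Cseries_iff in HS; apply is_Cseries_iff.
  apply (filterlim_ext (fun n => sum_n (fun n => cf ((1%nat, z) :: r) n * (RtoC (INR n) * x ^ pred n))%C (S n))).
  - intros n; induction n as [|n IH].
    + rewrite sum_Sn, !sum_O, (cf_0 _ H); unfold cf, plus; simpl; rewrite Rmult_1_r; field; apply RtoC_neq_0; lra.
    + rewrite sum_Sn, IH, sum_Sn; f_equal.
      assert (N : RtoC (INR (S (S n))) <> 0%C) by (apply RtoC_neq_0, not_0_INR; lia).
      unfold cf; rewrite pow_1; simpl pred.
      generalize dependent (RtoC (INR (S (S n)))); intros u Hu; rewrite !Cpow_S; field; auto.
  - exact (filterlim_comp _ _ _ S (fun n => sum_n _ n) _ _ _ (eventually_subseq S (fun n => Nat.lt_succ_diag_r (S n))) HS).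
Qed.

Lemma PSd_cf_1_nil (z x : C) : Cmod z <= 1 -> Cmod x < 1 ->
  (PSd (cf [(1%nat, z)]) x * (1 - z * x))%C = z.
Proof.
  intros Hz Hx.
  assert (W : wf [(1%nat, z)]) by (constructor; [split; [simpl; lia|exact Hz]|constructor]).
  generalize (PSd_cf_1_shift z [] x W Hx); intros H.
  assert (E : PSd (cf [(1%nat, z)]) x = (z + z * x * PSd (cf [(1%nat, z)]) x)%C).
  { transitivity (CSeries (fun n => z ^ S n * mpl_trunc [] n * x ^ n)%C).
    { symmetry; now apply is_Cseries_unique. }
    apply is_Cseries_unique.
    replace (z + z * x * PSd (cf [(1%nat, z)]) x)%C with
      (z ^ 1 * mpl_trunc [] 0 * x ^ 0 + z * x * PSd (cf [(1%nat, z)]) x)%C by (simpl; ring).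
    apply (is_Cseries_incr_1 (fun n => z ^ S n * mpl_trunc [] n * x ^ n)%C).
    apply (is_Cseries_ext (fun n => z * x * (z ^ S n * mpl_trunc [] n * x ^ n))%C).
    - intros n; simpl; ring.
    - now apply is_Cseries_scal. }
  transitivity (PSd (cf [(1%nat, z)]) x - z * x * PSd (cf [(1%nat, z)]) x)%C; [ring|].
  rewrite E at 1; ring.
Qed.

(** Multiplying by [1 - z x] takes differences of consecutive truncated sums, which leaves one
    summand of the next index; its argument [z2] picks up the factor [z] from the [z^n] that was in
    front. *)
Lemma PSd_cf_1_cons (z z2 : C) (s2 : nat) (r : list (nat * C)) (x : C) :
  wf ((1%nat, z) :: (s2, z2) :: r) -> Cmod x < 1 ->
  (PSd (cf ((1%nat, z) :: (s2, z2) :: r)) x * (1 - z * x))%C = (z * Mp ((s2, z * z2) :: r) x)%C.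
Proof.
  intros W Hx.
  destruct (wf_cons _ _ _ W) as [_ [Hz W2]]; destruct (wf_cons _ _ _ W2) as [Hs2 [Hz2 Wr]].
  assert (W3 : wf ((s2, z * z2)%C :: r)).
  { constructor; [|exact Wr]; split; [exact Hs2|]; simpl; rewrite Cmod_mult.
    generalize (Cmod_ge_0 z) (Cmod_ge_0 z2); nra. }
  generalize (PSd_cf_1_shift z ((s2, z2) :: r) x W Hx); intros H.
  set (D := PSd _ x) in *.
  assert (E : D = (z * x * D + z * Mp ((s2, z * z2) :: r) x)%C).
  { transitivity (CSeries (fun n => z ^ S n * mpl_trunc ((s2, z2) :: r) n * x ^ n)%C).
    { symmetry; now apply is_Cseries_unique. }
    apply is_Cseries_unique.
    apply (is_Cseries_ext (fun n =>
       (match n with O => 0 | S k => z * x * (z ^ S k * mpl_trunc ((s2, z2) :: r) k * x ^ k) end)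
         + z * (cf ((s2, z * z2) :: r) n * x ^ n))%C).
    - intros n; destruct n as [|n].
      + rewrite cf_0 by exact W3; rewrite mpl_trunc_0; ring.
      + rewrite (mpl_trunc_S s2 z2 r n); unfold cf; rewrite Cpow_mult_l, !Cpow_S.
        unfold Cdiv; ring.
    - apply is_Cseries_plus; [|apply is_Cseries_scal; now apply Mp_correct].
      rewrite <- (Cplus_0_l (z * x * D)).
      apply (is_Cseries_incr_1 (fun n => match n with O => 0 | S k => z * x * (z ^ S k * mpl_trunc ((s2, z2) :: r) k * x ^ k) end)%C).
      now apply is_Cseries_scal. }
  transitivity (D - z * x * D)%C; [ring|]. rewrite E at 1; ring.
Qed.

(** * Continuity up to the unit circle *)

Lemma filterlim_Cmod {T : Type} (F : (T -> Prop) -> Prop) {FF : Filter F} (f : T -> C) (l : C) :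
  filterlim f F (locally l) <-> forall eps : posreal, F (fun t => Cmod (f t - l)%C < eps).
Proof. exact (filterlim_locally_ball_norm (U := C_NormedModule) f l). Qed.

Lemma is_Cseries_tail_le (a : nat -> C) (b : nat -> R) (l : C) (B : R) (N : nat) :
  (forall n, Cmod (a n) <= b n) -> is_Cseries a l -> is_series b B ->
  Cmod (l - sum_n a N)%C <= B - sum_n b N.
Proof.
  intros H Ha Hb.
  apply (is_lim_seq_le_loc (fun M => Cmod (sum_n a M - sum_n a N)%C) (fun M => sum_n b M - sum_n b N)
    (Cmod (l - sum_n a N)%C) (B - sum_n b N)).
  - exists N; intros M HM; induction HM as [|M HM IH].
    + replace (sum_n a N - sum_n a N)%C with (RtoC 0) by ring; rewrite Cmod_0; lra.
    + rewrite !sum_Sn; unfold plus; simpl.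
      replace (sum_n a M + a (S M) - sum_n a N)%C with ((sum_n a M - sum_n a N) + a (S M))%C by ring.
      eapply Rle_trans; [apply Cmod_triangle|]; specialize (H (S M)); lra.
  - apply is_Cseries_iff in Ha.
    refine (filterlim_comp _ _ _ _ _ _ _ _ (Clim_minus _ _ (fun _ => sum_n a N) _ _ Ha (filterlim_const _))
      (filterlim_norm (V := C_NormedModule) _)).
  - apply is_lim_seq_minus'; [exact Hb|apply is_lim_seq_const].
Qed.

Lemma Clim_pow {T : Type} (F : (T -> Prop) -> Prop) {FF : Filter F} (f : T -> C) (l : C) (n : nat) :
  filterlim f F (locally l) -> filterlim (fun t => f t ^ n)%C F (locally (l ^ n)%C).
Proof. intros H; induction n as [|n IH]; simpl; [apply filterlim_const|now apply Clim_mult]. Qed.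

(** Weierstrass test: the tails are bounded by those of the summable [b], uniformly on the closed
    disc, and the partial sums are polynomials. A general filter covers both ends of every path. *)
Lemma PS_closed_disc (c : nat -> C) (b : nat -> R) {T : Type} (F : (T -> Prop) -> Prop) {FF : Filter F}
  (x : T -> C) (l : C) :
  (forall n, Cmod (c n) <= b n) -> ex_series b -> F (fun t => Cmod (x t) <= 1) -> Cmod l <= 1 ->
  filterlim x F (locally l) -> filterlim (fun t => PS c (x t)) F (locally (PS c l)).
Proof.
  intros Hc [B HB] Fx Hl Hx.
  assert (Hb : forall y n, Cmod y <= 1 -> Cmod (c n * y ^ n)%C <= b n).
  { intros y n Hy; rewrite <- (Rmult_1_r (b n)), Cmod_mult, Cmod_pow.
    apply Rmult_le_compat; auto using Cmod_ge_0, pow_le.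
    rewrite <- (pow1 n); apply pow_incr; auto using Cmod_ge_0. }
  assert (Hs : forall y, Cmod y <= 1 -> is_Cseries (fun n => c n * y ^ n)%C (PS c y)).
  { intros y Hy; apply (CSeries_correct _ b); [now intros; apply Hb|now exists B]. }
  apply filterlim_Cmod; [assumption|]; intros eps.
  assert (HN : eventually (fun N => Rabs (sum_n b N - B) < eps / 3)).
  { assert (E : 0 < eps / 3) by (generalize (cond_pos eps); lra).
    exact (proj1 (filterlim_locally_ball_norm (U := R_NormedModule) (sum_n b) B) HB (mkposreal _ E)). }
  destruct HN as [N HN]; specialize (HN N (le_n N)).
  assert (HP : filterlim (fun t => sum_n (fun n => c n * x t ^ n)%C N) F
                 (locally (sum_n (fun n => c n * l ^ n)%C N))).
  { clear HN; induction N as [|N IH].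
    - rewrite sum_O; apply (filterlim_ext (fun t => c O * x t ^ 0)%C); [intros t; now rewrite sum_O|].
      apply Clim_mult; [assumption|apply filterlim_const|now apply Clim_pow].
    - rewrite sum_Sn; apply (filterlim_ext (fun t => sum_n (fun n => c n * x t ^ n) N + c (S N) * x t ^ S N)%C);
        [intros t; now rewrite sum_Sn|].
      apply Clim_plus; [assumption|exact IH|].
      apply Clim_mult; [assumption|apply filterlim_const|now apply Clim_pow]. }
  assert (E : 0 < eps / 3) by (generalize (cond_pos eps); lra).
  generalize (proj1 (filterlim_Cmod F _ _) HP (mkposreal _ E)); intros HP'.
  generalize (filter_and _ _ Fx HP'); apply filter_imp; intros t [H1 H2]; simpl in H2.
  generalize (is_Cseries_tail_le _ b _ B N (fun n => Hb (x t) n H1) (Hs _ H1) HB); intros T1.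
  generalize (is_Cseries_tail_le _ b _ B N (fun n => Hb l n Hl) (Hs _ Hl) HB); intros T2.
  apply Rabs_def2 in HN.
  set (p := sum_n (fun n => c n * x t ^ n)%C N) in *; set (q := sum_n (fun n => c n * l ^ n)%C N) in *.
  replace (PS c (x t) - PS c l)%C with ((PS c (x t) - p) + ((p - q) + - (PS c l - q)))%C by ring.
  eapply Rle_lt_trans; [apply Cmod_triangle|].
  eapply Rle_lt_trans; [apply Rplus_le_compat_l, Cmod_triangle|]; rewrite Cmod_opp; lra.
Qed.

(** Comparison with the telescoping series of [2 (1 / sqrt n - 1 / sqrt (n + 1))]. *)
Lemma ex_series_pow_3_2 : ex_series (fun n => sqrt (INR (S n)) / INR (S n) ^ 2).
Proof.
  apply ex_series_incr_1.
  pose (v := fun n => / sqrt (INR (S n))).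
  apply (@ex_series_le R_AbsRing R_CompleteNormedModule _ (fun n => 2 * (v n - v (S n)))).
  - intros n; unfold norm; simpl; unfold abs; simpl.
    assert (P0 : 0 < sqrt (INR (S n))) by (apply sqrt_lt_R0, lt_0_INR; lia).
    assert (P1 : 0 < sqrt (INR (S (S n)))) by (apply sqrt_lt_R0, lt_0_INR; lia).
    assert (E0 : sqrt (INR (S n)) * sqrt (INR (S n)) = INR (S n)) by (apply sqrt_sqrt, pos_INR).
    assert (E1 : sqrt (INR (S (S n))) * sqrt (INR (S (S n))) = INR (S (S n))) by (apply sqrt_sqrt, pos_INR).
    assert (L : sqrt (INR (S n)) <= sqrt (INR (S (S n)))) by apply sqrt_INR_le_S.
    change (Rabs (sqrt (INR (S (S n))) / INR (S (S n)) ^ 2) <= 2 * (v n - v (S n))); unfold v.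
    assert (EE : INR (S (S n)) = INR (S n) + 1) by apply S_INR.
    rewrite <- E1 at 2.
    set (p := sqrt (INR (S n))) in *; set (q := sqrt (INR (S (S n)))) in *.
    replace (q / (q * q) ^ 2) with (/ (q * q * q)) by (field; lra).
    rewrite Rabs_pos_eq by (left; apply Rinv_0_lt_compat; repeat apply Rmult_lt_0_compat; lra).
    replace (2 * (/ p - / q)) with ((q * q - p * p) * 2 / (p * q * (p + q))) by (field; lra).
    replace ((q * q - p * p) * 2 / (p * q * (p + q))) with (/ (p * q * (p + q) / 2)).
    2:{ replace (q * q - p * p) with 1 by lra; field; lra. }
    apply Rinv_le_contravar.
    + apply Rdiv_lt_0_compat; [repeat apply Rmult_lt_0_compat; lra|lra].
    + assert (H : p * (p + q) <= 2 * (q * q)) by nra.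
      replace (p * q * (p + q) / 2) with (q * ((p * (p + q)) / 2)) by field.
      replace (q * q * q) with (q * (q * q)) by ring.
      apply Rmult_le_compat_l; lra.
  - apply (@ex_series_scal_l R_AbsRing).
    exists (v O); change (is_lim_seq (sum_n (fun n => v n - v (S n))) (v O)).
    apply (is_lim_seq_ext (fun n => v O - v (S n))).
    + intros n; induction n as [|n IH]; [now rewrite sum_O|rewrite sum_Sn, <- IH; unfold plus; simpl; ring].
    + replace (Finite (v O)) with (Finite (v O - 0)) by (f_equal; ring).
      apply is_lim_seq_minus'; [apply is_lim_seq_const|]; unfold v.
      replace (Finite 0) with (Rbar_inv p_infty) by reflexivity.
      apply is_lim_seq_inv; [|easy].
      apply (is_lim_seq_incr_1 (fun n => sqrt (INR (S n)))), (is_lim_seq_incr_1 (fun n => sqrt (INR n))).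
      exact (filterlim_comp _ _ _ _ _ _ _ _ is_lim_seq_INR (filterlim_sqrt_p)).
Qed.

Lemma ex_series_cf_bound (s : nat) (z : C) (r : list (nat * C)) : wf ((S (S s), z) :: r) ->
  exists b, (forall n, Cmod (cf ((S (S s), z) :: r) n) <= b n) /\ ex_series b.
Proof.
  intros W.
  exists (fun n => match n with O => 0 | S k => 2 ^ length r * (sqrt (INR (S k)) / INR (S k) ^ 2) end); split.
  - intros [|n]; [rewrite cf_0, Cmod_0 by exact W; lra|].
    eapply Rle_trans; [now apply cf_bound|].
    unfold Rdiv; rewrite Rmult_assoc; apply Rmult_le_compat_l; [apply pow_le; lra|].
    apply Rmult_le_compat_l; [apply sqrt_pos|].
    apply Rinv_le_contravar; [apply pow_lt, lt_0_INR; lia|].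
    apply Rle_pow; [apply (le_INR 1); lia|lia].
  - apply ex_series_incr_1, (@ex_series_scal_l R_AbsRing), ex_series_pow_3_2.
Qed.

Lemma Mp_closed_disc (s : nat) (z : C) (r : list (nat * C))
  {T : Type} (F : (T -> Prop) -> Prop) {FF : Filter F} (x : T -> C) (l : C) :
  wf ((S (S s), z) :: r) -> F (fun t => Cmod (x t) <= 1) -> Cmod l <= 1 ->
  filterlim x F (locally l) ->
  filterlim (fun t => Mp ((S (S s), z) :: r) (x t)) F (locally (Mp ((S (S s), z) :: r) l)).
Proof.
  intros W; destruct (ex_series_cf_bound s z r W) as [b [Hb Hs]].
  now apply (PS_closed_disc _ b).
Qed.

Lemma is_Cseries_decr_1 (a : nat -> C) (l : C) :
  a O = 0%C -> is_Cseries a l -> is_Cseries (fun n => a (S n)) l.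
Proof.
  intros H0 [H1 H2]; split.
  - apply (is_series_incr_1 (fun n => Re (a n))).
    replace (plus _ _) with (Re l); [exact H1|]. rewrite H0; unfold plus; simpl; ring.
  - apply (is_series_incr_1 (fun n => Im (a n))).
    replace (plus _ _) with (Im l); [exact H2|]. rewrite H0; unfold plus; simpl; ring.
Qed.

Lemma wf_1 (s : nat) (z : C) : (0 < s)%nat -> Cmod z <= 1 -> wf [(s, z)].
Proof. intros H1 H2; constructor; [now split|constructor]. Qed.

Lemma Cmod_1_le : Cmod 1 <= 1.
Proof. rewrite Cmod_1; apply Rle_refl. Qed.

Lemma Li_Mp (s : nat) (z : C) : Cmod z <= 1 -> Li (S (S s)) z = Mp [(S (S s), RtoC 1)] z.
Proof.
  intros Hz.
  assert (W : wf [(S (S s), RtoC 1)]) by (apply wf_1; [lia|apply Cmod_1_le]).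
  destruct (ex_series_cf_bound s 1 [] W) as [b [Hb Hs]].
  unfold Li; apply is_Cseries_unique.
  apply (is_Cseries_ext (fun n => cf [(S (S s), RtoC 1)] (S n) * z ^ S n)%C).
  { intros n; unfold cf; rewrite Cpow_1_l; simpl mpl_trunc; unfold Cdiv; ring. }
  apply (is_Cseries_decr_1 (fun n => cf [(S (S s), RtoC 1)] n * z ^ n)%C).
  { rewrite cf_0 by exact W; ring. }
  apply (CSeries_correct _ b); [|exact Hs].
  intros n; rewrite <- (Rmult_1_r (b n)), Cmod_mult, Cmod_pow.
  apply Rmult_le_compat; auto using Cmod_ge_0, pow_le.
  rewrite <- (pow1 n); apply pow_incr; auto using Cmod_ge_0.
Qed.

(** * Differentiation along paths *)

Lemma Cneq_Cmod_lt (z x : C) : Cmod z <= 1 -> Cmod x < 1 -> (1 - z * x)%C <> 0%C.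
Proof.
  intros Hz Hx E.
  assert (H : Cmod (z * x)%C = 1).
  { replace (z * x)%C with (1 - (1 - z * x))%C by ring; rewrite E.
    replace (1 - 0)%C with (RtoC 1) by ring; apply Cmod_1. }
  rewrite Cmod_mult in H; generalize (Cmod_ge_0 z) (Cmod_ge_0 x); nra.
Qed.

Lemma dC_Mp_SS (k : nat) (z : C) (r : list (nat * C)) (x : R -> C) (t : R) (x' : C) :
  wf ((S (S k), z) :: r) -> Cmod (x t) < 1 -> x t <> 0%C -> dC x t x' ->
  dC (fun s => Mp ((S (S k), z) :: r) (x s)) t (Mp ((S k, z) :: r) (x t) * (x' / x t))%C.
Proof.
  intros W Hx Hn D.
  apply (dC_eq _ _ (PSd (cf ((S (S k), z) :: r)) (x t) * x')%C).
  - rewrite <- PSd_cf_SS by assumption; field; exact Hn.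
  - apply (dC_PS _ (2 ^ length ((S (S k), z) :: r))); auto; intros n; now apply cf_bounded.
Qed.

Lemma dC_Mp_1_nil (z : C) (x : R -> C) (t : R) (x' : C) :
  Cmod z <= 1 -> Cmod (x t) < 1 -> dC x t x' ->
  dC (fun s => Mp [(1%nat, z)] (x s)) t (z * x' / (1 - z * x t))%C.
Proof.
  intros W Hx D.
  assert (N : (1 - z * x t)%C <> 0%C) by now apply Cneq_Cmod_lt.
  apply (dC_eq _ _ (PSd (cf [(1%nat, z)]) (x t) * x')%C).
  - rewrite <- (PSd_cf_1_nil z (x t)) at 2 by assumption; field; exact N.
  - apply (dC_PS _ (2 ^ length [(1%nat, z)])); auto; intros n; apply cf_bounded, wf_1; auto.
Qed.

Lemma dC_Mp_1_cons (z z2 : C) (s2 : nat) (r : list (nat * C)) (x : R -> C) (t : R) (x' : C) :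
  wf ((1%nat, z) :: (s2, z2) :: r) -> Cmod (x t) < 1 -> dC x t x' ->
  dC (fun s => Mp ((1%nat, z) :: (s2, z2) :: r) (x s)) t
     (Mp ((s2, z * z2)%C :: r) (x t) * (z * x' / (1 - z * x t)))%C.
Proof.
  intros W Hx D.
  destruct (wf_cons _ _ _ W) as [_ [Hz _]].
  assert (N : (1 - z * x t)%C <> 0%C) by now apply Cneq_Cmod_lt.
  apply (dC_eq _ _ (PSd (cf ((1%nat, z) :: (s2, z2) :: r)) (x t) * x')%C).
  - generalize (PSd_cf_1_cons z z2 s2 r (x t) W Hx); intros E.
    transitivity ((PSd (cf ((1%nat, z) :: (s2, z2) :: r)) (x t) * (1 - z * x t)) * (x' / (1 - z * x t)))%C;
      [field; exact N|]. rewrite E; field; exact N.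
  - apply (dC_PS _ (2 ^ length ((1%nat, z) :: (s2, z2) :: r))); auto; intros n; now apply cf_bounded.
Qed.

Lemma Cmod_lt_sq (a b : C) : Re a ^ 2 + Im a ^ 2 < Re b ^ 2 + Im b ^ 2 -> Cmod a < Cmod b.
Proof. intros H; unfold Cmod; apply sqrt_lt_1_alt; split; [nra|exact H]. Qed.

Lemma Cmod_div_lt_1 (a b : C) : Re a ^ 2 + Im a ^ 2 < Re b ^ 2 + Im b ^ 2 -> Cmod (a / b)%C < 1.
Proof.
  intros H; apply Cmod_lt_sq in H.
  assert (Hb : b <> 0%C) by (intros E; rewrite E, Cmod_0 in H; generalize (Cmod_ge_0 a); lra).
  rewrite Cmod_div by exact Hb; generalize (Cmod_ge_0 a); intros; apply Rlt_div_l; lra.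
Qed.

Lemma Re_pos_neq (z : C) : 0 < Re z -> z <> 0%C.
Proof. intros H E; rewrite E in H; simpl in H; lra. Qed.

(** * The logarithm *)

Lemma cos_pos_range (x : R) : - PI < x < PI -> 0 < cos x -> - (PI / 2) < x < PI / 2.
Proof.
  intros H Hc; generalize PI_RGT_0; intros HP; split; apply Rnot_le_lt; intros Hx.
  - apply (Rlt_irrefl 0), Rlt_le_trans with (1 := Hc); rewrite <- cos_neg; apply cos_le_0; lra.
  - apply (Rlt_irrefl 0), Rlt_le_trans with (1 := Hc); apply cos_le_0; lra.
Qed.

(** The cosine of the sum of the two angles is a positive multiple of [1 - u v], so the sum stays in
    the interval on which [atan] inverts [tan]. *)
Lemma atan_plus (u v : R) : u * v < 1 -> atan u + atan v = atan ((u + v) / (1 - u * v)).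
Proof.
  intros H.
  destruct (atan_bound u) as [U1 U2]; destruct (atan_bound v) as [V1 V2].
  assert (Cu : 0 < cos (atan u)) by (apply cos_gt_0; lra).
  assert (Cv : 0 < cos (atan v)) by (apply cos_gt_0; lra).
  assert (Su : sin (atan u) = u * cos (atan u)).
  { rewrite <- (tan_atan u) at 2; unfold tan; field; lra. }
  assert (Sv : sin (atan v) = v * cos (atan v)).
  { rewrite <- (tan_atan v) at 2; unfold tan; field; lra. }
  assert (Cs : cos (atan u + atan v) = cos (atan u) * cos (atan v) * (1 - u * v)).
  { rewrite cos_plus, Su, Sv; ring. }
  assert (Hr : - (PI / 2) < atan u + atan v < PI / 2).
  { apply cos_pos_range; [lra|]; rewrite Cs; repeat apply Rmult_lt_0_compat; lra. }
  rewrite <- (atan_tan (atan u + atan v)) by lra; f_equal.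
  unfold tan; rewrite Cs, sin_plus, Su, Sv; field; lra.
Qed.

(** Positivity of [Re (a * b)] is what [atan_plus] requires of the two slopes: the arguments then
    add without a jump of the branch. *)
Lemma Clog_mult (a b : C) : 0 < Re a -> 0 < Re b -> 0 < Re (a * b)%C ->
  Clog (a * b)%C = (Clog a + Clog b)%C.
Proof.
  destruct a as [x y], b as [u v]; simpl; intros Ha Hb Hab.
  unfold Clog, Cplus; simpl; f_equal.
  - rewrite <- Rdiv_plus_distr, <- ln_mult by nra; do 2 f_equal; ring.
  - rewrite atan_plus.
    + f_equal; field; repeat split; lra.
    + replace (y / x * (v / u)) with (y * v / (x * u)) by (field; lra).
      apply Rlt_div_l; nra.
Qed.

Lemma Re_inv_pos (a : C) : 0 < Re a -> 0 < Re (/ a)%C.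
Proof.
  destruct a as [x y]; simpl; intros H; apply Rdiv_lt_0_compat; nra.
Qed.

Lemma Clog_1 : Clog 1 = 0%C.
Proof. unfold Clog, RtoC; simpl; f_equal; [replace (1 * (1 * 1) + 0 * (0 * 1)) with 1 by ring; rewrite ln_1; lra|].
  replace (0 / 1) with 0 by field; apply atan_0. Qed.

Lemma Clog_inv (a : C) : 0 < Re a -> Clog (/ a)%C = (- Clog a)%C.
Proof.
  intros H; generalize (Re_inv_pos a H); intros H2.
  assert (Hn := Re_pos_neq a H).
  assert (E : (Clog (a * / a) = Clog a + Clog (/ a))%C).
  { apply Clog_mult; auto; rewrite Cinv_r by exact Hn; simpl; lra. }
  rewrite Cinv_r, Clog_1 in E by exact Hn.
  replace (Clog (/ a))%C with (Clog a + Clog (/ a) - Clog a)%C by ring; rewrite <- E; ring.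
Qed.

Lemma Clog_R (x : R) : 0 < x -> Clog (RtoC x) = RtoC (ln x).
Proof.
  intros H; unfold Clog, RtoC; simpl; f_equal.
  - replace (x * (x * 1) + 0 * (0 * 1)) with (x * x) by ring; rewrite ln_mult by lra; field.
  - replace (0 / x) with 0 by (field; lra); apply atan_0.
Qed.

Lemma Clog_scal (s : R) (z : C) : 0 < s -> 0 < Re z -> Clog (RtoC s * z)%C = (RtoC (ln s) + Clog z)%C.
Proof.
  intros Hs Hz; rewrite <- Clog_R by exact Hs; apply Clog_mult; auto.
  rewrite re_scal_l; now apply Rmult_lt_0_compat.
Qed.

Lemma abs_s_ln_s (s : R) : 0 < s < 1 -> Rabs (s * ln s) <= 2 * sqrt s.
Proof.
  intros Hs.
  assert (P : 0 < sqrt s) by (apply sqrt_lt_R0; lra).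
  assert (E : sqrt s * sqrt s = s) by (apply sqrt_sqrt; lra).
  assert (L : ln s = - (2 * ln (/ sqrt s))).
  { rewrite ln_Rinv by exact P; rewrite <- E at 1; rewrite ln_mult by exact P; ring. }
  assert (B : ln (/ sqrt s) <= / sqrt s).
  { generalize (exp_ineq1_le (ln (/ sqrt s))); rewrite exp_ln by (apply Rinv_0_lt_compat, P); lra. }
  assert (N : ln s < 0) by (rewrite <- ln_1; apply ln_increasing; lra).
  rewrite Rabs_left by nra.
  rewrite L; replace (- (s * - (2 * ln (/ sqrt s)))) with (2 * (s * ln (/ sqrt s))) by ring.
  apply Rmult_le_compat_l; [lra|].
  apply Rle_trans with (s * / sqrt s); [apply Rmult_le_compat_l; lra|].
  rewrite <- E at 1; right; field; lra.
Qed.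

Lemma is_derive_0_bound (g : R -> R) (l : R) : g 0 = 0 -> is_derive g 0 l ->
  exists d : posreal, forall s, 0 < s < d -> Rabs (g s) <= (Rabs l + 1) * s.
Proof.
  intros H0 Hd; apply is_derive_Reals in Hd; destruct (Hd 1 Rlt_0_1) as [d Hd'].
  exists d; intros s Hs.
  assert (A : Rabs s < d) by (rewrite Rabs_pos_eq; lra).
  specialize (Hd' s ltac:(lra) A); rewrite Rplus_0_l, H0, Rminus_0_r in Hd'.
  assert (B : Rabs (g s / s) <= Rabs l + 1).
  { replace (g s / s) with ((g s / s - l) + l) by ring.
    eapply Rle_trans; [apply Rabs_triang|lra]. }
  replace (g s) with (g s / s * s) by (field; lra).
  rewrite Rabs_mult, (Rabs_pos_eq s) by lra; apply Rmult_le_compat_r; lra.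
Qed.

Lemma ln_mult_lim_0 (g : R -> R) (l : R) : g 0 = 0 -> is_derive g 0 l ->
  filterlim (fun s => ln s * g s) (at_right 0) (locally 0).
Proof.
  intros H0 Hd; destruct (is_derive_0_bound g l H0 Hd) as [d Hg].
  apply filterlim_locally; intros eps.
  set (K := Rabs l + 1) in *.
  assert (HK : 0 < K) by (unfold K; generalize (Rabs_pos l); lra).
  assert (E : 0 < (eps / (2 * K)) ^ 2).
  { apply pow_lt, Rdiv_lt_0_compat; [apply cond_pos|lra]. }
  assert (M : 0 < Rmin (Rmin d 1) ((eps / (2 * K)) ^ 2)).
  { repeat apply Rmin_pos; auto; [apply cond_pos|lra]. }
  exists (mkposreal _ M); intros s Hs Hp.
  unfold ball in *; simpl in *; unfold AbsRing_ball, abs, minus, plus, opp in *; simpl in *.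
  replace (s + - 0) with s in Hs by ring; rewrite Rabs_pos_eq in Hs by lra.
  rewrite Ropp_0, Rplus_0_r.
  assert (S1 : s < d) by (eapply Rlt_le_trans; [exact Hs|]; eapply Rle_trans; [apply Rmin_l|apply Rmin_l]).
  assert (S2 : s < 1) by (eapply Rlt_le_trans; [exact Hs|]; eapply Rle_trans; [apply Rmin_l|apply Rmin_r]).
  assert (S3 : s < (eps / (2 * K)) ^ 2) by (eapply Rlt_le_trans; [exact Hs|apply Rmin_r]).
  specialize (Hg s (conj Hp S1)).
  assert (S4 : sqrt s < eps / (2 * K)).
  { apply Rsqr_incrst_0; [|apply sqrt_pos|left; apply Rdiv_lt_0_compat; [apply cond_pos|lra]].
    rewrite Rsqr_sqrt by lra; unfold Rsqr; simpl in S3; lra. }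
  rewrite Rabs_mult.
  apply Rle_lt_trans with (K * Rabs (s * ln s)).
  - rewrite Rabs_mult, (Rabs_pos_eq s) by lra.
    replace (K * (s * Rabs (ln s))) with (Rabs (ln s) * (K * s)) by ring.
    apply Rmult_le_compat_l; [apply Rabs_pos|exact Hg].
  - apply Rle_lt_trans with (K * (2 * sqrt s)).
    + apply Rmult_le_compat_l; [lra|now apply abs_s_ln_s].
    + replace (pos eps) with (K * (2 * (eps / (2 * K)))) by (field; lra).
      apply Rmult_lt_compat_l; lra.
Qed.

(** [Clog (s z)] is [ln s + Clog z], the factor [g s] is [O(s)], and [s ln s] tends to 0. This
    disposes of every product in which a divergent [log] meets a function vanishing at the base
    point. *)
Lemma Clog_mult_lim_0 (z : C) (g : R -> C) (l : C) : 0 < Re z -> g 0 = 0%C -> dC g 0 l ->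
  filterlim (fun s => Clog (RtoC s * z) * g s)%C (at_right 0) (locally (RtoC 0)).
Proof.
  intros Hz H0 Hg.
  apply (filterlim_ext_loc (fun s => RtoC (ln s) * g s + Clog z * g s)%C).
  { exists (mkposreal 1 Rlt_0_1); intros s _ Hs; rewrite Clog_scal by assumption; ring. }
  apply (Clim_eq _ _ (0 + Clog z * 0)%C); [ring|].
  apply Clim_plus; [typeclasses eauto| |].
  - apply filterlim_C_iff; [typeclasses eauto|]; destruct Hg as [Hg1 Hg2]; split.
    + apply (filterlim_ext (fun s => ln s * Re (g s))); [intros s; now rewrite re_scal_l|].
      apply (ln_mult_lim_0 (fun s => Re (g s)) (Re l)); [now rewrite H0|exact Hg1].
    + apply (filterlim_ext (fun s => ln s * Im (g s))); [intros s; now rewrite im_scal_l|].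
      apply (ln_mult_lim_0 (fun s => Im (g s)) (Im l)); [now rewrite H0|exact Hg2].
  - apply Clim_mult; [typeclasses eauto|apply filterlim_const|].
    rewrite <- H0; eapply dC_at_right; exact Hg.
Qed.

(** * Classical polylogarithms along rays *)

Lemma dC_ray (z : C) (t : R) : dC (fun s => RtoC s * z)%C t z.
Proof.
  apply (dC_eq _ _ (RtoC 1 * z + RtoC t * 0)%C); [ring|].
  apply (dC_mult (fun s => RtoC s)); [|apply dC_const].
  apply (dC_RtoC (fun s => s)), (is_derive_id (K := R_AbsRing)).
Qed.

Lemma ray_const (f : R -> C) (l l1 : C) :
  (forall t, 0 < t < 1 -> dC f t 0%C) ->
  filterlim f (at_right 0) (locally l) -> filterlim f (at_left 1) (locally l1) -> l1 = l.
Proof. intros H H0 H1; symmetry; exact (dC_0_limits f 0 1 l l1 Rlt_0_1 H H0 H1). Qed.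

Ltac clim_plus := apply Clim_plus; [typeclasses eauto| |].
Ltac clim_minus := apply Clim_minus; [typeclasses eauto| |].
Ltac clim_mult := apply Clim_mult; [typeclasses eauto| |].

Definition L (s : nat) (x : C) : C := Mp [(s, RtoC 1)] x.

Arguments L : simpl never.

Lemma wf_L (s : nat) : wf [(S s, RtoC 1)].
Proof. apply wf_1; [lia|apply Cmod_1_le]. Qed.

Lemma Mp_0 (d : list (nat * C)) : wf d -> Mp d 0 = 0%C.
Proof.
  intros W; unfold Mp; apply is_Cseries_unique.
  apply (is_Cseries_ext (fun _ => RtoC 0)).
  - intros [|n]; [rewrite cf_0 by exact W; ring|rewrite Cpow_S; ring].
  - assert (H : is_series (fun _ : nat => 0) 0).
    { change (is_lim_seq (sum_n (fun _ : nat => 0)) 0); apply (is_lim_seq_ext (fun _ => 0));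
        [intros n; rewrite sum_n_const; ring|apply is_lim_seq_const]. }
    split; exact H.
Qed.

(** Unlike [dC_Mp_SS], this also covers zeros of [x]. *)
Lemma ex_dC_Mp (d : list (nat * C)) (x : R -> C) (t : R) (x' : C) :
  wf d -> Cmod (x t) < 1 -> dC x t x' -> exists l, dC (fun s => Mp d (x s)) t l.
Proof.
  intros W Hx D; eexists; apply (dC_PS _ (2 ^ length d)); eauto; intros n; now apply cf_bounded.
Qed.

Lemma ex_dC_L (s : nat) (x : R -> C) (t : R) (x' : C) :
  Cmod (x t) < 1 -> dC x t x' -> exists l, dC (fun u => L (S s) (x u)) t l.
Proof. apply ex_dC_Mp, wf_L. Qed.

Lemma dC_L1 (x : R -> C) (t : R) (x' : C) :
  Cmod (x t) < 1 -> dC x t x' -> dC (fun s => L 1 (x s)) t (x' / (1 - x t))%C.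
Proof.
  intros H D; apply (dC_eq _ _ (1 * x' / (1 - 1 * x t))%C).
  - rewrite !Cmult_1_l; reflexivity.
  - apply dC_Mp_1_nil; auto using Cmod_1_le.
Qed.

Lemma Cmod_ray (s : R) (z : C) : 0 <= s <= 1 -> Cmod (RtoC s * z)%C <= Cmod z.
Proof. intros H; rewrite Cmod_mult, Cmod_R, Rabs_pos_eq by lra; generalize (Cmod_ge_0 z); nra. Qed.

Lemma L1_Clog (x : C) : Cmod x < 1 -> L 1 x = (- Clog (1 - x))%C.
Proof.
  intros Hx.
  assert (D : forall t, 0 <= t <= 1 -> dC (fun s => L 1 (RtoC s * x) + Clog (1 - RtoC s * x))%C t 0%C).
  { intros t Ht.
    assert (Hm : Cmod (RtoC t * x)%C < 1) by (eapply Rle_lt_trans; [now apply Cmod_ray|exact Hx]).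
    assert (Hp := Re_gt_1_sub _ Hm).
    eapply dC_eq; [|apply dC_plus; [apply dC_L1; [exact Hm|apply dC_ray]|
      apply (dC_Clog (fun s => 1 - RtoC s * x)%C); [exact Hp|apply dC_minus; [apply dC_const|apply dC_ray]]]].
    cbv beta; field; now apply Re_pos_neq. }
  assert (E : (L 1 (RtoC 1 * x) + Clog (1 - RtoC 1 * x) = L 1 (RtoC 0 * x) + Clog (1 - RtoC 0 * x))%C).
  { refine (ray_const _ _ _ _ (dC_at_right _ 0 _ (D 0 _)) (dC_at_left _ 1 _ (D 1 _))); [|lra|lra].
    intros t Ht; apply D; lra. }
  rewrite Cmult_0_l, Cmult_1_l in E; unfold L in E at 2; rewrite Mp_0 in E by apply wf_L.
  replace (1 - 0)%C with (RtoC 1) in E by ring; rewrite Clog_1 in E.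
  replace (L 1 x) with (L 1 x + Clog (1 - x) - Clog (1 - x))%C by ring; rewrite E; ring.
Qed.

Lemma dC_L2 (x : R -> C) (t : R) (x' : C) :
  Cmod (x t) < 1 -> x t <> 0%C -> dC x t x' ->
  dC (fun s => L 2 (x s)) t (- Clog (1 - x t) * (x' / x t))%C.
Proof. intros H N D; rewrite <- L1_Clog by exact H; apply dC_Mp_SS; auto using wf_L. Qed.

Lemma dC_L3 (x : R -> C) (t : R) (x' : C) :
  Cmod (x t) < 1 -> x t <> 0%C -> dC x t x' ->
  dC (fun s => L 3 (x s)) t (L 2 (x t) * (x' / x t))%C.
Proof. intros H N D; apply dC_Mp_SS; auto using wf_L. Qed.

Lemma L_closed (s : nat) {T : Type} (F : (T -> Prop) -> Prop) {FF : Filter F} (x : T -> C) (l : C) :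
  F (fun t => Cmod (x t) <= 1) -> Cmod l <= 1 -> filterlim x F (locally l) ->
  filterlim (fun t => L (S (S s)) (x t)) F (locally (L (S (S s)) l)).
Proof. intros H1 H2 H3; apply Mp_closed_disc; auto using wf_L. Qed.

Lemma L_0 (s : nat) : L (S s) 0 = 0%C.
Proof. apply Mp_0, wf_L. Qed.

Lemma at_right_lt (a b : R) (P : R -> Prop) : a < b -> (forall s, a < s < b -> P s) -> at_right a P.
Proof.
  intros Hab H; exists (mkposreal (b - a) ltac:(lra)); intros s Hs Hp; apply H; split; [exact Hp|].
  unfold ball in Hs; simpl in Hs; unfold AbsRing_ball, abs, minus, plus, opp in Hs; simpl in Hs.
  apply Rabs_def2 in Hs; lra.
Qed.

Lemma at_left_gt (a b : R) (P : R -> Prop) : a < b -> (forall s, a < s < b -> P s) -> at_left b P.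
Proof.
  intros Hab H; exists (mkposreal (b - a) ltac:(lra)); intros s Hs Hp; apply H; split; [|exact Hp].
  unfold ball in Hs; simpl in Hs; unfold AbsRing_ball, abs, minus, plus, opp in Hs; simpl in Hs.
  apply Rabs_def2 in Hs; lra.
Qed.

Lemma L_at_right (a b : R) (s : nat) (x : R -> C) (x' : C) : a < b ->
  (forall t, a < t < b -> Cmod (x t) <= 1) -> Cmod (x a) <= 1 -> dC x a x' ->
  filterlim (fun t => L (S (S s)) (x t)) (at_right a) (locally (L (S (S s)) (x a))).
Proof.
  intros Hab H H0 D; apply (L_closed s (at_right a) x (x a)); [now apply (at_right_lt a b)|exact H0|].
  eapply dC_at_right; exact D.
Qed.

Lemma L_at_left (a b : R) (s : nat) (x : R -> C) (x' : C) : a < b ->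
  (forall t, a < t < b -> Cmod (x t) <= 1) -> Cmod (x b) <= 1 -> dC x b x' ->
  filterlim (fun t => L (S (S s)) (x t)) (at_left b) (locally (L (S (S s)) (x b))).
Proof.
  intros Hab H H0 D; apply (L_closed s (at_left b) x (x b)); [now apply (at_left_gt a b)|exact H0|].
  eapply dC_at_left; exact D.
Qed.

Definition L_at_right_0 (s : nat) (x : R -> C) (x' : C) := L_at_right 0 1 s x x' Rlt_0_1.
Definition L_at_left_1 (s : nat) (x : R -> C) (x' : C) := L_at_left 0 1 s x x' Rlt_0_1.

(** * Functional equations of the dilogarithm *)

Lemma Cmod_ray_lt (s : R) (z : C) : 0 < s < 1 -> Cmod z <= 1 -> Cmod (RtoC s * z)%C < 1.
Proof. intros H Hz; rewrite Cmod_mult, Cmod_R, Rabs_pos_eq by lra; generalize (Cmod_ge_0 z); nra. Qed.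

Lemma ray_neq_0 (s : R) (z : C) : 0 < s -> z <> 0%C -> (RtoC s * z)%C <> 0%C.
Proof. intros H Hz; apply Cmult_neq_0; [apply RtoC_neq_0; lra|exact Hz]. Qed.

Lemma Clog_1_sub_sq (x : C) : Cmod x < 1 -> Clog (1 - x * x)%C = (Clog (1 - x) + Clog (1 + x))%C.
Proof.
  intros H; replace (1 - x * x)%C with ((1 - x) * (1 + x))%C by ring.
  assert (H2 : Cmod (x * x)%C < 1) by (rewrite Cmod_mult; generalize (Cmod_ge_0 x); nra).
  apply Clog_mult.
  - now apply Re_gt_1_sub.
  - replace (1 + x)%C with (1 - - x)%C by ring; apply Re_gt_1_sub; now rewrite Cmod_opp.
  - replace ((1 - x) * (1 + x))%C with (1 - x * x)%C by ring; now apply Re_gt_1_sub.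
Qed.

(** Along the ray [t z] both sides have the same derivative because [log (1 - x^2)] splits. Points
    of the unit circle are included by continuity; they give [Li_2] at -1 and at cube roots of
    unity. *)
Lemma L2_dup (z : C) : Cmod z <= 1 -> L 2 (z * z)%C = (2 * (L 2 z + L 2 (- z)))%C.
Proof.
  intros Hz.
  destruct (Ceq_dec z 0) as [->|Nz].
  { replace (0 * 0)%C with (RtoC 0) by ring; replace (- 0)%C with (RtoC 0) by ring; rewrite L_0; ring. }
  pose (f := fun s => (L 2 ((RtoC s * z) * (RtoC s * z)) - 2 * (L 2 (RtoC s * z) + L 2 (- (RtoC s * z))))%C).
  assert (D : forall t, 0 < t < 1 -> dC f t 0%C).
  { intros t Ht.
    assert (Hm := Cmod_ray_lt t z Ht Hz).
    assert (Nt := ray_neq_0 t z (proj1 Ht) Nz).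
    assert (Hq : Cmod ((RtoC t * z) * (RtoC t * z))%C < 1).
    { rewrite Cmod_mult; generalize (Cmod_ge_0 (RtoC t * z)%C); nra. }
    eapply dC_eq; [|apply dC_minus; [apply dC_L2; [exact Hq| |apply dC_mult; apply dC_ray]|
      apply dC_scal, dC_plus; [apply dC_L2; [exact Hm|exact Nt|apply dC_ray]|
        apply dC_L2; [rewrite Cmod_opp; exact Hm| |apply dC_opp, dC_ray]]]].
    - cbv beta; rewrite Clog_1_sub_sq by exact Hm.
      replace (1 - - (t * z))%C with (1 + t * z)%C by ring.
      field; split; [exact Nz|apply RtoC_neq_0; lra].
    - now apply Cmult_neq_0.
    - intros E; apply Nt; replace (t * z)%C with (- - (t * z))%C by ring; rewrite E; ring. }
  assert (B1 : forall t, 0 < t < 1 -> Cmod (RtoC t * z)%C <= 1).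
  { intros t Ht; left; now apply Cmod_ray_lt. }
  assert (B2 : forall t, 0 < t < 1 -> Cmod (- (RtoC t * z))%C <= 1) by (intros; rewrite Cmod_opp; auto).
  assert (B3 : forall t, 0 < t < 1 -> Cmod ((RtoC t * z) * (RtoC t * z))%C <= 1).
  { intros t Ht; rewrite Cmod_mult; generalize (B1 t Ht) (Cmod_ge_0 (RtoC t * z)%C); nra. }
  assert (E : f 1 = f 0).
  { apply (ray_const f); [exact D| |]; unfold f.
    - clim_minus; [|clim_mult; [apply filterlim_const|clim_plus]].
      + eapply (L_at_right_0 0 (fun s => (RtoC s * z) * (RtoC s * z))%C); [exact B3| |apply dC_mult; apply dC_ray].
        rewrite !Cmult_0_l, Cmod_0; lra.
      + eapply (L_at_right_0 0 (fun s => RtoC s * z)%C); [exact B1| |apply dC_ray].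
        rewrite !Cmult_0_l, Cmod_0; lra.
      + eapply (L_at_right_0 0 (fun s => - (RtoC s * z))%C); [exact B2| |apply dC_opp, dC_ray].
        rewrite !Cmult_0_l, Cmod_opp, Cmod_0; lra.
    - clim_minus; [|clim_mult; [apply filterlim_const|clim_plus]].
      + eapply (L_at_left_1 0 (fun s => (RtoC s * z) * (RtoC s * z))%C); [exact B3| |apply dC_mult; apply dC_ray].
        rewrite !Cmult_1_l, Cmod_mult; generalize (Cmod_ge_0 z); nra.
      + eapply (L_at_left_1 0 (fun s => RtoC s * z)%C); [exact B1| |apply dC_ray].
        now rewrite Cmult_1_l.
      + eapply (L_at_left_1 0 (fun s => - (RtoC s * z))%C); [exact B2| |apply dC_opp, dC_ray].
        now rewrite Cmult_1_l, Cmod_opp. }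
  unfold f in E; rewrite !Cmult_0_l, !Cmult_1_l in E.
  replace (- 0)%C with (RtoC 0) in E by ring; rewrite L_0 in E.
  replace (L 2 (z * z)%C) with (L 2 (z * z) - 2 * (L 2 z + L 2 (- z)) + 2 * (L 2 z + L 2 (- z)))%C by ring.
  rewrite E; ring.
Qed.

Lemma Cmod_x_sub_1_lt (x : C) : Re x < / 2 -> Cmod (x / (x - 1))%C < 1.
Proof. intros H; apply Cmod_div_lt_1; destruct x as [u v]; simpl in *; lra. Qed.

(** Since [1 - x / (x - 1) = 1 / (1 - x)], the logarithm in the derivative only changes sign. The
    condition on [Re x] says [|x| < |x - 1|], and it persists along the ray from 0 to [x]. *)
Lemma L2_Landen (x : C) : Cmod x < 1 -> Re x < / 2 ->
  L 2 (x / (x - 1))%C = (- L 2 x - / 2 * (Clog (1 - x) * Clog (1 - x)))%C.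
Proof.
  intros Hx Hr.
  destruct (Ceq_dec x 0) as [->|Nx].
  { replace (0 / (0 - 1))%C with (RtoC 0) by (field; intros E; apply (f_equal Re) in E; simpl in E; lra).
    replace (1 - 0)%C with (RtoC 1) by ring; rewrite L_0, Clog_1; ring. }
  pose (y := fun s => (RtoC s * x / (RtoC s * x - 1))%C).
  pose (f := fun s => (L 2 (y s) + L 2 (RtoC s * x) + / 2 * (Clog (1 - RtoC s * x) * Clog (1 - RtoC s * x)))%C).
  assert (Hm : forall t, 0 <= t <= 1 -> Cmod (RtoC t * x)%C < 1).
  { intros t Ht; eapply Rle_lt_trans; [now apply Cmod_ray|exact Hx]. }
  assert (Hp : forall t, 0 <= t <= 1 -> 0 < Re (1 - RtoC t * x)%C) by (intros; now apply Re_gt_1_sub, Hm).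
  assert (Hy : forall t, 0 <= t <= 1 -> Cmod (y t) < 1).
  { intros t Ht; apply Cmod_x_sub_1_lt; rewrite re_scal_l.
    destruct (Rle_lt_dec 0 (Re x)); nra. }
  assert (Nq : forall t, 0 <= t <= 1 -> (RtoC t * x - 1)%C <> 0%C).
  { intros t Ht E; apply (Re_pos_neq _ (Hp t Ht)).
    replace (1 - t * x)%C with (- (t * x - 1))%C by ring; rewrite E; ring. }
  assert (Dy : forall t, 0 <= t <= 1 -> dC y t (- x / ((RtoC t * x - 1) * (RtoC t * x - 1)))%C).
  { intros t Ht; unfold y.
    eapply dC_eq; [|apply dC_div; [now apply Nq|apply dC_ray|apply dC_minus; [apply dC_ray|apply dC_const]]].
    cbv beta; field; now apply Nq. }
  assert (Dl : forall t, 0 <= t <= 1 -> dC (fun s => Clog (1 - RtoC s * x))%C t ((0 - x) / (1 - RtoC t * x))%C).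
  { intros t Ht; apply (dC_Clog (fun s => 1 - RtoC s * x)%C); [now apply Hp|apply dC_minus; [apply dC_const|apply dC_ray]]. }
  assert (D : forall t, 0 < t <= 1 -> dC f t 0%C).
  { intros t Ht; assert (Ht' : 0 <= t <= 1) by lra.
    assert (Nt := ray_neq_0 t x (proj1 Ht) Nx).
    assert (Nq' := Nq t Ht'); assert (Np := Re_pos_neq _ (Hp t Ht')).
    eapply dC_eq; [|apply dC_plus; [apply dC_plus; [apply dC_L2; [now apply Hy| |now apply Dy]|
      apply dC_L2; [now apply Hm|exact Nt|apply dC_ray]]|apply dC_scal, dC_mult; now apply Dl]].
    - cbv beta.
      replace (1 - y t)%C with (/ (1 - RtoC t * x))%C by (unfold y; field; auto).
      rewrite Clog_inv by now apply Hp.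
      unfold y; field; repeat split; auto; apply RtoC_neq_0; lra.
    - unfold y; intros E; apply Nt.
      transitivity (RtoC t * x / (RtoC t * x - 1) * (RtoC t * x - 1))%C; [field; exact Nq'|rewrite E; ring]. }
  assert (E : f 1 = f 0).
  { apply (ray_const f); [intros; apply D; lra| |eapply dC_at_left, D; lra].
    assert (H0 : 0 <= 0 <= 1) by lra.
    unfold f; clim_plus; [clim_plus|clim_mult; [apply filterlim_const|clim_mult]].
    - apply (L_at_right_0 0 y _ (fun t Ht => Rlt_le _ _ (Hy t ltac:(lra))) (Rlt_le _ _ (Hy 0 H0)) (Dy 0 H0)).
    - apply (L_at_right_0 0 _ _ (fun t Ht => Rlt_le _ _ (Hm t ltac:(lra))) (Rlt_le _ _ (Hm 0 H0)) (dC_ray x 0)).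
    - exact (dC_at_right _ _ _ (Dl 0 H0)).
    - exact (dC_at_right _ _ _ (Dl 0 H0)). }
  unfold f, y in E; rewrite !Cmult_0_l, !Cmult_1_l in E.
  replace (0 / (0 - 1))%C with (RtoC 0) in E by (field; intros Z; apply (f_equal Re) in Z; simpl in Z; lra).
  replace (1 - 0)%C with (RtoC 1) in E by ring; rewrite L_0, Clog_1 in E.
  transitivity (L 2 (x / (x - 1)) + L 2 x + / 2 * (Clog (1 - x) * Clog (1 - x))
     - L 2 x - / 2 * (Clog (1 - x) * Clog (1 - x)))%C; [ring|rewrite E; ring].
Qed.

(** On the ray [t z] the point [1 - t z] is a convex combination of 1 and [1 - z], so it stays in
    the disc. The constant is the limit at [t = 0], where this point reaches 1 and the product of
    logarithms vanishes. *)
Lemma L2_reflection (z : C) : Cmod z < 1 -> Cmod (1 - z)%C < 1 ->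
  (L 2 z + L 2 (1 - z) + Clog z * Clog (1 - z))%C = L 2 1.
Proof.
  intros Hz Hz'.
  assert (Hre : 0 < Re z).
  { replace z with (1 - (1 - z))%C by ring; now apply Re_gt_1_sub. }
  assert (Nz := Re_pos_neq _ Hre).
  pose (f := fun s => (L 2 (RtoC s * z) + L 2 (1 - RtoC s * z) + Clog (RtoC s * z) * Clog (1 - RtoC s * z))%C).
  assert (Hm : forall t, 0 <= t <= 1 -> Cmod (RtoC t * z)%C < 1).
  { intros t Ht; eapply Rle_lt_trans; [now apply Cmod_ray|exact Hz]. }
  assert (Hp : forall t, 0 <= t <= 1 -> 0 < Re (1 - RtoC t * z)%C) by (intros; now apply Re_gt_1_sub, Hm).
  assert (Hq : forall t, 0 <= t <= 1 -> Cmod (1 - RtoC t * z)%C <= 1 - t + t * Cmod (1 - z)).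
  { intros t Ht; replace (1 - t * z)%C with (RtoC (1 - t) + RtoC t * (1 - z))%C by (rewrite RtoC_minus; ring).
    eapply Rle_trans; [apply Cmod_triangle|]; rewrite Cmod_mult, !Cmod_R, !Rabs_pos_eq; lra. }
  assert (Hq1 : forall t, 0 < t <= 1 -> Cmod (1 - RtoC t * z)%C < 1).
  { intros t Ht; eapply Rle_lt_trans; [apply Hq; lra|]; generalize (Cmod_ge_0 (1 - z)%C); nra. }
  assert (Dl : forall t, 0 <= t <= 1 -> dC (fun s => Clog (1 - RtoC s * z))%C t ((0 - z) / (1 - RtoC t * z))%C).
  { intros t Ht; apply (dC_Clog (fun s => 1 - RtoC s * z)%C); [now apply Hp|apply dC_minus; [apply dC_const|apply dC_ray]]. }
  assert (D : forall t, 0 < t <= 1 -> dC f t 0%C).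
  { intros t Ht; assert (Ht' : 0 <= t <= 1) by lra.
    assert (Nt := ray_neq_0 t z (proj1 Ht) Nz); assert (Np := Re_pos_neq _ (Hp t Ht')).
    eapply dC_eq; [|apply dC_plus; [apply dC_plus; [apply dC_L2; [now apply Hm|exact Nt|apply dC_ray]|
      apply dC_L2; [now apply Hq1|exact Np|apply dC_minus; [apply dC_const|apply dC_ray]]]|
      apply dC_mult; [apply (dC_Clog (fun s => RtoC s * z)%C); [|apply dC_ray]|now apply Dl]]].
    - cbv beta; replace (1 - (1 - t * z))%C with (RtoC t * z)%C by ring.
      field; repeat split; auto; apply RtoC_neq_0; lra.
    - rewrite re_scal_l; nra. }
  assert (E : f 1 = (0 + L 2 1 + 0)%C).
  { apply (ray_const f); [intros; apply D; lra| |eapply dC_at_left, D; lra].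
    assert (H0 : 0 <= 0 <= 1) by lra.
    unfold f; clim_plus; [clim_plus|].
    - apply (Clim_eq _ _ (L 2 (RtoC 0 * z))); [rewrite Cmult_0_l; apply L_0|].
      apply (L_at_right_0 0 _ _ (fun t Ht => Rlt_le _ _ (Hm t ltac:(lra))) (Rlt_le _ _ (Hm 0 H0)) (dC_ray z 0)).
    - apply (Clim_eq _ _ (L 2 (1 - RtoC 0 * z))); [f_equal; ring|].
      eapply (L_at_right_0 0 (fun t => 1 - RtoC t * z)%C); [intros t Ht; left; apply Hq1; lra| |
        apply dC_minus; [apply dC_const|apply dC_ray]].
      eapply Rle_trans; [now apply Hq|]; lra.
    - eapply Clog_mult_lim_0; [exact Hre| |now apply Dl].
      rewrite Cmult_0_l; replace (1 - 0)%C with (RtoC 1) by ring; apply Clog_1. }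
  unfold f in E; rewrite !Cmult_1_l in E; rewrite E; ring.
Qed.

(** Legendre's chi function, the odd part of [Li_s]. *)
Definition chi (s : nat) (x : C) : C := (/ 2 * (L s x - L s (- x)))%C.

Arguments chi : simpl never.

Lemma dC_chi2 (x : R -> C) (t : R) (x' : C) :
  Cmod (x t) < 1 -> x t <> 0%C -> dC x t x' ->
  dC (fun s => chi 2 (x s)) t (/ 2 * (Clog (1 + x t) - Clog (1 - x t)) * (x' / x t))%C.
Proof.
  intros H N D; unfold chi.
  assert (N' : (- x t)%C <> 0%C) by (intros E; apply N; replace (x t) with (- - x t)%C by ring; rewrite E; ring).
  eapply dC_eq; [|apply dC_scal, dC_minus; [apply dC_L2; eassumption|
    apply (dC_L2 (fun s => - x s)%C); [now rewrite Cmod_opp|exact N'|apply dC_opp, D]]].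
  cbv beta; replace (1 - - x t)%C with (1 + x t)%C by ring; field; exact N.
Qed.

Lemma chi_0 (s : nat) : chi (S s) 0 = 0%C.
Proof. unfold chi; replace (- 0)%C with (RtoC 0) by ring; rewrite L_0; ring. Qed.

Lemma chi_at_right_0 (s : nat) (x : R -> C) (x' : C) :
  (forall t, 0 < t < 1 -> Cmod (x t) <= 1) -> Cmod (x 0) <= 1 -> dC x 0 x' ->
  filterlim (fun t => chi (S (S s)) (x t)) (at_right 0) (locally (chi (S (S s)) (x 0))).
Proof.
  intros H H0 D; unfold chi; clim_mult; [apply filterlim_const|clim_minus].
  - eapply L_at_right_0; eauto.
  - eapply (L_at_right_0 s (fun t => - x t)%C); [intros; rewrite Cmod_opp; auto|now rewrite Cmod_opp|apply dC_opp, D].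
Qed.

Lemma Cayley_lt_1 (x : C) : 0 < Re x -> Cmod ((1 - x) / (1 + x))%C < 1.
Proof. intros H; apply Cmod_div_lt_1; destruct x as [u v]; simpl in *; lra. Qed.

(** The map [w = (1 - Y) / (1 + Y)] is an involution, so it exchanges [log ((1 + w) / (1 - w))] with
    [- log Y]; the two derivatives combine into that of a product of logarithms. As [Y] shrinks to
    0, [w] tends to 1, whence the constant [chi 2 1]. *)
Lemma chi2_Cayley (Y : C) : Cmod Y < 1 -> 0 < Re Y ->
  chi 2 ((1 - Y) / (1 + Y))%C = (chi 2 1 + / 2 * (Clog Y * (Clog (1 + Y) - Clog (1 - Y))) - chi 2 Y)%C.
Proof.
  intros HY Hre.
  assert (NY := Re_pos_neq _ Hre).
  pose (w := fun s => ((1 - RtoC s * Y) / (1 + RtoC s * Y))%C).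
  pose (f := fun s => (chi 2 (w s) + chi 2 (RtoC s * Y)
     - / 2 * (Clog (RtoC s * Y) * (Clog (1 + RtoC s * Y) - Clog (1 - RtoC s * Y))))%C).
  assert (Hm : forall t, 0 <= t <= 1 -> Cmod (RtoC t * Y)%C < 1).
  { intros t Ht; eapply Rle_lt_trans; [now apply Cmod_ray|exact HY]. }
  assert (Hp : forall t, 0 <= t <= 1 -> 0 < Re (1 - RtoC t * Y)%C) by (intros; now apply Re_gt_1_sub, Hm).
  assert (Hp' : forall t, 0 <= t <= 1 -> 0 < Re (1 + RtoC t * Y)%C).
  { intros t Ht; replace (1 + t * Y)%C with (1 - - (t * Y))%C by ring; apply Re_gt_1_sub; rewrite Cmod_opp; now apply Hm. }
  assert (Hw : forall t, 0 < t <= 1 -> Cmod (w t) < 1).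
  { intros t Ht; apply Cayley_lt_1; rewrite re_scal_l; nra. }
  assert (Dw : forall t, 0 <= t <= 1 -> dC w t (- 2 * Y / ((1 + RtoC t * Y) * (1 + RtoC t * Y)))%C).
  { intros t Ht; unfold w.
    eapply dC_eq; [|apply dC_div; [now apply Re_pos_neq, Hp'|apply dC_minus; [apply dC_const|apply dC_ray]|
      apply dC_plus; [apply dC_const|apply dC_ray]]].
    cbv beta; field; now apply Re_pos_neq, Hp'. }
  assert (Dl : forall t, 0 <= t <= 1 ->
    dC (fun s => Clog (1 + RtoC s * Y) - Clog (1 - RtoC s * Y))%C t (Y / (1 + RtoC t * Y) + Y / (1 - RtoC t * Y))%C).
  { intros t Ht; eapply dC_eq; [|apply dC_minus;
     [apply (dC_Clog (fun s => 1 + RtoC s * Y)%C); [now apply Hp'|apply dC_plus; [apply dC_const|apply dC_ray]]|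
      apply (dC_Clog (fun s => 1 - RtoC s * Y)%C); [now apply Hp|apply dC_minus; [apply dC_const|apply dC_ray]]]].
    cbv beta; field; split; apply Re_pos_neq; first [now apply Hp|now apply Hp']. }
  assert (D : forall t, 0 < t <= 1 -> dC f t 0%C).
  { intros t Ht; assert (Ht' : 0 <= t <= 1) by lra.
    assert (Nt := ray_neq_0 t Y (proj1 Ht) NY); assert (Np := Re_pos_neq _ (Hp t Ht'));
    assert (Np' := Re_pos_neq _ (Hp' t Ht')).
    assert (Hr : 0 < Re (RtoC t * Y)%C) by (rewrite re_scal_l; nra).
    eapply dC_eq; [|apply dC_minus; [apply dC_plus; [apply dC_chi2; [now apply Hw| |now apply Dw]|
      apply dC_chi2; [now apply Hm|exact Nt|apply dC_ray]]|
      apply dC_scal, dC_mult; [apply (dC_Clog (fun s => RtoC s * Y)%C); [exact Hr|apply dC_ray]|now apply Dl]]].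
    - cbv beta.
      (* From [1 - w = (1 + w) Y], all three factors lying in the right half-plane. *)
      assert (E : (Clog (1 + w t) - Clog (1 - w t))%C = (- Clog (RtoC t * Y))%C).
      { replace (1 - w t)%C with ((1 + w t) * (RtoC t * Y))%C by (unfold w; field; exact Np').
        assert (P2 : 0 < Re (1 + w t)%C).
        { replace (1 + w t)%C with (1 - - w t)%C by ring; apply Re_gt_1_sub; rewrite Cmod_opp; now apply Hw. }
        rewrite Clog_mult; [ring|exact P2|exact Hr|].
        replace ((1 + w t) * (RtoC t * Y))%C with (1 - w t)%C by (unfold w; field; exact Np').
        now apply Re_gt_1_sub, Hw. }
      rewrite E; unfold w; field; repeat split; auto; apply RtoC_neq_0; lra.
    - unfold w; intros E; apply Np.
      transitivity ((1 - RtoC t * Y) / (1 + RtoC t * Y) * (1 + RtoC t * Y))%C; [field; exact Np'|rewrite E; ring]. }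
  assert (E : f 1 = (chi 2 1 + 0 - / 2 * 0)%C).
  { apply (ray_const f); [intros; apply D; lra| |eapply dC_at_left, D; lra].
    assert (H0 : 0 <= 0 <= 1) by lra.
    unfold f; clim_minus; [clim_plus|clim_mult; [apply filterlim_const|]].
    - apply (Clim_eq _ _ (chi 2 (w 0))).
      { f_equal; unfold w; rewrite Cmult_0_l; field; apply RtoC_neq_0; lra. }
      apply (chi_at_right_0 0 w _ (fun t Ht => Rlt_le _ _ (Hw t ltac:(lra)))) with (2 := Dw 0 H0).
      unfold w; rewrite Cmult_0_l; replace ((1 - 0) / (1 + 0))%C with (RtoC 1) by (field; apply RtoC_neq_0; lra).
      apply Cmod_1_le.
    - apply (Clim_eq _ _ (chi 2 (RtoC 0 * Y))); [rewrite Cmult_0_l; apply chi_0|].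
      apply (chi_at_right_0 0 _ _ (fun t Ht => Rlt_le _ _ (Hm t ltac:(lra))) (Rlt_le _ _ (Hm 0 H0)) (dC_ray Y 0)).
    - eapply Clog_mult_lim_0; [exact Hre| |now apply Dl].
      rewrite Cmult_0_l; replace (1 - 0)%C with (RtoC 1) by ring; replace (1 + 0)%C with (RtoC 1) by ring; ring. }
  unfold f, w in E; rewrite !Cmult_1_l in E.
  transitivity (chi 2 ((1 - Y) / (1 + Y)) + chi 2 Y - / 2 * (Clog Y * (Clog (1 + Y) - Clog (1 - Y)))
    + / 2 * (Clog Y * (Clog (1 + Y) - Clog (1 - Y))) - chi 2 Y)%C; [ring|rewrite E; ring].
Qed.

(** Used when only the real part of the derivative vanishes; the other component is left
    undetermined. *)
Lemma Re_0_limits (f : R -> C) (a b : R) (la lb : C) : a < b ->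
  (forall t, a < t < b -> exists l, dC f t l /\ Re l = 0) ->
  filterlim f (at_right a) (locally la) -> filterlim f (at_left b) (locally lb) -> Re la = Re lb.
Proof.
  intros Hab Hd Ha Hb.
  rewrite filterlim_C_iff in Ha by typeclasses eauto; rewrite filterlim_C_iff in Hb by typeclasses eauto.
  apply (deriv_0_limits (fun t => Re (f t)) a b); [auto| |tauto|tauto].
  intros t Ht; destruct (Hd t Ht) as [l [[H1 _] E]]; now rewrite E in H1.
Qed.

Lemma Im_0_limits (f : R -> C) (a b : R) (la lb : C) : a < b ->
  (forall t, a < t < b -> exists l, dC f t l /\ Im l = 0) ->
  filterlim f (at_right a) (locally la) -> filterlim f (at_left b) (locally lb) -> Im la = Im lb.
Proof.
  intros Hab Hd Ha Hb.
  rewrite filterlim_C_iff in Ha by typeclasses eauto; rewrite filterlim_C_iff in Hb by typeclasses eauto.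
  apply (deriv_0_limits (fun t => Im (f t)) a b); [auto| |tauto|tauto].
  intros t Ht; destruct (Hd t Ht) as [l [[_ H1] E]]; now rewrite E in H1.
Qed.

(** * Paths in polar coordinates *)

Definition polar (r f : R) : C := (r * cos f, r * sin f).

Lemma Cmod_polar (r f : R) : 0 <= r -> Cmod (polar r f) = r.
Proof.
  intros H; unfold Cmod, polar; simpl.
  replace (_ + _) with (r ^ 2) by (generalize (sin2_cos2 f); unfold Rsqr; simpl; nra).
  now apply sqrt_pow2.
Qed.

Lemma Clog_polar (r f : R) : 0 < r -> - (PI / 2) < f < PI / 2 -> Clog (polar r f) = (ln r, f).
Proof.
  intros Hr Hf; assert (Hc : 0 < cos f) by (apply cos_gt_0; lra).
  unfold Clog, polar; simpl; f_equal.
  - replace (_ + _) with (r * r) by (generalize (sin2_cos2 f); unfold Rsqr; simpl; nra).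
    rewrite ln_mult by lra; field.
  - replace (r * sin f / (r * cos f)) with (tan f) by (unfold tan; field; lra).
    apply atan_tan; lra.
Qed.

Lemma polar_neq_0 (r f : R) : 0 < r -> polar r f <> 0%C.
Proof. intros H; apply Cmod_gt_0; rewrite Cmod_polar; lra. Qed.

Lemma dC_polar (r f : R -> R) (t p q : R) :
  is_derive r t p -> is_derive f t q ->
  dC (fun s => polar (r s) (f s)) t (polar 1 (f t) * ((p, r t * q)%R : C))%C.
Proof.
  intros Dr Df; split; unfold polar; simpl.
  - evar_last.
    + apply (is_derive_mult r (fun s => cos (f s))); [exact Dr| |intros; apply Rmult_comm].
      apply (is_derive_comp (V := R_NormedModule) cos f); [apply is_derive_cos|exact Df].
    + unfold plus, mult, scal; simpl; unfold mult; simpl; ring.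
  - evar_last.
    + apply (is_derive_mult r (fun s => sin (f s))); [exact Dr| |intros; apply Rmult_comm].
      apply (is_derive_comp (V := R_NormedModule) sin f); [apply is_derive_sin|exact Df].
    + unfold plus, mult, scal; simpl; unfold mult; simpl; ring.
Qed.

(** Here [(p, q)] is the logarithmic derivative of the path, the factor by which [L 2] and [L 3]
    pass to the next lower weight. *)
Lemma dC_polar_log (r f : R -> R) (t p q : R) :
  is_derive r t (r t * p) -> is_derive f t q ->
  dC (fun s => polar (r s) (f s)) t (polar (r t) (f t) * (p, q))%C.
Proof.
  intros Dr Df; eapply dC_eq; [|apply dC_polar; eassumption].
  unfold polar, Cmult; simpl; f_equal; ring.
Qed.

Lemma dC_L2_log (x : R -> C) (t : R) (l : C) :
  Cmod (x t) < 1 -> x t <> 0%C -> dC x t (x t * l)%C -> dC (fun s => L 2 (x s)) t (- Clog (1 - x t) * l)%C.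
Proof. intros H N D; eapply dC_eq; [|apply dC_L2; eassumption]; field; exact N. Qed.

Lemma dC_L3_log (x : R -> C) (t : R) (l : C) :
  Cmod (x t) < 1 -> x t <> 0%C -> dC x t (x t * l)%C -> dC (fun s => L 3 (x s)) t (L 2 (x t) * l)%C.
Proof. intros H N D; eapply dC_eq; [|apply dC_L3; eassumption]; field; exact N. Qed.

Lemma CSeries_conj (a : nat -> C) : CSeries (fun n => Cconj (a n)) = Cconj (CSeries a).
Proof. unfold CSeries, Cconj; simpl; f_equal; apply (Series_opp (fun n => Im (a n))). Qed.

Lemma CSeries_ext (a b : nat -> C) : (forall n, a n = b n) -> CSeries a = CSeries b.
Proof. intros E; unfold CSeries; f_equal; apply Series_ext; intros n; now rewrite E. Qed.

Lemma Mp_scal (s : nat) (z y x : C) (r : list (nat * C)) : Mp ((s, z) :: r) (y * x)%C = Mp ((s, z * y)%C :: r) x.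
Proof.
  unfold Mp, PS; apply CSeries_ext; intros n; unfold cf.
  rewrite !Cpow_mult_l; unfold Cdiv; ring.
Qed.

Lemma Mp_single (s : nat) (z x : C) : Mp [(s, z)] x = L s (z * x)%C.
Proof. unfold L; now rewrite Mp_scal, Cmult_1_l. Qed.

Lemma L_conj (s : nat) (x : C) : L s (Cconj x) = Cconj (L s x).
Proof.
  unfold L, Mp, PS; rewrite <- CSeries_conj; apply CSeries_ext; intros n.
  rewrite Cmult_conj, Cpow_conj; f_equal; unfold cf; rewrite Cpow_1_l; simpl mpl_trunc.
  unfold Cdiv, Cinv, Cmult, RtoC, Cconj; simpl; f_equal; unfold Rdiv; ring.
Qed.

(* Special values of the dilogarithm *)
Opaque L.

(** Both [1 - x] and [1 - X] have modulus [2 cos (2 t) - 1], so the logarithms of the modulus cancel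
    in the real part of the derivative and only [12 t] remains. At [PI / 6] both arguments are 1,
    which yields [zeta(2)]; at [PI / 12] they are the point [Y0] of the closed form and
    [2 - sqrt 3]. *)
Lemma dilog_pair_real (b : R) : 0 < b <= PI / 6 ->
  2 * Re (L 2 (polar (2 * sin b) (PI / 2 - 3 * b))) - Re (L 2 (RtoC (4 * sin b ^ 2))) = 6 * b ^ 2.
Proof.
  intros Hb; assert (HP := PI_RGT_0).
  pose (x := fun t => polar (2 * sin t) (PI / 2 - 3 * t)).
  pose (X := fun t => RtoC (4 * sin t ^ 2)).
  pose (F := fun t => (2 * L 2 (x t) - L 2 (X t) - RtoC (6 * t ^ 2))%C).
  assert (Hs : forall t, 0 < t < PI / 6 -> 0 < sin t < / 2).
  { intros t Ht; split; [apply sin_gt_0; lra|].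
    replace (/ 2) with (1 / 2) by field; rewrite <- sin_PI6; apply sin_increasing_1; lra. }
  assert (Hs' : forall t, 0 <= t <= PI / 6 -> 0 <= sin t <= / 2).
  { intros t Ht; split; [apply sin_ge_0; lra|].
    replace (/ 2) with (1 / 2) by field; rewrite <- sin_PI6; apply sin_incr_1; lra. }
  assert (Bx : forall t, 0 <= t <= PI / 6 -> Cmod (x t) <= 1).
  { intros t Ht; specialize (Hs' t Ht); unfold x; rewrite Cmod_polar; lra. }
  assert (BX : forall t, 0 <= t <= PI / 6 -> Cmod (X t) <= 1).
  { intros t Ht; specialize (Hs' t Ht); unfold X; rewrite Cmod_R, Rabs_pos_eq; nra. }
  assert (Dx : forall t, dC x t (polar 1 (PI / 2 - 3 * t) * ((2 * cos t)%R, (2 * sin t * - 3)%R))%C).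
  { intros t; apply (dC_polar (fun t => 2 * sin t) (fun t => PI / 2 - 3 * t)); auto_derive; auto; ring. }
  assert (DX : forall t, dC X t (RtoC (8 * sin t * cos t))).
  { intros t; apply (dC_RtoC (fun t => 4 * sin t ^ 2)); auto_derive; auto; ring. }
  assert (Dq : forall t, dC (fun t => RtoC (6 * t ^ 2)) t (RtoC (12 * t))).
  { intros t; apply (dC_RtoC (fun t => 6 * t ^ 2)); auto_derive; auto; ring. }
  assert (E : Re (F 0) = Re (F b)).
  { apply (Re_0_limits F 0 b); [lra| | |].
    - intros t Ht; destruct (Hs t ltac:(lra)) as [S1 S2].
      assert (Hm : 0 < 2 * cos (2 * t) - 1) by (rewrite cos_2a_sin; nra).
      eexists; split.
      + unfold F; apply dC_minus; [apply dC_minus; [apply dC_scal, (dC_L2_log x t (cos t / sin t, - 3))|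
          apply (dC_L2_log X t (RtoC (2 * (cos t / sin t))))]|apply Dq].
        * unfold x; rewrite Cmod_polar; lra.
        * apply polar_neq_0; lra.
        * eapply dC_eq; [|apply Dx]; unfold x, polar, Cmult; simpl; f_equal; field; lra.
        * unfold X; rewrite Cmod_R, Rabs_pos_eq; nra.
        * apply RtoC_neq_0; nra.
        * eapply dC_eq; [|apply DX]; unfold X; rewrite <- RtoC_mult; f_equal; field; lra.
      + assert (E1 : (1 - x t)%C = polar (2 * cos (2 * t) - 1) (- (2 * t))).
        { unfold x, polar, RtoC, Cminus, Cplus, Copp; simpl; rewrite cos_neg, sin_neg.
          replace (3 * t) with (2 * t + t) by ring.
          rewrite cos_minus, sin_minus, cos_PI2, sin_PI2, cos_plus, sin_plus, cos_2a, sin_2a.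
          generalize (sin2_cos2 t); unfold Rsqr; intros T.
          assert (T' : sin t * sin t = 1 - cos t * cos t) by lra.
          f_equal; ring [T']. }
        assert (E2 : (1 - X t)%C = RtoC (2 * cos (2 * t) - 1)).
        { unfold X; rewrite <- RtoC_minus; f_equal; rewrite cos_2a_sin; ring. }
        rewrite E1, E2, Clog_R, Clog_polar by lra.
        unfold RtoC, Cmult, Copp, Cminus, Cplus; simpl; field; lra.
    - unfold F; clim_minus; [clim_minus; [clim_mult; [apply filterlim_const|]|]|].
      + eapply (L_at_right 0 b 0 x); [lra|intros; apply Bx; lra|apply Bx; lra|apply Dx].
      + eapply (L_at_right 0 b 0 X); [lra|intros; apply BX; lra|apply BX; lra|apply DX].
      + exact (dC_at_right _ _ _ (Dq 0)).
    - unfold F; clim_minus; [clim_minus; [clim_mult; [apply filterlim_const|]|]|].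
      + eapply (L_at_left 0 b 0 x); [lra|intros; apply Bx; lra|apply Bx; lra|apply Dx].
      + eapply (L_at_left 0 b 0 X); [lra|intros; apply BX; lra|apply BX; lra|apply DX].
      + exact (dC_at_left _ _ _ (Dq b)). }
  assert (E0 : F 0 = 0%C).
  { unfold F, x, X; rewrite sin_0.
    replace (polar (2 * 0) (PI / 2 - 3 * 0)) with (RtoC 0) by (unfold polar, RtoC; f_equal; ring).
    replace (4 * 0 ^ 2) with 0 by ring; rewrite L_0; replace (6 * 0 ^ 2) with 0 by ring; ring. }
  rewrite E0 in E; unfold F in E; fold (x b) (X b); simpl in E; unfold Re in *; simpl in *; lra.
Qed.

(** The case [b = PI / 6] of [dilog_pair_real] reads [2 L 2 1 - L 2 1 = 6 (PI / 6)^2] in real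
    parts. *)
Lemma L2_1 : L 2 1 = RtoC (PI ^ 2 / 6).
Proof.
  assert (HP := PI_RGT_0).
  generalize (dilog_pair_real (PI / 6) ltac:(lra)); rewrite sin_PI6; intros H.
  replace (polar (2 * (1 / 2)) (PI / 2 - 3 * (PI / 6))) with (RtoC 1) in H.
  2:{ replace (PI / 2 - 3 * (PI / 6)) with 0 by field; unfold polar, RtoC; rewrite cos_0, sin_0; f_equal; field. }
  replace (4 * (1 / 2) ^ 2) with 1 in H by field.
  assert (H2 : Im (L 2 1) = 0).
  { generalize (L_conj 2 1); replace (Cconj 1) with (RtoC 1) by (unfold Cconj, RtoC; simpl; f_equal; ring).
    intros E; apply (f_equal Im) in E; unfold Im in *; simpl in E; lra. }
  rewrite (surjective_pairing (L 2 1)); unfold RtoC in *; f_equal; unfold Re, Im in *; [lra|exact H2].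
Qed.

Lemma chi2_1 : chi 2 1 = RtoC (PI ^ 2 / 8).
Proof.
  generalize (L2_dup 1 Cmod_1_le); replace (1 * 1)%C with (RtoC 1) by ring; intros E.
  unfold chi; replace (L 2 (- (1))) with (/ 2 * (2 * (L 2 1 + L 2 (- (1)))) - L 2 1)%C by (field; apply RtoC_neq_0; lra).
  rewrite <- E, L2_1; unfold RtoC, Cmult, Cminus, Cplus, Copp, Cinv; simpl; f_equal; field.
Qed.

(** * A family of trilogarithm identities *)

(** For [(k, f)] among [(1, 0)], [(1, PI / 3)], [(1, - PI / 3)] and [(-3, PI)], the polar form of [1 - zth k f t] is elementary. *)
Definition zth (k f t : R) : C := polar (/ (2 * cos t)) (k * t + f).

Lemma dC_zth (k f t : R) : 0 < cos t -> dC (zth k f) t (zth k f t * (tan t, k))%C.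
Proof.
  intros H; unfold zth; apply (dC_polar_log (fun t => / (2 * cos t)) (fun t => k * t + f)).
  - auto_derive; [lra|unfold tan; field; lra].
  - auto_derive; auto; ring.
Qed.

Lemma cos_range (t : R) : 0 <= t < PI / 3 -> / 2 < cos t.
Proof.
  intros H; replace (/ 2) with (1 / 2) by field; rewrite <- cos_PI3; apply cos_decreasing_1; lra.
Qed.

Lemma cos_range_le (t : R) : 0 <= t <= PI / 3 -> / 2 <= cos t.
Proof.
  intros H; replace (/ 2) with (1 / 2) by field; rewrite <- cos_PI3; apply cos_decr_1; lra.
Qed.

Lemma zth_lt_1 (k f t : R) : 0 <= t < PI / 3 -> Cmod (zth k f t) < 1.
Proof.
  intros H; assert (Hc := cos_range t H); unfold zth.
  assert (H1 : / (2 * cos t) < 1) by (rewrite <- Rinv_1; apply Rinv_lt_contravar; lra).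
  rewrite Cmod_polar; [exact H1|left; apply Rinv_0_lt_compat; lra].
Qed.

Lemma zth_le_1 (k f t : R) : 0 <= t <= PI / 3 -> Cmod (zth k f t) <= 1.
Proof.
  intros H; assert (Hc := cos_range_le t H); unfold zth.
  assert (H1 : / (2 * cos t) <= 1) by (rewrite <- Rinv_1; apply Rinv_le_contravar; lra).
  rewrite Cmod_polar; [exact H1|left; apply Rinv_0_lt_compat; lra].
Qed.

Lemma zth_neq_0 (k f t : R) : 0 <= t <= PI / 3 -> zth k f t <> 0%C.
Proof.
  intros H; assert (Hc := cos_range_le t H); apply polar_neq_0, Rinv_0_lt_compat; lra.
Qed.

Lemma dC_L2_zth (k f t : R) : 0 <= t < PI / 3 ->
  dC (fun s => L 2 (zth k f s)) t (- Clog (1 - zth k f t) * (tan t, k))%C.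
Proof.
  intros H; assert (Hc := cos_range t H); apply dC_L2_log;
    [now apply zth_lt_1|apply zth_neq_0; lra|apply dC_zth; lra].
Qed.

Lemma dC_L3_zth (k f t : R) : 0 <= t < PI / 3 ->
  dC (fun s => L 3 (zth k f s)) t (L 2 (zth k f t) * (tan t, k))%C.
Proof.
  intros H; assert (Hc := cos_range t H); apply dC_L3_log;
    [now apply zth_lt_1|apply zth_neq_0; lra|apply dC_zth; lra].
Qed.

(** [- lc t] is the logarithm of the modulus of every [zth k f t]. *)
Definition lc (t : R) : R := ln (2 * cos t).

Lemma is_derive_lc (t : R) : 0 < cos t -> is_derive lc t (- tan t).
Proof. intros H; unfold lc; auto_derive; [lra|unfold tan; field; lra]. Qed.

Section Logs.
Variable t : R.
Hypothesis Ht : 0 <= t < PI / 3.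

Let s3 : sqrt 3 * sqrt 3 = 3.
Proof. apply sqrt_sqrt; lra. Qed.

Lemma cos_pos_m : 0 < cos (t - PI / 6).
Proof. apply cos_gt_0; generalize PI_RGT_0; lra. Qed.

Lemma cos_pos_p : 0 < cos (t + PI / 6).
Proof. apply cos_gt_0; generalize PI_RGT_0; lra. Qed.

Lemma Clog_1_sub_zth_0 : Clog (1 - zth 1 0 t)%C = (- lc t, - t).
Proof.
  assert (Hc := cos_range t Ht); assert (HP := PI_RGT_0).
  replace (1 - zth 1 0 t)%C with (polar (/ (2 * cos t)) (- t)).
  - rewrite Clog_polar by (lra || (apply Rinv_0_lt_compat; lra)); unfold lc; rewrite ln_Rinv by lra; reflexivity.
  - unfold zth, polar, RtoC, Cminus, Cplus, Copp; simpl; rewrite cos_neg, sin_neg, Rmult_1_l, Rplus_0_r; f_equal; field; lra.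
Qed.

Lemma Clog_1_sub_zth_p : Clog (1 - zth 1 (PI / 3) t)%C = (lc (t - PI / 6) - lc t, - (PI / 6)).
Proof.
  assert (Hc := cos_range t Ht); assert (HP := PI_RGT_0); assert (Hm := cos_pos_m).
  replace (1 - zth 1 (PI / 3) t)%C with (polar (2 * cos (t - PI / 6) / (2 * cos t)) (- (PI / 6))).
  - rewrite Clog_polar by (lra || (apply Rdiv_lt_0_compat; lra)); unfold lc; rewrite ln_div by lra; reflexivity.
  - unfold zth, polar, RtoC, Cminus, Cplus, Copp; simpl; rewrite cos_neg, sin_neg, Rmult_1_l, cos_minus, cos_plus, sin_plus,
      cos_PI6, sin_PI6, cos_PI3, sin_PI3.
    f_equal; field [s3]; lra.
Qed.

Lemma Clog_1_sub_zth_m : Clog (1 - zth 1 (- (PI / 3)) t)%C = (lc (t + PI / 6) - lc t, PI / 6).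
Proof.
  assert (Hc := cos_range t Ht); assert (HP := PI_RGT_0); assert (Hm := cos_pos_p).
  replace (1 - zth 1 (- (PI / 3)) t)%C with (polar (2 * cos (t + PI / 6) / (2 * cos t)) (PI / 6)).
  - rewrite Clog_polar by (lra || (apply Rdiv_lt_0_compat; lra)); unfold lc; rewrite ln_div by lra; reflexivity.
  - unfold zth, polar, RtoC, Cminus, Cplus, Copp; simpl; rewrite Rmult_1_l, !cos_plus, sin_plus, cos_neg, sin_neg,
      cos_PI6, sin_PI6, cos_PI3, sin_PI3.
    f_equal; field [s3]; lra.
Qed.

(** Up to the factor [e^(- i t) / (2 cos t)], [1 - z] is [2 cos (2 t) + 1 = 4 cos (t - PI / 6) cos
    (t + PI / 6)]. Hence no logarithm occurs beyond those of the other three members of the family,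
    and cancellation becomes possible. *)
Lemma Clog_1_sub_zth_3 : Clog (1 - zth (-3) PI t)%C = (lc (t - PI / 6) + lc (t + PI / 6) - lc t, - t).
Proof.
  assert (Hc := cos_range t Ht); assert (HP := PI_RGT_0); assert (Hm := cos_pos_m); assert (Hp := cos_pos_p).
  replace (1 - zth (-3) PI t)%C with (polar ((2 * cos (t - PI / 6)) * (2 * cos (t + PI / 6)) / (2 * cos t)) (- t)).
  - rewrite Clog_polar by (lra || (apply Rdiv_lt_0_compat; [|lra]; nra)); unfold lc.
    rewrite ln_div, ln_mult by (lra || nra); reflexivity.
  - unfold zth, polar, RtoC, Cminus, Cplus, Copp; simpl.
    replace (-3 * t + PI) with (- (2 * t + t) + PI) by ring.
    rewrite neg_cos, neg_sin, !cos_neg, !sin_neg, cos_minus, !cos_plus, sin_plus, cos_PI6, sin_PI6, cos_2a, sin_2a.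
    generalize (sin2_cos2 t); unfold Rsqr; intros T.
    assert (T' : sin t * sin t = 1 - cos t * cos t) by lra.
    f_equal; field [s3 T']; lra.
Qed.

End Logs.

Lemma L2_zth_left (k f a : R) : 0 <= a < PI / 3 ->
  filterlim (fun s => L 2 (zth k f s)) (at_left (PI / 3)) (locally (L 2 (zth k f (PI / 3)))).
Proof.
  intros Ha; eapply (L_at_left a (PI / 3) 0 (zth k f)); [lra|intros; apply zth_le_1; lra|apply zth_le_1; lra|].
  apply dC_zth; rewrite cos_PI3; lra.
Qed.

Lemma zth_PI3 (k f : R) : zth k f (PI / 3) = polar 1 (k * (PI / 3) + f).
Proof. unfold zth; f_equal; rewrite cos_PI3; field. Qed.

Lemma lc_PI3 : lc (PI / 3) = 0.
Proof. unfold lc; rewrite cos_PI3; replace (2 * (1 / 2)) with 1 by field; apply ln_1. Qed.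

Lemma is_derive_half_sq (f : R -> R) (k t l : R) : is_derive f t l ->
  is_derive (fun s => f s ^ 2 / 2 + k * s ^ 2 / 2) t (l * f t + k * t).
Proof.
  intros D; evar_last.
  - apply (@is_derive_plus R_AbsRing R_NormedModule).
    + refine (is_derive_scal_l (V := R_NormedModule) (fun s => f s ^ 2) t _ (/ 2) _); apply is_derive_pow, D.
    + instantiate (1 := k * t); auto_derive; auto; field.
  - unfold plus, scal; simpl; unfold mult; simpl; field.
Qed.

(** The left side is constant in [t] and is evaluated at [PI / 3]. Read at [t = 0], where the
    argument is [1 / 2], the identity then determines the real part of [Li_2] at the sixth root of
    unity. *)
Lemma Re_L2_zth (t : R) : 0 <= t < PI / 3 ->
  Re (L 2 (zth 1 0 t)) + lc t ^ 2 / 2 + 1 * t ^ 2 / 2 = Re (L 2 (polar 1 (PI / 3))) + PI ^ 2 / 18.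
Proof.
  intros Ht; assert (HP := PI_RGT_0).
  pose (F := fun t => (L 2 (zth 1 0 t) + RtoC (lc t ^ 2 / 2 + 1 * t ^ 2 / 2))%C).
  assert (Dq : forall t, 0 < cos t -> dC (fun t => RtoC (lc t ^ 2 / 2 + 1 * t ^ 2 / 2)) t (RtoC (- tan t * lc t + 1 * t))).
  { intros u Hu; apply (dC_RtoC (fun t => lc t ^ 2 / 2 + 1 * t ^ 2 / 2)); now apply (is_derive_half_sq lc), is_derive_lc. }
  assert (D : forall u, 0 <= u < PI / 3 ->
    dC F u (- Clog (1 - zth 1 0 u) * (tan u, 1%R) + RtoC (- tan u * lc u + 1 * u))%C).
  { intros u Hu; apply dC_plus; [now apply dC_L2_zth|apply Dq; generalize (cos_range u Hu); lra]. }
  assert (E : Re (F t) = Re (L 2 (zth 1 0 (PI / 3)) + RtoC (lc (PI / 3) ^ 2 / 2 + 1 * (PI / 3) ^ 2 / 2))%C).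
  { apply (Re_0_limits F t (PI / 3)); [lra| | |].
    - intros u Hu; eexists; split; [apply D; lra|].
      rewrite Clog_1_sub_zth_0 by lra; simpl; ring.
    - exact (dC_at_right _ _ _ (D t Ht)).
    - unfold F; clim_plus; [now apply (L2_zth_left 1 0 t)|].
      refine (dC_at_left _ _ _ (Dq (PI / 3) _)); rewrite cos_PI3; lra. }
  rewrite zth_PI3, lc_PI3 in E; replace (1 * (PI / 3) + 0) with (PI / 3) in E by ring.
  unfold F in E; simpl in E; unfold Re in *; lra.
Qed.

Lemma L2_half : L 2 (RtoC (/ 2)) = RtoC (PI ^ 2 / 12 - ln 2 ^ 2 / 2).
Proof.
  assert (H : Cmod (RtoC (/ 2)) < 1) by (rewrite Cmod_R, Rabs_pos_eq; lra).
  assert (E1 : (1 - RtoC (/ 2))%C = RtoC (/ 2)) by (rewrite <- RtoC_minus; f_equal; field).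
  generalize (L2_reflection (RtoC (/ 2)) H); rewrite E1; intros E; specialize (E H).
  rewrite Clog_R, L2_1, ln_Rinv in E by lra.
  replace (L 2 (RtoC (/ 2))) with (/ 2 * (L 2 (RtoC (/ 2)) + L 2 (RtoC (/ 2)) + RtoC (- ln 2) * RtoC (- ln 2)
    - RtoC (- ln 2) * RtoC (- ln 2)))%C by (field; apply RtoC_neq_0; lra).
  rewrite E; rewrite <- RtoC_mult, <- RtoC_minus, <- RtoC_inv, <- RtoC_mult by lra; f_equal; field.
Qed.

Lemma Re_L2_sixth_root : Re (L 2 (polar 1 (PI / 3))) = PI ^ 2 / 36.
Proof.
  assert (HP := PI_RGT_0).
  generalize (Re_L2_zth 0 ltac:(lra)); unfold zth, lc; rewrite cos_0, Rmult_1_r.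
  replace (polar (/ 2) (1 * 0 + 0)) with (RtoC (/ 2)).
  - rewrite L2_half, re_RtoC; lra.
  - replace (1 * 0 + 0) with 0 by ring; unfold polar, RtoC; rewrite cos_0, sin_0; f_equal; ring.
Qed.

Lemma Re_L2_cube_root : Re (L 2 (polar 1 (2 * PI / 3))) = - PI ^ 2 / 18.
Proof.
  assert (E := L2_dup (polar 1 (PI / 3)) ltac:(rewrite Cmod_polar; lra)).
  replace (polar 1 (PI / 3) * polar 1 (PI / 3))%C with (polar 1 (2 * PI / 3)) in E.
  2:{ replace (2 * PI / 3) with (PI / 3 + PI / 3) by field; unfold polar, Cmult; simpl.
      rewrite cos_plus, sin_plus; f_equal; ring. }
  replace (- polar 1 (PI / 3))%C with (Cconj (polar 1 (2 * PI / 3))) in E.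
  2:{ replace (2 * PI / 3) with (- (PI / 3) + PI) by field; unfold polar, Cconj, Copp; simpl.
      rewrite neg_cos, neg_sin, cos_neg, sin_neg; f_equal; ring. }
  rewrite L_conj in E; apply (f_equal Re) in E.
  assert (H := Re_L2_sixth_root); unfold Re in *; simpl in E; lra.
Qed.

(** The coefficients are those of the trilogarithm bracket times the speeds [k = -3, 1, 1, 1] of the
    arguments, because this combination is what the imaginary direction contributes to the
    derivative of that bracket. The constant is found at [t = PI / 3], where all four points are
    roots of unity. *)
Lemma Re_L2_bracket (t : R) : 0 <= t < PI / 3 ->
  - 3 * Re (L 2 (zth (-3) PI t)) + 3 * Re (L 2 (zth 1 (PI / 3) t)) + 3 * Re (L 2 (zth 1 (- (PI / 3)) t))
    - 2 * Re (L 2 (zth 1 0 t)) = PI ^ 2 / 6 - lc t ^ 2 / 2 - 7 * t ^ 2 / 2.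
Proof.
  intros Ht; assert (HP := PI_RGT_0).
  pose (F := fun t => (RtoC (-3) * L 2 (zth (-3) PI t) + 3 * L 2 (zth 1 (PI / 3) t) + 3 * L 2 (zth 1 (- (PI / 3)) t)
    - 2 * L 2 (zth 1 0 t) + RtoC (lc t ^ 2 / 2 + 7 * t ^ 2 / 2))%C).
  assert (Dq : forall t, 0 < cos t -> dC (fun t => RtoC (lc t ^ 2 / 2 + 7 * t ^ 2 / 2)) t (RtoC (- tan t * lc t + 7 * t))).
  { intros u Hu; apply (dC_RtoC (fun t => lc t ^ 2 / 2 + 7 * t ^ 2 / 2)); now apply (is_derive_half_sq lc), is_derive_lc. }
  assert (D : forall u, 0 <= u < PI / 3 -> dC F u
     (RtoC (-3) * (- Clog (1 - zth (-3) PI u) * (tan u, -3)) + 3 * (- Clog (1 - zth 1 (PI / 3) u) * (tan u, 1%R))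
      + 3 * (- Clog (1 - zth 1 (- (PI / 3)) u) * (tan u, 1%R)) - 2 * (- Clog (1 - zth 1 0 u) * (tan u, 1%R))
      + RtoC (- tan u * lc u + 7 * u))%C).
  { intros u Hu; apply dC_plus; [|apply Dq; generalize (cos_range u Hu); lra].
    apply dC_minus; [apply dC_plus; [apply dC_plus|]|]; apply dC_scal; now apply dC_L2_zth. }
  assert (E : Re (F t) = Re (RtoC (-3) * L 2 (zth (-3) PI (PI / 3)) + 3 * L 2 (zth 1 (PI / 3) (PI / 3))
    + 3 * L 2 (zth 1 (- (PI / 3)) (PI / 3))
    - 2 * L 2 (zth 1 0 (PI / 3)) + RtoC (lc (PI / 3) ^ 2 / 2 + 7 * (PI / 3) ^ 2 / 2))%C).
  { apply (Re_0_limits F t (PI / 3)); [lra| | |].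
    - intros u Hu; eexists; split; [apply D; lra|].
      rewrite Clog_1_sub_zth_0, Clog_1_sub_zth_p, Clog_1_sub_zth_m, Clog_1_sub_zth_3 by lra; simpl; field.
    - exact (dC_at_right _ _ _ (D t Ht)).
    - unfold F; clim_plus.
      + clim_minus; [clim_plus; [clim_plus|]|]; (clim_mult; [apply filterlim_const|now apply (L2_zth_left _ _ t)]).
      + refine (dC_at_left _ _ _ (Dq (PI / 3) _)); rewrite cos_PI3; lra. }
  rewrite !zth_PI3, lc_PI3 in E.
  replace (-3 * (PI / 3) + PI) with 0 in E by field.
  replace (1 * (PI / 3) + PI / 3) with (2 * PI / 3) in E by field.
  replace (1 * (PI / 3) + - (PI / 3)) with 0 in E by field.
  replace (1 * (PI / 3) + 0) with (PI / 3) in E by field.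
  replace (polar 1 0) with (RtoC 1) in E by (unfold polar, RtoC; rewrite cos_0, sin_0; f_equal; ring).
  assert (H1 := Re_L2_sixth_root); assert (H2 := Re_L2_cube_root).
  rewrite L2_1 in E; unfold F in E; simpl in E; unfold Re in *; lra.
Qed.

Lemma Im_L_R (s : nat) (x : R) : Im (L s (RtoC x)) = 0.
Proof.
  generalize (L_conj s (RtoC x)); replace (Cconj (RtoC x)) with (RtoC x) by (unfold Cconj, RtoC; simpl; f_equal; ring).
  intros E; apply (f_equal Im) in E; unfold Im in *; simpl in E; lra.
Qed.

Lemma zth_conj_0 : zth 1 (- (PI / 3)) 0 = Cconj (zth 1 (PI / 3) 0).
Proof.
  unfold zth, polar, Cconj; simpl; rewrite !Rmult_0_r, !Rplus_0_l, cos_neg, sin_neg; f_equal; ring.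
Qed.

Lemma zth_0_0 : zth 1 0 0 = RtoC (/ 2).
Proof. unfold zth, polar, RtoC; rewrite Rmult_0_r, Rplus_0_l, cos_0, sin_0; f_equal; field. Qed.

Lemma zth_3_0 : zth (-3) PI 0 = RtoC (- / 2).
Proof. unfold zth, polar, RtoC; rewrite Rmult_0_r, Rplus_0_l, cos_PI, cos_0, sin_PI; f_equal; field. Qed.

(** At [t = 0] two of the points are real and the other two are conjugate with equal weights. *)
Lemma Im_bracket_0 (s : nat) :
  Im (L s (zth (-3) PI 0) + 3 * L s (zth 1 (PI / 3) 0) + 3 * L s (zth 1 (- (PI / 3)) 0) - 2 * L s (zth 1 0 0))%C = 0.
Proof.
  rewrite zth_conj_0, L_conj, zth_0_0, zth_3_0.
  generalize (Im_L_R s (/ 2)) (Im_L_R s (- / 2)); unfold Im; simpl; intros -> ->; ring.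
Qed.

Lemma Im_L2_bracket (t : R) : 0 <= t < PI / 3 ->
  Im (L 2 (zth (-3) PI t) + 3 * L 2 (zth 1 (PI / 3) t) + 3 * L 2 (zth 1 (- (PI / 3)) t)
    - 2 * L 2 (zth 1 0 t))%C = t * lc t.
Proof.
  intros Ht; assert (HP := PI_RGT_0).
  destruct (Req_dec t 0) as [->|Nt]; [rewrite Im_bracket_0; ring|].
  pose (F := fun t => (L 2 (zth (-3) PI t) + 3 * L 2 (zth 1 (PI / 3) t) + 3 * L 2 (zth 1 (- (PI / 3)) t)
    - 2 * L 2 (zth 1 0 t) - Ci * RtoC (t * lc t))%C).
  assert (D : forall u, 0 <= u < PI / 3 -> dC F u
     (- Clog (1 - zth (-3) PI u) * (tan u, -3) + 3 * (- Clog (1 - zth 1 (PI / 3) u) * (tan u, 1%R))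
      + 3 * (- Clog (1 - zth 1 (- (PI / 3)) u) * (tan u, 1%R)) - 2 * (- Clog (1 - zth 1 0 u) * (tan u, 1%R))
      - Ci * RtoC (1 * lc u + u * - tan u))%C).
  { intros u Hu; apply dC_minus; [apply dC_minus; [apply dC_plus; [apply dC_plus|]|]|].
    - now apply dC_L2_zth.
    - apply dC_scal; now apply dC_L2_zth.
    - apply dC_scal; now apply dC_L2_zth.
    - apply dC_scal; now apply dC_L2_zth.
    - apply dC_scal, (dC_RtoC (fun t => t * lc t)).
      apply (is_derive_mult (fun t => t) lc); [apply (is_derive_id (K := R_AbsRing))| |intros; apply Rmult_comm].
      apply is_derive_lc; generalize (cos_range u Hu); lra. }
  assert (E : Im (F 0) = Im (F t)).
  { apply (Im_0_limits F 0 t); [lra| | |].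
    - intros u Hu; eexists; split; [apply D; lra|].
      rewrite Clog_1_sub_zth_0, Clog_1_sub_zth_p, Clog_1_sub_zth_m, Clog_1_sub_zth_3 by lra; simpl; field.
    - refine (dC_at_right _ _ _ (D 0 _)); lra.
    - exact (dC_at_left _ _ _ (D t Ht)). }
  unfold F in E; assert (H0 := Im_bracket_0 2); unfold Im in *; simpl in *; lra.
Qed.

(** The coefficients 1, 3, 3, -2 make both the [tan t] part and the remaining part of the derivative
    elementary; these are the two dilogarithm brackets above. The base point is [t = 0], where the
    imaginary part vanishes. *)
Lemma Im_L3_bracket (t : R) : 0 < t < PI / 3 ->
  Im (L 3 (zth (-3) PI t) + 3 * L 3 (zth 1 (PI / 3) t) + 3 * L 3 (zth 1 (- (PI / 3)) t)
    - 2 * L 3 (zth 1 0 t))%C = PI ^ 2 / 6 * t - t * lc t ^ 2 / 2 - 7 * t ^ 3 / 6.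
Proof.
  intros Ht; assert (HP := PI_RGT_0).
  pose (q := fun t => PI ^ 2 / 6 * t - t * lc t ^ 2 / 2 - 7 * t ^ 3 / 6).
  pose (F := fun t => (L 3 (zth (-3) PI t) + 3 * L 3 (zth 1 (PI / 3) t) + 3 * L 3 (zth 1 (- (PI / 3)) t)
    - 2 * L 3 (zth 1 0 t) - Ci * RtoC (q t))%C).
  assert (Dq : forall u, 0 < cos u ->
     is_derive q u (PI ^ 2 / 6 - lc u ^ 2 / 2 + u * lc u * tan u - 7 * u ^ 2 / 2)).
  { intros u Hu.
    apply (is_derive_ext (fun t => (PI ^ 2 / 6 * t - 7 * t ^ 3 / 6) - (t * / 2) * lc t ^ 2)).
    { intros v; unfold q; simpl; field. }
    evar_last.
    - apply (@is_derive_minus R_AbsRing R_NormedModule).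
      + instantiate (1 := PI ^ 2 / 6 - 7 * u ^ 2 / 2); auto_derive; auto; field.
      + apply (is_derive_mult (fun t => t * / 2) (fun t => lc t ^ 2)); [|apply is_derive_pow, is_derive_lc, Hu|intros; apply Rmult_comm].
        instantiate (1 := / 2); auto_derive; auto; field.
    - unfold minus, plus, opp, mult; simpl; field. }
  assert (D : forall u, 0 <= u < PI / 3 -> dC F u
     (L 2 (zth (-3) PI u) * (tan u, -3) + 3 * (L 2 (zth 1 (PI / 3) u) * (tan u, 1%R))
      + 3 * (L 2 (zth 1 (- (PI / 3)) u) * (tan u, 1%R)) - 2 * (L 2 (zth 1 0 u) * (tan u, 1%R))
      - Ci * RtoC (PI ^ 2 / 6 - lc u ^ 2 / 2 + u * lc u * tan u - 7 * u ^ 2 / 2))%C).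
  { intros u Hu; apply dC_minus; [apply dC_minus; [apply dC_plus; [apply dC_plus|]|]|].
    - now apply dC_L3_zth.
    - apply dC_scal; now apply dC_L3_zth.
    - apply dC_scal; now apply dC_L3_zth.
    - apply dC_scal; now apply dC_L3_zth.
    - apply dC_scal, (dC_RtoC q), Dq; generalize (cos_range u Hu); lra. }
  assert (E : Im (F 0) = Im (F t)).
  { apply (Im_0_limits F 0 t); [lra| | |].
    - intros u Hu; eexists; split; [apply D; lra|].
      generalize (Re_L2_bracket u ltac:(lra)) (Im_L2_bracket u ltac:(lra)); unfold Im, Re; simpl; intros H1 H2.
      (* Regrouped as [tan u] times the imaginary dilogarithm bracket plus the real, [k]-weighted
         one. *)
      match goal with |- ?e = 0 => replace e with
       (tan u * (snd (L 2 (zth (-3) PI u)) + (3 * snd (L 2 (zth 1 (PI / 3) u)) + 0 * fst (L 2 (zth 1 (PI / 3) u))) +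
         (3 * snd (L 2 (zth 1 (- (PI / 3)) u)) + 0 * fst (L 2 (zth 1 (- (PI / 3)) u))) +
          - (2 * snd (L 2 (zth 1 0 u)) + 0 * fst (L 2 (zth 1 0 u))) - u * lc u)
        + (-3 * fst (L 2 (zth (-3) PI u)) + 3 * fst (L 2 (zth 1 (PI / 3) u)) + 3 * fst (L 2 (zth 1 (- (PI / 3)) u))
          - 2 * fst (L 2 (zth 1 0 u)) - (PI ^ 2 / 6 - lc u ^ 2 / 2 - 7 * u ^ 2 / 2))) by field end.
      rewrite H2, H1; simpl; field.
    - refine (dC_at_right _ _ _ (D 0 _)); lra.
    - refine (dC_at_left _ _ _ (D t _)); lra. }
  unfold F in E; assert (H0 := Im_bracket_0 3).
  fold (q t); assert (Q0 : q 0 = 0) by (unfold q; field).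
  rewrite Q0 in E; unfold Im in *; simpl in *; lra.
Qed.

Lemma sqrt2_inv : / (2 * cos (PI / 4)) = / sqrt 2.
Proof.
  rewrite cos_PI4; f_equal; assert (H : sqrt 2 * sqrt 2 = 2) by (apply sqrt_sqrt; lra).
  assert (0 < sqrt 2) by (apply sqrt_lt_R0; lra).
  field [H]; lra.
Qed.

(** At [t = PI / 4] the curves [(-3, PI)] and [(1, 0)] meet at [(1 + i) / 2], so their contributions
    to [Im_L3_bracket] collapse to [1 - 2 = -1] times the constant [GG]; the two others pass through
    arguments [7 PI / 12] and [- PI / 12]. *)
Lemma Im_L3_7_12 :
  3 * (Im (L 3 (polar (/ sqrt 2) (7 * PI / 12))) - Im (L 3 (polar (/ sqrt 2) (PI / 12)))) =
  Im (L 3 (polar (/ sqrt 2) (PI / 4))) + 3 * PI ^ 3 / 128 - PI * ln 2 ^ 2 / 32.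
Proof.
  assert (HP := PI_RGT_0).
  generalize (Im_L3_bracket (PI / 4) ltac:(lra)); unfold zth; rewrite sqrt2_inv.
  replace (-3 * (PI / 4) + PI) with (PI / 4) by field.
  replace (1 * (PI / 4) + PI / 3) with (7 * PI / 12) by field.
  replace (1 * (PI / 4) + - (PI / 3)) with (- (PI / 12)) by field.
  replace (1 * (PI / 4) + 0) with (PI / 4) by field.
  replace (polar (/ sqrt 2) (- (PI / 12))) with (Cconj (polar (/ sqrt 2) (PI / 12))).
  2:{ unfold polar, Cconj; simpl; rewrite cos_neg, sin_neg; f_equal; ring. }
  assert (Hl : lc (PI / 4) = ln 2 / 2).
  { unfold lc; rewrite <- (Rinv_inv (2 * cos (PI / 4))), sqrt2_inv, Rinv_inv.
    assert (E : ln 2 = ln (sqrt 2) + ln (sqrt 2)).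
    { rewrite <- ln_mult by (apply sqrt_lt_R0; lra); rewrite sqrt_sqrt; lra. }
    rewrite E; field. }
  rewrite Hl, L_conj; unfold Im; simpl; intros H; lra.
Qed.

(** * The central binomial series *)

(** For [j = 0] these are the coefficients of [arcsin k / sqrt (1 - k^2)], in powers [k^(2n+1)];
    each step in [j] is an integration against [dk / k]. *)
Definition cb (j n : nat) : R := 4 ^ n / (INR (2 * n + 1) ^ S j * Binomial.C (2 * n) n).

Lemma C_2n_pos (n : nat) : 0 < Binomial.C (2 * n) n.
Proof.
  unfold Binomial.C; apply Rdiv_lt_0_compat; [apply INR_fact_lt_0|].
  apply Rmult_lt_0_compat; apply INR_fact_lt_0.
Qed.

Lemma C_2n_S (n : nat) : Binomial.C (2 * S n) (S n) * INR (S n) = Binomial.C (2 * n) n * (2 * INR (2 * n + 1)).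
Proof.
  unfold Binomial.C.
  replace (2 * S n - S n)%nat with (S n) by lia; replace (2 * n - n)%nat with n by lia.
  replace (2 * S n)%nat with (S (S (2 * n))) by lia.
  rewrite !fact_simpl, !mult_INR.
  replace (INR (S (S (2 * n)))) with (2 * INR (S n)) by (rewrite !S_INR, mult_INR; simpl; ring).
  replace (2 * n + 1)%nat with (S (2 * n)) by lia.
  assert (H1 := INR_fact_neq_0 n); assert (H2 : INR (S n) <> 0) by (apply not_0_INR; lia).
  field; auto.
Qed.

Lemma cb_pos (j n : nat) : 0 < cb j n.
Proof.
  unfold cb; apply Rdiv_lt_0_compat; [apply pow_lt; lra|].
  apply Rmult_lt_0_compat; [apply pow_lt, lt_0_INR; lia|apply C_2n_pos].
Qed.

Lemma INR_odd (n : nat) : INR (2 * n + 1) = 2 * INR n + 1.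
Proof. rewrite plus_INR, mult_INR; simpl; ring. Qed.

Lemma cb_S (j n : nat) : cb j n = (2 * INR n + 1) * cb (S j) n.
Proof.
  unfold cb; rewrite <- INR_odd; assert (H := C_2n_pos n).
  assert (P : 0 < INR (2 * n + 1)) by (apply lt_0_INR; lia).
  generalize dependent (INR (2 * n + 1)); intros p P; generalize dependent (Binomial.C (2 * n) n); intros v H.
  assert (Q : 0 < p ^ j) by (now apply pow_lt).
  simpl; field; lra.
Qed.

Lemma cb_0_rec (n : nat) : (2 * INR (S n) + 1) * cb 0 (S n) = (2 * INR n + 2) * cb 0 n.
Proof.
  unfold cb; rewrite !pow_1, !INR_odd.
  assert (H := C_2n_S n); assert (P := C_2n_pos n); assert (P' := C_2n_pos (S n)).
  rewrite INR_odd, S_INR in H; rewrite S_INR.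
  assert (N := pos_INR n).
  set (u := Binomial.C (2 * S n) (S n)) in *; set (v := Binomial.C (2 * n) n) in *.
  rewrite <- tech_pow_Rmult.
  assert (E : u = v * (2 * (2 * INR n + 1)) / (INR n + 1)) by (rewrite <- H; field; lra).
  rewrite E; field; repeat split; lra.
Qed.

Lemma cb_le_1 (j n : nat) : cb j n <= 1.
Proof.
  revert n; induction j as [|j IH]; intros n.
  - induction n as [|n IHn].
    + unfold cb, Binomial.C; simpl; lra.
    + assert (H := cb_0_rec n); assert (N := pos_INR n); rewrite S_INR in H.
      assert (P := cb_pos 0 n); assert (P' := cb_pos 0 (S n)); nra.
  - specialize (IH n); rewrite cb_S in IH.
    assert (N := pos_INR n); assert (P := cb_pos (S j) n); nra.
Qed.

Lemma CV_radius_le_1 (a : nat -> R) (x : R) :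
  (forall n, Rabs (a n) <= 1) -> Rabs x < 1 -> Rbar_lt (Rabs x) (CV_radius a).
Proof.
  intros Ha Hx; destruct (CV_radius_bounded a) as [H _].
  apply Rbar_lt_le_trans with 1; [exact Hx|].
  apply (H 1); exists 1; intros n; rewrite pow1, Rmult_1_r; apply Ha.
Qed.

Lemma ex_pseries_1 (a : nat -> R) (x : R) :
  (forall n, Rabs (a n) <= 1) -> Rabs x < 1 -> ex_pseries a x.
Proof. intros Ha Hx; now apply CV_radius_inside, CV_radius_le_1. Qed.

Lemma ex_pseries_derive_1 (a : nat -> R) (x : R) :
  (forall n, Rabs (a n) <= 1) -> Rabs x < 1 -> ex_pseries (PS_derive a) x.
Proof. intros Ha Hx; apply CV_radius_inside; rewrite CV_radius_derive; now apply CV_radius_le_1. Qed.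

Lemma PSeries_odd (a : nat -> R) (x : R) : (forall n, Rabs (a n) <= 1) -> Rabs x < 1 ->
  is_pseries (fun n => (2 * INR n + 1) * a n) x (PSeries a x + 2 * (x * PSeries (PS_derive a) x)).
Proof.
  intros Ha Hx.
  generalize (is_pseries_plus _ _ _ _ _ (PSeries_correct _ _ (ex_pseries_1 a x Ha Hx))
    (is_pseries_scal 2 _ x _ (Rmult_comm _ _)
      (is_pseries_incr_1 _ _ _ (PSeries_correct _ _ (ex_pseries_derive_1 a x Ha Hx))))).
  apply is_pseries_ext; intros [|n]; unfold PS_plus, PS_scal, PS_incr_1, PS_derive, plus, scal, zero; simpl;
    unfold mult; simpl; ring.
Qed.

Lemma is_derive_odd (a : nat -> R) (k : R) : (forall n, Rabs (a n) <= 1) -> Rabs k < 1 ->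
  is_derive (fun k => k * PSeries a (k ^ 2)) k (PSeries (fun n => (2 * INR n + 1) * a n) (k ^ 2)).
Proof.
  intros Ha Hk.
  assert (Hx : Rabs (k ^ 2) < 1).
  { rewrite <- RPow_abs; generalize (Rabs_pos k); nra. }
  rewrite (is_pseries_unique _ _ _ (PSeries_odd a (k ^ 2) Ha Hx)).
  evar_last.
  - apply (is_derive_mult (fun k => k) (fun k => PSeries a (k ^ 2))); [apply (is_derive_id (K := R_AbsRing))| |intros; apply Rmult_comm].
    apply (is_derive_comp (V := R_NormedModule) (PSeries a) (fun k => k ^ 2)).
    + apply is_derive_PSeries; now apply CV_radius_le_1.
    + instantiate (1 := 2 * k); auto_derive; auto; ring.
  - unfold plus, mult, scal, one; simpl; unfold mult; simpl; ring.
Qed.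

Definition fb (j : nat) (k : R) : R := k * PSeries (cb j) (k ^ 2).

Lemma cb_abs (j n : nat) : Rabs (cb j n) <= 1.
Proof. rewrite Rabs_pos_eq by (left; apply cb_pos); apply cb_le_1. Qed.

Lemma is_derive_fb_S (j : nat) (k : R) : k <> 0 -> Rabs k < 1 -> is_derive (fb (S j)) k (fb j k / k).
Proof.
  intros Hk H; unfold fb at 2; replace (k * PSeries (cb j) (k ^ 2) / k) with (PSeries (cb j) (k ^ 2)) by (field; exact Hk).
  rewrite (PSeries_ext (cb j) (fun n => (2 * INR n + 1) * cb (S j) n)) by (intros n; apply cb_S).
  apply is_derive_odd; [apply cb_abs|exact H].
Qed.

Lemma is_derive_fb_0 (k : R) : Rabs k < 1 -> is_derive (fb 0) k ((1 + k * fb 0 k) / (1 - k ^ 2)).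
Proof.
  intros Hk.
  assert (Hx : Rabs (k ^ 2) < 1) by (rewrite <- RPow_abs; generalize (Rabs_pos k); nra).
  evar_last; [apply is_derive_odd; [apply cb_abs|exact Hk]|].
  assert (Hodd := PSeries_odd (cb 0) (k ^ 2) (cb_abs 0) Hx).
  set (g := PSeries (fun n => (2 * INR n + 1) * cb 0 n) (k ^ 2)).
  assert (Hg : is_pseries (fun n => (2 * INR n + 1) * cb 0 n) (k ^ 2) g).
  { unfold g; rewrite (is_pseries_unique _ _ _ Hodd); exact Hodd. }
  assert (H0 : g = 1 + k ^ 2 * (PSeries (cb 0) (k ^ 2) + g)).
  { unfold g at 1; rewrite PSeries_decr_1 by (eexists; exact Hg).
    f_equal; [unfold cb, Binomial.C; simpl; field|f_equal].
    apply is_pseries_unique.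
    generalize (is_pseries_plus _ _ _ _ _ (PSeries_correct _ _ (ex_pseries_1 (cb 0) (k ^ 2) (cb_abs 0) Hx)) Hg).
    apply is_pseries_ext; intros n;
    change (cb 0 n + (2 * INR n + 1) * cb 0 n = (2 * INR (S n) + 1) * cb 0 (S n)); rewrite cb_0_rec; ring. }
  assert (Hk2 : 1 - k ^ 2 <> 0).
  { apply Rabs_def2 in Hx; lra. }
  unfold fb.
  apply (Rmult_eq_reg_r (1 - k ^ 2)); [|exact Hk2].
  unfold Rdiv; rewrite Rmult_assoc, Rinv_l, Rmult_1_r by exact Hk2.
  set (h := PSeries (cb 0) (k ^ 2)) in *; nra.
Qed.

(** [kr r = sin (2 arctan r)], which makes [sqrt (1 - k^2) = (1 - r^2) / (1 + r^2)] rational. *)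
Definition kr (r : R) : R := 2 * r / (1 + r ^ 2).

Lemma is_derive_kr (r : R) : is_derive kr r (2 * (1 - r ^ 2) / (1 + r ^ 2) ^ 2).
Proof. unfold kr; auto_derive; [nra|field; nra]. Qed.

Lemma kr_range (r : R) : 0 <= r < 1 -> 0 <= kr r < 1.
Proof.
  intros H; unfold kr; split; [apply Rmult_le_pos; [lra|left; apply Rinv_0_lt_compat; nra]|].
  apply Rlt_div_l; nra.
Qed.

Lemma kr_pos (r : R) : 0 < r -> 0 < kr r.
Proof. intros H; unfold kr; apply Rdiv_lt_0_compat; nra. Qed.

Lemma kr_abs (r : R) : 0 <= r < 1 -> Rabs (kr r) < 1.
Proof. intros H; destruct (kr_range r H); rewrite Rabs_pos_eq; lra. Qed.

Lemma is_derive_at_left (f : R -> R) (t l : R) : is_derive f t l -> filterlim f (at_left t) (locally (f t)).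
Proof.
  intros D; eapply filterlim_filter_le_1; [apply at_left_le_locally|].
  apply (ex_derive_continuous (K := R_AbsRing) (V := R_NormedModule)); eexists; exact D.
Qed.

Lemma is_derive_at_right (f : R -> R) (t l : R) : is_derive f t l -> filterlim f (at_right t) (locally (f t)).
Proof.
  intros D; eapply filterlim_filter_le_1; [apply at_right_le_locally|].
  apply (ex_derive_continuous (K := R_AbsRing) (V := R_NormedModule)); eexists; exact D.
Qed.

(** This is [arcsin k = 2 arctan r], obtained from the differential equation: the left side has
    derivative [2 / (1 + r^2)] and vanishes at 0. *)
Lemma fb_0_kr (r : R) : 0 < r < 1 -> fb 0 (kr r) * ((1 - r ^ 2) / (1 + r ^ 2)) = 2 * atan r.
Proof.
  intros Hr.
  pose (F := fun r => fb 0 (kr r) * ((1 - r ^ 2) / (1 + r ^ 2)) - 2 * atan r).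
  assert (D : forall u, 0 <= u < 1 -> is_derive F u 0).
  { intros u Hu; unfold F; evar_last.
    - apply (@is_derive_minus R_AbsRing R_NormedModule).
      + apply (is_derive_mult (fun r => fb 0 (kr r)) (fun r => (1 - r ^ 2) / (1 + r ^ 2))); [| |intros; apply Rmult_comm].
        * apply (is_derive_comp (V := R_NormedModule) (fb 0) kr); [apply is_derive_fb_0; now apply kr_abs|apply is_derive_kr].
        * instantiate (1 := - 4 * u / (1 + u ^ 2) ^ 2); auto_derive; [nra|field; nra].
      + instantiate (1 := 2 / (1 + u ^ 2)); evar_last; [apply is_derive_scal, is_derive_atan|unfold Rsqr; simpl; field; nra].
    - assert (K : 1 - kr u ^ 2 = ((1 - u ^ 2) / (1 + u ^ 2)) ^ 2) by (unfold kr; field; nra).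
      rewrite K; set (y := fb 0 (kr u)); unfold minus, plus, opp, mult, scal; simpl; unfold mult; simpl.
      unfold kr; field; split; apply Rgt_not_eq; nra. }
  assert (E : F 0 = F r).
  { apply (deriv_0_limits F 0 r); [lra|intros; apply D; lra| |].
    - refine (is_derive_at_right _ _ _ (D 0 _)); lra.
    - refine (is_derive_at_left _ _ _ (D r _)); lra. }
  unfold F in E at 1; replace (kr 0) with 0 in E by (unfold kr; field).
  replace (fb 0 0) with 0 in E by (unfold fb; ring); rewrite atan_0 in E; unfold F in E; lra.
Qed.

(** * Polylogarithms on the imaginary axis *)

Lemma dC_Ci_R (c t : R) : dC (fun r => Ci * RtoC (c * r))%C t (Ci * RtoC c)%C.
Proof. apply dC_scal, (dC_RtoC (fun r => c * r)); auto_derive; auto; ring. Qed.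

Lemma Ci_R_lt_1 (r : R) : 0 <= r < 1 -> Cmod (Ci * RtoC r)%C < 1.
Proof. intros H; rewrite Cmod_mult, Cmod_Ci, Cmod_R, Rabs_pos_eq; lra. Qed.

Lemma Ci_R_neq_0 (r : R) : r <> 0 -> (Ci * RtoC r)%C <> 0%C.
Proof. intros H; apply Cmult_neq_0; [apply Ci_nz|now apply RtoC_neq_0]. Qed.

Lemma Clog_1_sub_iR (r : R) : Clog (1 - Ci * RtoC r)%C = (ln (1 + r ^ 2) / 2, - atan r).
Proof.
  unfold Clog, Ci, RtoC, Cminus, Cplus, Copp, Cmult; simpl; f_equal.
  - do 2 f_equal; ring.
  - rewrite <- atan_opp; f_equal; field.
Qed.

(** [kr' / kr = (1 - r^2) / (r (1 + r^2))] cancels the factor in [fb_0_kr] and leaves the integrand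
    [2 atan r / r], twice that of the inverse tangent integral [Im Li_2 (i r)]. *)
Lemma fb_1_kr (r : R) : 0 <= r < 1 -> fb 1 (kr r) = 2 * Im (L 2 (Ci * RtoC r)%C).
Proof.
  intros Hr.
  destruct (Req_dec r 0) as [->|Nr].
  { rewrite Cmult_0_r, L_0; unfold kr, fb; simpl; field. }
  pose (F := fun r => fb 1 (kr r) - 2 * Im (L 2 (Ci * RtoC (1 * r))%C)).
  assert (DL : forall u, 0 < u < 1 -> dC (fun r => L 2 (Ci * RtoC (1 * r))%C) u
     (- Clog (1 - Ci * RtoC (1 * u)) * (Ci * RtoC 1 / (Ci * RtoC (1 * u))))%C).
  { intros u Hu; apply (dC_L2 (fun r => Ci * RtoC (1 * r))%C).
    - apply Ci_R_lt_1; lra.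
    - apply Ci_R_neq_0; lra.
    - apply dC_Ci_R. }
  assert (D : forall u, 0 < u < 1 -> is_derive F u 0).
  { intros u Hu; unfold F; evar_last.
    - apply (@is_derive_minus R_AbsRing R_NormedModule).
      + apply (is_derive_comp (V := R_NormedModule) (fb 1) kr); [apply is_derive_fb_S; [|apply kr_abs; lra]|apply is_derive_kr].
        apply Rgt_not_eq, kr_pos; lra.
      + apply is_derive_scal; exact (proj2 (DL u Hu)).
    - replace (Ci * RtoC 1 / (Ci * RtoC (1 * u)))%C with (RtoC (/ u)).
      2:{ rewrite Rmult_1_l, RtoC_inv by lra; field; split; [apply RtoC_neq_0; lra|apply Ci_nz]. }
      rewrite Rmult_1_l, Clog_1_sub_iR.
      assert (H := fb_0_kr u Hu).
      assert (H2 : fb 0 (kr u) = 2 * atan u * (1 + u ^ 2) / (1 - u ^ 2)) by (rewrite <- H; field; nra).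
      rewrite H2; unfold minus, plus, opp, scal; simpl; unfold mult; simpl; unfold kr; field; repeat split; try nra. }
  assert (E : F 0 = F r).
  { apply (deriv_0_limits F 0 r); [lra|intros; apply D; lra| |].
    (* The derivative formula divides by [r], so at the endpoint 0 continuity is obtained from
       differentiability of the two power series instead. *)
    - assert (H0 : Cmod (Ci * RtoC (1 * 0))%C < 1) by (rewrite Rmult_0_r, Cmult_0_r, Cmod_0; lra).
      destruct (ex_dC_L 1 (fun r => Ci * RtoC (1 * r))%C 0 _ H0 (dC_Ci_R 1 0)) as [l [_ Hl]].
      assert (DF : exists l, is_derive F 0 l).
      { eexists; unfold F; apply (@is_derive_minus R_AbsRing R_NormedModule); [|apply is_derive_scal; exact Hl].
        apply (is_derive_comp (V := R_NormedModule) (fb 1) kr); [|apply is_derive_kr].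
        apply is_derive_odd; [apply cb_abs|apply kr_abs; lra]. }
      destruct DF as [l' Hl']; exact (is_derive_at_right _ _ _ Hl').
    - refine (is_derive_at_left _ _ _ (D r _)); lra. }
  unfold F in E; rewrite Rmult_0_r, Cmult_0_r, L_0, Rmult_1_l in E.
  replace (kr 0) with 0 in E by (unfold kr; field).
  replace (fb 1 0) with 0 in E by (unfold fb; ring); simpl in E; lra.
Qed.

(** [Bc' = chi 2 * (log (w / (1 - w^2)))'] *)
Definition Bc (w : C) : C :=
  (chi 3 w + / 2 * (Mp [(1%nat, RtoC 1); (2%nat, RtoC 1)] w - Mp [(1%nat, RtoC 1); (2%nat, RtoC (-1))] w
    + Mp [(1%nat, RtoC (-1)); (2%nat, RtoC (-1))] w - Mp [(1%nat, RtoC (-1)); (2%nat, RtoC 1)] w))%C.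

Lemma wf_2 (s1 s2 : nat) (z1 z2 : C) : (0 < s1)%nat -> (0 < s2)%nat -> Cmod z1 <= 1 -> Cmod z2 <= 1 ->
  wf [(s1, z1); (s2, z2)].
Proof. intros; constructor; [now split|now apply wf_1]. Qed.

Lemma Cmod_m1_le : Cmod (RtoC (-1)) <= 1.
Proof. rewrite Cmod_R, Rabs_left; lra. Qed.

Ltac wf12 := apply wf_2; [lia|lia| |]; (apply Cmod_1_le || apply Cmod_m1_le).

Lemma dC_chi3 (x : R -> C) (t : R) (x' : C) :
  Cmod (x t) < 1 -> x t <> 0%C -> dC x t x' -> dC (fun s => chi 3 (x s)) t (chi 2 (x t) * (x' / x t))%C.
Proof.
  intros H N D; unfold chi.
  assert (N' : (- x t)%C <> 0%C) by (intros E; apply N; replace (x t) with (- - x t)%C by ring; rewrite E; ring).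
  eapply dC_eq; [|apply dC_scal, dC_minus; [apply dC_L3; eassumption|
    apply (dC_L3 (fun s => - x s)%C); [now rewrite Cmod_opp|exact N'|apply dC_opp, D]]].
  cbv beta; field; exact N.
Qed.

Lemma dC_Mp_12 (z1 z2 : C) (x : R -> C) (t : R) (x' : C) : Cmod z1 <= 1 -> Cmod z2 <= 1 ->
  Cmod (x t) < 1 -> dC x t x' ->
  dC (fun s => Mp [(1%nat, z1); (2%nat, z2)] (x s)) t (L 2 (z1 * z2 * x t) * (z1 * x' / (1 - z1 * x t)))%C.
Proof.
  intros H1 H2 H D; rewrite <- Mp_single; apply dC_Mp_1_cons; auto; apply wf_2; auto.
Qed.

Lemma Cneq_1_sub (x : C) : Cmod x < 1 -> (1 - x)%C <> 0%C.
Proof. intros H; now apply Re_pos_neq, Re_gt_1_sub. Qed.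

Lemma Cneq_1_plus (x : C) : Cmod x < 1 -> (1 + x)%C <> 0%C.
Proof. intros H; replace (1 + x)%C with (1 - - x)%C by ring; apply Cneq_1_sub; now rewrite Cmod_opp. Qed.

Lemma dC_Bc (x : R -> C) (t : R) (x' : C) :
  Cmod (x t) < 1 -> x t <> 0%C -> dC x t x' ->
  dC (fun s => Bc (x s)) t (chi 2 (x t) * (x' / x t + 2 * x t * x' / (1 - x t * x t)))%C.
Proof.
  intros H N D; unfold Bc.
  eapply dC_eq; [|apply dC_plus; [apply dC_chi3; eassumption|apply dC_scal, dC_minus;
    [apply dC_plus; [apply dC_minus|]|]; apply dC_Mp_12; eauto using Cmod_1_le, Cmod_m1_le]].
  cbv beta; unfold chi.
  replace (1 * 1 * x t)%C with (x t) by ring.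
  replace (1 * RtoC (-1) * x t)%C with (- x t)%C by ring.
  replace (RtoC (-1) * RtoC (-1) * x t)%C with (x t) by ring.
  replace (RtoC (-1) * 1 * x t)%C with (- x t)%C by ring.
  assert (N1 := Cneq_1_sub _ H); assert (N2 := Cneq_1_plus _ H).
  field; repeat split; auto.
  - replace (1 - x t * x t)%C with ((1 - x t) * (1 + x t))%C by ring; now apply Cmult_neq_0.
  - replace (1 - RtoC (-1) * x t)%C with (1 + x t)%C by ring; exact N2.
Qed.

Lemma ex_dC_Bc (x : R -> C) (t : R) (x' : C) : Cmod (x t) < 1 -> dC x t x' ->
  exists l, dC (fun s => Bc (x s)) t l.
Proof.
  intros H D; unfold Bc, chi.
  assert (H' : Cmod (- x t)%C < 1) by now rewrite Cmod_opp.
  destruct (ex_dC_L 2 x t x' H D) as [l1 H1].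
  destruct (ex_dC_L 2 (fun s => - x s)%C t _ H' (dC_opp _ _ _ D)) as [l2 H2].
  destruct (ex_dC_Mp [(1%nat, RtoC 1); (2%nat, RtoC 1)] x t x' ltac:(wf12) H D) as [l3 H3].
  destruct (ex_dC_Mp [(1%nat, RtoC 1); (2%nat, RtoC (-1))] x t x' ltac:(wf12) H D) as [l4 H4].
  destruct (ex_dC_Mp [(1%nat, RtoC (-1)); (2%nat, RtoC (-1))] x t x' ltac:(wf12) H D) as [l5 H5].
  destruct (ex_dC_Mp [(1%nat, RtoC (-1)); (2%nat, RtoC 1)] x t x' ltac:(wf12) H D) as [l6 H6].
  eexists; exact (dC_plus _ _ _ _ _ (dC_scal _ _ _ _ (dC_minus _ _ _ _ _ H1 H2))
    (dC_scal _ _ _ _ (dC_minus _ _ _ _ _ (dC_plus _ _ _ _ _ (dC_minus _ _ _ _ _ H3 H4) H5) H6))).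
Qed.

Lemma Bc_0 : Bc 0 = 0%C.
Proof. unfold Bc; rewrite chi_0, !Mp_0 by wf12; ring. Qed.

Lemma chi2_iR (r : R) : chi 2 (Ci * RtoC (-1 * r))%C = (- (Ci * RtoC (Im (L 2 (Ci * RtoC r)))))%C.
Proof.
  unfold chi.
  replace (- (Ci * RtoC (-1 * r)))%C with (Ci * RtoC r)%C by (rewrite RtoC_mult; ring).
  replace (Ci * RtoC (-1 * r))%C with (Cconj (Ci * RtoC r)).
  - rewrite L_conj; destruct (L 2 (Ci * RtoC r)%C) as [u v].
    unfold Cconj, Ci, RtoC, Cminus, Cmult, Copp, Cplus, Cinv; simpl; f_equal; field.
  - unfold Cconj, Ci, RtoC, Cmult; simpl; f_equal; ring.
Qed.

(** With [w = - i r] one has [1 - w^2 = 1 + r^2], so [kr' / kr] is the logarithmic derivative of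
    [w / (1 - w^2)], the form in [Bc]. The factor [4 i] matches [chi 2 w = - i Im Li_2 (i r)] with
    [fb 1 = 2 Im Li_2 (i r)]. *)
Lemma fb_2_kr (r : R) : 0 < r < 1 -> 2 * fb 2 (kr r) = Re (4 * Ci * Bc (Ci * RtoC (-1 * r)))%C.
Proof.
  intros Hr.
  pose (F := fun r => (RtoC (2 * fb 2 (kr r)) - 4 * Ci * Bc (Ci * RtoC (-1 * r)))%C).
  assert (B : forall u, 0 <= u < 1 -> Cmod (Ci * RtoC (-1 * u))%C < 1).
  { intros u Hu; rewrite RtoC_mult, !Cmod_mult, Cmod_Ci, !Cmod_R, Rabs_left, Rabs_pos_eq; lra. }
  assert (Df : forall u, 0 < u < 1 -> dC (fun r => RtoC (2 * fb 2 (kr r))) u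
     (RtoC (2 * (2 * (1 - u ^ 2) / (1 + u ^ 2) ^ 2 * (fb 1 (kr u) / kr u))))).
  { intros u Hu; apply (dC_RtoC (fun r => 2 * fb 2 (kr r))), is_derive_scal.
    apply (is_derive_comp (V := R_NormedModule) (fb 2) kr); [apply is_derive_fb_S; [|apply kr_abs; lra]|apply is_derive_kr].
    apply Rgt_not_eq, kr_pos; lra. }
  assert (D : forall u, 0 < u < 1 -> dC F u (RtoC (2 * (2 * (1 - u ^ 2) / (1 + u ^ 2) ^ 2 * (fb 1 (kr u) / kr u)))
      - 4 * Ci * (chi 2 (Ci * RtoC (-1 * u)) * (Ci * RtoC (-1) / (Ci * RtoC (-1 * u))
         + 2 * (Ci * RtoC (-1 * u)) * (Ci * RtoC (-1)) / (1 - (Ci * RtoC (-1 * u)) * (Ci * RtoC (-1 * u))))))%C).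
  { intros u Hu; apply dC_minus; [now apply Df|]; apply dC_scal.
    apply (dC_Bc (fun r => Ci * RtoC (-1 * r))%C); [apply B; lra|apply Ci_R_neq_0; lra|apply dC_Ci_R]. }
  assert (E : Re (F 0) = Re (F r)).
  { apply (Re_0_limits F 0 r); [lra| | |].
    - intros u Hu; eexists; split; [apply D; lra|].
      rewrite chi2_iR, fb_1_kr by lra.
      assert (Nu : RtoC u <> 0%C) by (apply RtoC_neq_0; lra).
      replace (Ci * RtoC (-1) / (Ci * RtoC (-1 * u)))%C with (RtoC (/ u)).
      2:{ rewrite RtoC_mult, RtoC_inv by lra; field; repeat split; auto using Ci_nz; apply RtoC_neq_0; lra. }
      replace (2 * (Ci * RtoC (-1 * u)) * (Ci * RtoC (-1)) / (1 - (Ci * RtoC (-1 * u)) * (Ci * RtoC (-1 * u))))%C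
        with (RtoC (- (2 * u / (1 + u ^ 2)))).
      2:{ replace (1 - (Ci * RtoC (-1 * u)) * (Ci * RtoC (-1 * u)))%C with (RtoC (1 + u ^ 2)).
          2:{ unfold Ci, RtoC, Cminus, Cmult, Copp, Cplus; simpl; f_equal; ring. }
          replace (2 * (Ci * RtoC (-1 * u)) * (Ci * RtoC (-1)))%C with (RtoC (- (2 * u))).
          2:{ unfold Ci, RtoC, Cminus, Cmult, Copp, Cplus; simpl; f_equal; ring. }
          rewrite <- RtoC_div by nra; f_equal; field; nra. }
      rewrite <- RtoC_plus.
      destruct (L 2 (Ci * RtoC u)%C) as [p q]; unfold Ci, RtoC, Cminus, Cmult, Copp, Cplus, Im, Re; simpl.
      unfold kr; field; repeat split; nra.
    - destruct (ex_dC_Bc (fun r => Ci * RtoC (-1 * r))%C 0 _ (B 0 ltac:(lra)) (dC_Ci_R (-1) 0)) as [l Hl].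
      unfold F; clim_minus; [|clim_mult; [apply filterlim_const|exact (dC_at_right _ _ _ Hl)]].
      assert (DF : exists l, dC (fun r => RtoC (2 * fb 2 (kr r))) 0 l).
      { eexists; apply (dC_RtoC (fun r => 2 * fb 2 (kr r))), is_derive_scal.
        apply (is_derive_comp (V := R_NormedModule) (fb 2) kr); [|apply is_derive_kr].
        apply is_derive_odd; [apply cb_abs|apply kr_abs; lra]. }
      destruct DF as [l' Hl']; exact (dC_at_right _ _ _ Hl').
    - refine (dC_at_left _ _ _ (D r _)); lra. }
  unfold F in E; rewrite Rmult_0_r, Cmult_0_r, Bc_0 in E.
  replace (kr 0) with 0 in E by (unfold kr; field).
  replace (fb 2 0) with 0 in E by (unfold fb; ring).
  revert E; set (X := (4 * Ci * Bc _)%C); simpl; unfold Re; lra.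
Qed.

Lemma a_range : 0 < 2 - sqrt 3 < 1.
Proof.
  assert (H : sqrt 3 * sqrt 3 = 3) by (apply sqrt_sqrt; lra).
  assert (P : 0 < sqrt 3) by (apply sqrt_lt_R0; lra); split; nra.
Qed.

Lemma binomial_series_Bc :
  is_series (fun n : nat => / (INR (2 * n + 1) ^ 3 * Binomial.C (2 * n) n))
    (Re (4 * Ci * Bc (Ci * RtoC (-1 * (2 - sqrt 3))))%C).
Proof.
  rewrite <- fb_2_kr by apply a_range.
  assert (H : sqrt 3 * sqrt 3 = 3) by (apply sqrt_sqrt; lra).
  assert (P : 0 < sqrt 3) by (apply sqrt_lt_R0; lra).
  (* Since [2 - sqrt 3 = tan (PI / 12)], the value is [sin (PI / 6)]. The square of [1 / 2] cancels
     [4^n] in [cb], and the factor 2 in front cancels the leading [k] of [fb]. *)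
  replace (kr (2 - sqrt 3)) with (/ 2).
  2:{ unfold kr; apply (Rmult_eq_reg_r (2 * (1 + (2 - sqrt 3) ^ 2))); [|nra]. field_simplify; [|nra]. simpl; nra. }
  unfold fb; replace (2 * (/ 2 * PSeries (cb 2) ((/ 2) ^ 2))) with (PSeries (cb 2) (/ 4)).
  2:{ replace ((/ 2) ^ 2) with (/ 4) by field; field. }
  assert (Hq : Rabs (/ 4) < 1) by (rewrite Rabs_pos_eq; lra).
  generalize (PSeries_correct _ _ (ex_pseries_1 (cb 2) (/ 4) (cb_abs 2) Hq)); unfold is_pseries.
  apply is_series_ext; intros n; rewrite pow_n_pow.
  change ((/ 4) ^ n * cb 2 n = / (INR (2 * n + 1) ^ 3 * Binomial.C (2 * n) n)).
  unfold cb; rewrite pow_inv.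
  assert (H1 := C_2n_pos n); assert (H2 : 0 < INR (2 * n + 1)) by (apply lt_0_INR; lia).
  assert (H3 : 0 < 4 ^ n) by (apply pow_lt; lra).
  field; lra.
Qed.

(** * Reduction to trilogarithms *)

(** [1 / (1 + Y)] is [1 - Y / (1 + Y)]: the reflection formula at [Y / (1 + Y)], followed by
    Landen's at [- Y]. *)
Lemma L2_inv_1_plus (Y : C) : Cmod Y < 1 -> 0 < Re Y ->
  L 2 (1 / (1 + Y))%C =
  (RtoC (PI ^ 2 / 6) + L 2 (- Y) + Clog Y * Clog (1 + Y) - / 2 * (Clog (1 + Y) * Clog (1 + Y)))%C.
Proof.
  intros HY Hre.
  assert (N1 := Cneq_1_plus Y HY).
  assert (P1 : 0 < Re (1 + Y)%C) by (replace (1 + Y)%C with (1 - - Y)%C by ring; apply Re_gt_1_sub; now rewrite Cmod_opp).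
  assert (Ez : (1 - Y / (1 + Y))%C = (1 / (1 + Y))%C) by (field; exact N1).
  assert (B1 : Cmod (Y / (1 + Y))%C < 1) by (apply Cmod_div_lt_1; destruct Y as [u v]; simpl in *; nra).
  assert (B2 : Cmod (1 / (1 + Y))%C < 1) by (apply Cmod_div_lt_1; destruct Y as [u v]; simpl in *; nra).
  assert (Pz : 0 < Re (Y / (1 + Y))%C).
  { replace (Y / (1 + Y))%C with (1 - 1 / (1 + Y))%C by (field; exact N1); now apply Re_gt_1_sub. }
  assert (HL := L2_Landen (- Y) ltac:(now rewrite Cmod_opp) ltac:(destruct Y as [u v]; simpl in *; lra)).
  replace (- Y / (- Y - 1))%C with (Y / (1 + Y))%C in HL.
  2:{ field; split; [|exact N1]; intros E; apply N1; replace (1 + Y)%C with (- (- Y - 1))%C by ring; rewrite E; ring. }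
  replace (1 - - Y)%C with (1 + Y)%C in HL by ring.
  assert (HR := L2_reflection (Y / (1 + Y))%C B1 ltac:(now rewrite Ez)).
  rewrite Ez, L2_1, HL in HR.
  assert (E1 : Clog (1 / (1 + Y))%C = (- Clog (1 + Y))%C).
  { rewrite <- Clog_inv by exact P1; f_equal; field; exact N1. }
  assert (E2 : Clog (Y / (1 + Y))%C = (Clog Y - Clog (1 + Y))%C).
  { unfold Cdiv; rewrite Clog_mult; [rewrite Clog_inv by exact P1; ring|exact Hre|now apply Re_inv_pos|exact Pz]. }
  rewrite E1, E2 in HR; rewrite <- HR; field; apply RtoC_neq_0; lra.
Qed.

(** The direction [1 + i] gives [(Yp s)^2 = 2 i s^2], so [Yp s] is the square root of [i r] for
    [r = 2 s^2]. *)
Definition Yd : C := (1, 1).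
Definition Yp (s : R) : C := (RtoC s * Yd)%C.

(** By [L2_Landen], [L2_inv_1_plus] and [chi2_Cayley], the dilogarithms at these arguments reduce to
    [L 2 Y], [L 2 (- Y)] and logarithms. In the derivative the two occur in the proportion that
    [L2_dup] turns into [L 2 (Y^2)]. *)
Definition Up (Y : C) : C := (L 3 (Y / (Y - 1)) - L 3 (1 / (1 + Y)) + chi 3 Y + chi 3 ((1 - Y) / (1 + Y)))%C.

(** Meant for [x = log Y], [y = log (1 - Y)], [z = log (1 + Y)]. The divergent [x] occurs only next
    to quadratic terms in [y] and [z], which vanish at [Y = 0], so the expression tends to 0
    there. *)
Definition Pp (x y z : C) : C :=
  (/ 2 * (x * (/ 2 * (z * z) + y * z - / 2 * (y * y))) + / 6 * (y * y * y) - / 6 * (z * z * z)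
   + RtoC (PI ^ 2 / 6) * z + RtoC (PI ^ 2 / 8) * (y - z))%C.

Section Path.
Variable s : R.
Hypothesis Hs : 0 < s < / 2.

Let Y := Yp s.

Lemma Yp_lt_1 : Cmod Y < 1.
Proof.
  rewrite <- Cmod_1; apply Cmod_lt_sq; unfold Y, Yp, Yd, RtoC; simpl; nra.
Qed.

Lemma Yp_Re_pos : 0 < Re Y.
Proof. unfold Y, Yp, Yd, RtoC; simpl; lra. Qed.

Lemma Yp_neq_0 : Y <> 0%C.
Proof. apply Re_pos_neq, Yp_Re_pos. Qed.

Lemma Yp_1_sub_pos : 0 < Re (1 - Y)%C.
Proof. apply Re_gt_1_sub, Yp_lt_1. Qed.

Lemma Yp_1_plus_pos : 0 < Re (1 + Y)%C.
Proof. unfold Y, Yp, Yd, RtoC; simpl; lra. Qed.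

Lemma Yp_1_sub_neq : (1 - Y)%C <> 0%C.
Proof. apply Re_pos_neq, Yp_1_sub_pos. Qed.

Lemma Yp_sub_1_neq : (Y - 1)%C <> 0%C.
Proof. intros E; apply Yp_1_sub_neq; replace (1 - Y)%C with (- (Y - 1))%C by ring; rewrite E; ring. Qed.

Lemma Yp_1_plus_neq : (1 + Y)%C <> 0%C.
Proof. apply Re_pos_neq, Yp_1_plus_pos. Qed.

Lemma Yp_sq : (Y * Y)%C = (Ci * RtoC (2 * s ^ 2))%C.
Proof. unfold Y, Yp, Yd, RtoC, Ci, Cmult; simpl; f_equal; ring. Qed.

Let la := Clog Y.
Let lb := Clog (1 - Y)%C.
Let lz := Clog (1 + Y)%C.

Lemma dC_Up : dC (fun s => Up (Yp s)) s
  ((- L 2 Y - / 2 * (lb * lb)) * (Yd / Y + Yd / (1 - Y))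
   - (RtoC (PI ^ 2 / 6) + L 2 (- Y) + la * lz - / 2 * (lz * lz)) * - (Yd / (1 + Y))
   + chi 2 Y * (Yd / Y)
   + (RtoC (PI ^ 2 / 8) + / 2 * (la * (lz - lb)) - chi 2 Y) * (- (Yd / (1 - Y)) - Yd / (1 + Y)))%C.
Proof.
  assert (HY := Yp_lt_1); assert (Hre := Yp_Re_pos); assert (N0 := Yp_neq_0).
  assert (N1 := Yp_1_sub_neq); assert (N1' := Yp_sub_1_neq); assert (N2 := Yp_1_plus_neq).
  assert (D : dC Yp s Yd) by apply dC_ray.
  unfold Up; apply dC_plus; [apply dC_plus; [apply dC_minus|]|].
  - unfold lb; rewrite <- L2_Landen; [|exact HY|unfold Y, Yp, Yd, RtoC; simpl; lra].
    eapply dC_eq; [|apply (dC_L3 (fun s => Yp s / (Yp s - 1))%C);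
      [apply Cmod_x_sub_1_lt; fold Y; unfold Y, Yp, Yd, RtoC; simpl; lra| |
       apply dC_div; [exact N1'|exact D|apply dC_minus; [exact D|apply dC_const]]]].
    + cbv beta; fold Y; field; auto.
    + fold Y; intros E; apply N0; transitivity (Y / (Y - 1) * (Y - 1))%C; [field; exact N1'|rewrite E; ring].
  - unfold la, lz; rewrite <- L2_inv_1_plus by assumption.
    eapply dC_eq; [|apply (dC_L3 (fun s => 1 / (1 + Yp s))%C);
      [apply Cmod_div_lt_1; fold Y; unfold Y, Yp, Yd, RtoC; simpl; nra| |
       apply dC_div; [exact N2|apply dC_const|apply dC_plus; [apply dC_const|exact D]]]].
    + cbv beta; fold Y; field; auto.
    + fold Y; intros E; apply C1_nz; transitivity (1 / (1 + Y) * (1 + Y))%C; [field; exact N2|rewrite E; ring].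
  - now apply dC_chi3.
  - unfold la, lb, lz; rewrite <- chi2_1, <- chi2_Cayley by assumption.
    eapply dC_eq; [|apply (dC_chi3 (fun s => (1 - Yp s) / (1 + Yp s))%C);
      [now apply Cayley_lt_1| |
       apply dC_div; [exact N2|apply dC_minus; [apply dC_const|exact D]|apply dC_plus; [apply dC_const|exact D]]]].
    + cbv beta; fold Y; field; auto.
    + fold Y; intros E; apply N1; transitivity ((1 - Y) / (1 + Y) * (1 + Y))%C; [field; exact N2|rewrite E; ring].
Qed.

Lemma dC_Pp (a b c : R -> C) (t : R) (a' b' c' : C) : dC a t a' -> dC b t b' -> dC c t c' ->
  dC (fun s => Pp (a s) (b s) (c s)) t
   (/ 2 * (a' * (/ 2 * (c t * c t) + b t * c t - / 2 * (b t * b t)) + a t * (c t * c' + b' * c t + b t * c' - b t * b'))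
    + / 2 * (b t * b t * b') - / 2 * (c t * c t * c') + RtoC (PI ^ 2 / 6) * c' + RtoC (PI ^ 2 / 8) * (b' - c'))%C.
Proof.
  intros Da Db Dc; unfold Pp.
  eapply dC_eq; [|apply dC_plus; [apply dC_plus; [apply dC_minus; [apply dC_plus|]|]|]].
  2: apply dC_scal, dC_mult; [exact Da|apply dC_minus; [apply dC_plus; [apply dC_scal, dC_mult; exact Dc|apply dC_mult; eassumption]|apply dC_scal, dC_mult; exact Db]].
  2: apply dC_scal, dC_mult; [apply dC_mult; exact Db|exact Db].
  2: apply dC_scal, dC_mult; [apply dC_mult; exact Dc|exact Dc].
  2: apply dC_scal; exact Dc.
  2: apply dC_scal, dC_minus; eassumption.
  cbv beta; field; split; apply RtoC_neq_0; lra.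
Qed.

Lemma dC_logs : dC (fun s => Clog (Yp s)) s (Yd / Y)%C /\ dC (fun s => Clog (1 - Yp s)%C) s (- (Yd / (1 - Y)))%C
  /\ dC (fun s => Clog (1 + Yp s)%C) s (Yd / (1 + Y))%C.
Proof.
  assert (D : dC Yp s Yd) by apply dC_ray.
  split; [|split].
  - apply (dC_Clog Yp); [apply Yp_Re_pos|exact D].
  - eapply dC_eq; [|apply (dC_Clog (fun s => 1 - Yp s)%C); [apply Yp_1_sub_pos|apply dC_minus; [apply dC_const|exact D]]].
    cbv beta; fold Y; field; apply Yp_1_sub_neq.
  - eapply dC_eq; [|apply (dC_Clog (fun s => 1 + Yp s)%C); [apply Yp_1_plus_pos|apply dC_plus; [apply dC_const|exact D]]].
    cbv beta; fold Y; field; apply Yp_1_plus_neq.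
Qed.

Lemma log_sum : (lb + lz)%C = (ln (1 + (2 * s ^ 2) ^ 2) / 2, - atan (2 * s ^ 2)).
Proof. unfold lb, lz; rewrite <- Clog_1_sub_sq, Yp_sq by apply Yp_lt_1; apply Clog_1_sub_iR. Qed.

(** The products of logarithms in [Pp] are chosen so that only [L 2 (Y^2)] and [log^2 (1 - Y^2)] survive. *)
Lemma dC_Up_minus_Pp : dC (fun s => Up (Yp s) - Pp (Clog (Yp s)) (Clog (1 - Yp s)) (Clog (1 + Yp s)))%C s
  (- (/ 4 * (L 2 (Y * Y) * (Yd / Y + Yd / (1 - Y) - Yd / (1 + Y)))) - / 4 * ((lb + lz) * (lb + lz) * (Yd / Y)))%C.
Proof.
  destruct dC_logs as [Da [Db Dc]].
  eapply dC_eq; [|apply dC_minus; [apply dC_Up|apply dC_Pp; eassumption]].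
  cbv beta; fold Y la lb lz; unfold chi; rewrite L2_dup by (left; apply Yp_lt_1).
  generalize (Yd / Y)%C (Yd / (1 - Y))%C (Yd / (1 + Y))%C (L 2 Y) (L 2 (- Y)%C) la lb lz (RtoC (PI ^ 2 / 6)) (RtoC (PI ^ 2 / 8)).
  intros; field; split; apply RtoC_neq_0; lra.
Qed.

End Path.

Lemma Yp_0 : Yp 0 = 0%C.
Proof. unfold Yp; ring. Qed.

Lemma dC_Yp (t : R) : dC Yp t Yd.
Proof. apply dC_ray. Qed.

Lemma dC_neg_iR_sq (t : R) : dC (fun s => Ci * RtoC (-1 * (2 * s ^ 2)))%C t (Ci * RtoC (- (4 * t)))%C.
Proof. apply dC_scal, (dC_RtoC (fun s => -1 * (2 * s ^ 2))); auto_derive; auto; ring. Qed.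

(** The last term is the correction that closes the system. For [r = 2 s^2], differentiating
    [atan r] cancels the term [Re Li_2 (i r)] times the imaginary part of the logarithmic derivative
    of [Y / (1 - Y^2)]; differentiating [Re Li_2 (i r)] cancels the imaginary part of
    [log^2 (1 - Y^2)]. What is left, [Im Li_2 (i r)], is matched by [Bc]. *)
Definition Hp (s : R) : C :=
  (4 * Ci * Bc (Ci * RtoC (-1 * (2 * s ^ 2)))
   - RtoC 32 * Ci * (Up (Yp s) - Pp (Clog (Yp s)) (Clog (1 - Yp s)) (Clog (1 + Yp s)))
   + RtoC (8 * (atan (2 * s ^ 2) * Re (L 2 (Yp s * Yp s)%C))))%C.

Lemma dC_Hp (s : R) : 0 < s < / 2 -> exists l, dC Hp s l /\ Re l = 0.
Proof.
  intros Hs.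
  assert (HY := Yp_lt_1 s Hs); assert (N0 := Yp_neq_0 s Hs).
  assert (N1 := Yp_1_sub_neq s Hs); assert (N2 := Yp_1_plus_neq s Hs).
  assert (Hq : Cmod (Yp s * Yp s)%C < 1) by (rewrite Cmod_mult; generalize (Cmod_ge_0 (Yp s)); nra).
  assert (D2 := dC_L2 (fun s => Yp s * Yp s)%C s _ Hq (Cmult_neq_0 _ _ N0 N0) (dC_mult _ _ _ _ _ (dC_Yp s) (dC_Yp s))).
  eexists; split.
  - unfold Hp; apply dC_plus; [apply dC_minus; apply dC_scal|].
    + apply (dC_Bc (fun s => Ci * RtoC (-1 * (2 * s ^ 2)))%C); [|apply Ci_R_neq_0; nra|apply dC_neg_iR_sq].
      rewrite RtoC_mult, !Cmod_mult, Cmod_Ci, !Cmod_R, Rabs_left, Rabs_pos_eq; nra.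
    + now apply dC_Up_minus_Pp.
    + apply (dC_RtoC (fun s => 8 * (atan (2 * s ^ 2) * Re (L 2 (Yp s * Yp s)%C)))), is_derive_scal.
      apply (is_derive_mult (fun s => atan (2 * s ^ 2)) (fun s => Re (L 2 (Yp s * Yp s)%C))); [|exact (proj1 D2)|intros; apply Rmult_comm].
      instantiate (1 := 4 * s / (1 + (2 * s ^ 2) ^ 2)); auto_derive; auto; unfold Rsqr; field; nra.
  - cbv beta; rewrite log_sum, chi2_iR, Yp_sq, Clog_1_sub_iR by exact Hs.
    assert (Ns : RtoC s <> 0%C) by (apply RtoC_neq_0; lra).
    assert (Nd : 1 + (2 * s ^ 2) ^ 2 <> 0) by nra.
    assert (Nd' : RtoC (1 + (2 * s ^ 2) ^ 2) <> 0%C) by now apply RtoC_neq_0.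
    assert (Nyd : Yd <> 0%C) by (unfold Yd; intros E; apply (f_equal Re) in E; simpl in E; lra).
    assert (Nm : (1 - Yp s * Yp s)%C <> 0%C) by now apply Cneq_1_sub.
    replace (Yd / Yp s)%C with (RtoC (/ s)).
    2:{ rewrite RtoC_inv by lra; unfold Yp; field; auto. }
    replace ((Yd * Yp s + Yp s * Yd) / (Ci * RtoC (2 * s ^ 2)))%C with (RtoC (2 / s)).
    2:{ rewrite <- Yp_sq, RtoC_div by lra; unfold Yp; field; auto. }
    (* The logarithmic derivative of [Y / (1 - Y^2)] in coordinates; its imaginary part is the
       derivative of [atan (2 s^2)]. *)
    replace (RtoC (/ s) + Yd / (1 - Yp s) - Yd / (1 + Yp s))%C with
      ((/ s - 8 * s ^ 3 / (1 + (2 * s ^ 2) ^ 2), 4 * s / (1 + (2 * s ^ 2) ^ 2))).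
    2:{ replace (Yd / (1 - Yp s) - Yd / (1 + Yp s))%C with (2 * (Yp s * Yd) / (1 - Yp s * Yp s))%C.
        2:{ field; auto. }
        replace (RtoC (/ s) + Yd / (1 - Yp s) - Yd / (1 + Yp s))%C with
          (RtoC (/ s) + (Yd / (1 - Yp s) - Yd / (1 + Yp s)))%C by ring.
        replace (Yd / (1 - Yp s) - Yd / (1 + Yp s))%C with (2 * (Yp s * Yd) / (1 - Yp s * Yp s))%C by (field; auto).
        rewrite Yp_sq; unfold Yp, Yd, Ci, RtoC, Cdiv, Cinv, Cminus, Cmult, Copp, Cplus; simpl; f_equal; field; repeat split; nra. }
    replace (Ci * RtoC (- (4 * s)) / (Ci * RtoC (-1 * (2 * s ^ 2))) +
       2 * (Ci * RtoC (-1 * (2 * s ^ 2))) * (Ci * RtoC (- (4 * s))) /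
         (1 - Ci * RtoC (-1 * (2 * s ^ 2)) * (Ci * RtoC (-1 * (2 * s ^ 2)))))%C
      with (RtoC (2 / s - 16 * s ^ 3 / (1 + (2 * s ^ 2) ^ 2))).
    2:{ replace (Ci * RtoC (- (4 * s)) / (Ci * RtoC (-1 * (2 * s ^ 2))))%C with (RtoC (2 / s)).
        2:{ unfold Ci, RtoC, Cdiv, Cinv, Cmult; simpl; f_equal; field; nra. }
        replace (1 - Ci * RtoC (-1 * (2 * s ^ 2)) * (Ci * RtoC (-1 * (2 * s ^ 2))))%C with (RtoC (1 + (2 * s ^ 2) ^ 2)).
        2:{ unfold Ci, RtoC, Cminus, Cmult, Copp, Cplus; simpl; f_equal; ring. }
        replace (2 * (Ci * RtoC (-1 * (2 * s ^ 2))) * (Ci * RtoC (- (4 * s))))%C with (RtoC (- (16 * s ^ 3))).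
        2:{ unfold Ci, RtoC, Cminus, Cmult, Copp, Cplus; simpl; f_equal; ring. }
        rewrite <- RtoC_div, <- RtoC_plus by exact Nd; f_equal; field; split; [nra|lra]. }
    generalize (L 2 (Ci * RtoC (2 * s ^ 2))%C) (atan (2 * s ^ 2)) (ln (1 + (2 * s ^ 2) ^ 2)); intros [p q] u v.
    unfold Ci, RtoC, Cminus, Cmult, Copp, Cplus, Cinv, Im, Re, plus, mult, scal; simpl; unfold mult; simpl; field; split; [nra|lra].
Qed.

(** The base point is [s = 0], where two of the trilogarithm arguments reach 1 on the unit circle.
    There [Up] is a combination of the real numbers [L 3 1] and [L 3 (-1)], and multiplication by
    [i] makes its contribution to the real part vanish. *)
Lemma Re_Hp_eq_0 (s : R) : 0 < s < / 2 -> Re (Hp s) = 0.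
Proof.
  intros Hs.
  assert (Hlt : forall t, 0 < t < s -> 0 < t < / 2) by (intros; lra).
  assert (D0 := dC_Yp 0).
  assert (B0 : Cmod (Yp 0) < 1) by (rewrite Yp_0, Cmod_0; lra).
  assert (E1 : (1 - Yp 0)%C = RtoC 1) by (rewrite Yp_0; ring).
  assert (E2 : (1 + Yp 0)%C = RtoC 1) by (rewrite Yp_0; ring).
  assert (Db : dC (fun s => Clog (1 - Yp s)%C) 0 ((0 - Yd) / (1 - Yp 0))%C).
  { apply (dC_Clog (fun s => 1 - Yp s)%C); [rewrite E1; simpl; lra|apply dC_minus; [apply dC_const|exact D0]]. }
  assert (Dc : dC (fun s => Clog (1 + Yp s)%C) 0 ((0 + Yd) / (1 + Yp 0))%C).
  { apply (dC_Clog (fun s => 1 + Yp s)%C); [rewrite E2; simpl; lra|apply dC_plus; [apply dC_const|exact D0]]. }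
  assert (Cb : filterlim (fun s => Clog (1 - Yp s)%C) (at_right 0) (locally (RtoC 0))).
  { apply (Clim_eq _ _ (Clog (1 - Yp 0)%C)); [rewrite E1; apply Clog_1|exact (dC_at_right _ _ _ Db)]. }
  assert (Cc : filterlim (fun s => Clog (1 + Yp s)%C) (at_right 0) (locally (RtoC 0))).
  { apply (Clim_eq _ _ (Clog (1 + Yp 0)%C)); [rewrite E2; apply Clog_1|exact (dC_at_right _ _ _ Dc)]. }
  assert (CP : filterlim (fun s => Pp (Clog (Yp s)) (Clog (1 - Yp s)) (Clog (1 + Yp s)))%C (at_right 0) (locally (RtoC 0))).
  { unfold Pp.
    apply (Clim_eq _ _ (/ 2 * 0 + / 6 * (0 * 0 * 0) - / 6 * (0 * 0 * 0) + RtoC (PI ^ 2 / 6) * 0 + RtoC (PI ^ 2 / 8) * (0 - 0))%C).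
    { field; split; apply RtoC_neq_0; lra. }
    clim_plus; [clim_plus; [clim_minus; [clim_plus|]|]|].
    - clim_mult; [apply filterlim_const|].
      eapply (Clog_mult_lim_0 Yd (fun s => / 2 * (Clog (1 + Yp s) * Clog (1 + Yp s)) + Clog (1 - Yp s) * Clog (1 + Yp s)
         - / 2 * (Clog (1 - Yp s) * Clog (1 - Yp s)))%C); [simpl; lra| |].
      + rewrite E1, E2, Clog_1; ring.
      + apply dC_minus; [apply dC_plus; [apply dC_scal, dC_mult; exact Dc|apply dC_mult; [exact Db|exact Dc]]|apply dC_scal, dC_mult; exact Db].
    - clim_mult; [apply filterlim_const|clim_mult; [clim_mult; exact Cb|exact Cb]].
    - clim_mult; [apply filterlim_const|clim_mult; [clim_mult; exact Cc|exact Cc]].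
    - clim_mult; [apply filterlim_const|exact Cc].
    - clim_mult; [apply filterlim_const|clim_minus; [exact Cb|exact Cc]]. }
  assert (N1 : (Yp 0 - 1)%C <> 0%C) by (rewrite Yp_0; intros E; apply (f_equal Re) in E; simpl in E; lra).
  assert (N2 : (1 + Yp 0)%C <> 0%C) by (rewrite E2; apply C1_nz).
  assert (CU : filterlim (fun s => Up (Yp s)) (at_right 0) (locally (Up (Yp 0)))).
  { unfold Up; clim_plus; [clim_plus; [clim_minus|]|].
    - eapply (L_at_right 0 s 1 (fun s => Yp s / (Yp s - 1))%C); [lra| | |apply dC_div; [exact N1|exact D0|apply dC_minus; [exact D0|apply dC_const]]].
      + intros t Ht; left; apply Cmod_x_sub_1_lt; unfold Yp, Yd, RtoC; simpl; lra.
      + rewrite Yp_0; replace (0 / (0 - 1))%C with (RtoC 0); [rewrite Cmod_0; lra|].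
        field; intros E; apply (f_equal Re) in E; simpl in E; lra.
    - eapply (L_at_right 0 s 1 (fun s => 1 / (1 + Yp s))%C); [lra| | |apply dC_div; [exact N2|apply dC_const|apply dC_plus; [apply dC_const|exact D0]]].
      + intros t Ht; left; apply Cmod_div_lt_1; unfold Yp, Yd, RtoC; simpl; nra.
      + rewrite E2; replace (1 / 1)%C with (RtoC 1) by (field; apply C1_nz); apply Cmod_1_le.
    - unfold chi; clim_mult; [apply filterlim_const|clim_minus].
      + eapply (L_at_right 0 s 1 Yp); [lra|intros t Ht; left; apply Yp_lt_1; lra|lra|exact D0].
      + eapply (L_at_right 0 s 1 (fun s => - Yp s)%C); [lra|intros t Ht; rewrite Cmod_opp; left; apply Yp_lt_1; lra|rewrite Cmod_opp; lra|apply dC_opp; exact D0].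
    - unfold chi; clim_mult; [apply filterlim_const|].
      assert (Dw : dC (fun s => (1 - Yp s) / (1 + Yp s))%C 0 (((0 - Yd) * (1 + Yp 0) - (1 - Yp 0) * (0 + Yd)) / ((1 + Yp 0) * (1 + Yp 0)))%C).
      { apply dC_div; [exact N2|apply dC_minus; [apply dC_const|exact D0]|apply dC_plus; [apply dC_const|exact D0]]. }
      assert (Ew : ((1 - Yp 0) / (1 + Yp 0))%C = RtoC 1) by (rewrite E1, E2; field; apply C1_nz).
      clim_minus.
      + eapply (L_at_right 0 s 1 (fun s => (1 - Yp s) / (1 + Yp s))%C); [lra| |rewrite Ew; apply Cmod_1_le|exact Dw].
        intros t Ht; left; apply Cayley_lt_1, Yp_Re_pos; lra.
      + eapply (L_at_right 0 s 1 (fun s => - ((1 - Yp s) / (1 + Yp s)))%C); [lra| |rewrite Cmod_opp, Ew; apply Cmod_1_le|apply dC_opp; exact Dw].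
        intros t Ht; rewrite Cmod_opp; left; apply Cayley_lt_1, Yp_Re_pos; lra. }
  assert (EB : (Ci * RtoC (-1 * (2 * 0 ^ 2)))%C = RtoC 0) by (replace (-1 * (2 * 0 ^ 2)) with 0 by ring; ring).
  assert (CB : filterlim (fun s => Bc (Ci * RtoC (-1 * (2 * s ^ 2))))%C (at_right 0) (locally (RtoC 0))).
  { apply (Clim_eq _ _ (Bc (Ci * RtoC (-1 * (2 * 0 ^ 2)))%C)); [rewrite EB; apply Bc_0|].
    destruct (ex_dC_Bc (fun s => Ci * RtoC (-1 * (2 * s ^ 2)))%C 0 _ ltac:(cbv beta; rewrite EB, Cmod_0; lra) (dC_neg_iR_sq 0)) as [l Hl].
    exact (dC_at_right _ _ _ Hl). }
  assert (CL : filterlim (fun s => RtoC (8 * (atan (2 * s ^ 2) * Re (L 2 (Yp s * Yp s)%C)))) (at_right 0)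
     (locally (RtoC (8 * (atan (2 * 0 ^ 2) * Re (L 2 (Yp 0 * Yp 0)%C)))))).
  { assert (Bq : Cmod (Yp 0 * Yp 0)%C < 1) by (rewrite Yp_0, Cmult_0_l, Cmod_0; lra).
    destruct (ex_dC_L 1 (fun s => Yp s * Yp s)%C 0 _ Bq (dC_mult _ _ _ _ _ D0 D0)) as [l [Hl _]].
    assert (DD : exists l, dC (fun s => RtoC (8 * (atan (2 * s ^ 2) * Re (L 2 (Yp s * Yp s)%C)))) 0 l).
    { eexists; apply (dC_RtoC (fun s => 8 * (atan (2 * s ^ 2) * Re (L 2 (Yp s * Yp s)%C)))), is_derive_scal.
      apply (is_derive_mult (fun s => atan (2 * s ^ 2)) (fun s => Re (L 2 (Yp s * Yp s)%C))); [|exact Hl|intros; apply Rmult_comm].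
      instantiate (1 := 0); auto_derive; auto; unfold Rsqr; field. }
    destruct DD as [l' Hl']; exact (dC_at_right _ _ _ Hl'). }
  assert (E : Re (4 * Ci * 0 - RtoC 32 * Ci * (Up (Yp 0) - 0) + RtoC (8 * (atan (2 * 0 ^ 2) * Re (L 2 (Yp 0 * Yp 0)%C))))%C = Re (Hp s)).
  { apply (Re_0_limits Hp 0 s); [lra|intros; apply dC_Hp; lra| |].
    - unfold Hp; clim_plus; [clim_minus; [clim_mult; [apply filterlim_const|exact CB]|
        clim_mult; [apply filterlim_const|clim_minus; [exact CU|exact CP]]]|exact CL].
    - destruct (dC_Hp s Hs) as [l [Hl _]]; exact (dC_at_left _ _ _ Hl). }
  rewrite <- E.
  assert (EU : Im (Up (Yp 0)) = 0).
  { unfold Up; rewrite Yp_0; replace (0 / (0 - 1))%C with (RtoC 0).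
    2:{ field; intros Z; apply (f_equal Re) in Z; simpl in Z; lra. }
    replace (1 / (1 + 0))%C with (RtoC 1) by (field; intros Z; apply (f_equal Re) in Z; simpl in Z; lra).
    replace ((1 - 0) / (1 + 0))%C with (RtoC 1) by (field; intros Z; apply (f_equal Re) in Z; simpl in Z; lra).
    rewrite chi_0, L_0; unfold chi; replace (- (1))%C with (RtoC (-1)) by (rewrite <- RtoC_opp; reflexivity).
    generalize (Im_L_R 3 1) (Im_L_R 3 (-1)); unfold Im, RtoC, Cminus, Cmult, Copp, Cplus, Cinv; simpl; intros H1 H2; rewrite H1, H2; field. }
  replace (2 * 0 ^ 2) with 0 by ring; rewrite atan_0.
  revert EU; generalize (Up (Yp 0)) (L 2 (Yp 0 * Yp 0)%C); intros [u v] [p q] EU.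
  unfold Im in EU; simpl in *; rewrite EU; ring.
Qed.

(** * The closed form *)

(** The positive root of [2 s^2 + 2 s = 1], which is the condition that [Y] and [(1 - Y) / (1 + Y)]
    be conjugate for [Y = s (1 + i)]. *)
Definition s0 : R := (sqrt 3 - 1) / 2.

Lemma sqrt3_sq : sqrt 3 * sqrt 3 = 3.
Proof. apply sqrt_sqrt; lra. Qed.

Lemma sqrt2_sq : sqrt 2 * sqrt 2 = 2.
Proof. apply sqrt_sqrt; lra. Qed.

Lemma sqrt3_bounds : 1.7 < sqrt 3 < 1.8.
Proof. assert (H := sqrt3_sq); assert (P : 0 < sqrt 3) by (apply sqrt_lt_R0; lra); split; nra. Qed.

Lemma sqrt2_pos : 0 < sqrt 2.
Proof. apply sqrt_lt_R0; lra. Qed.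

Lemma s0_range : 0 < s0 < / 2.
Proof. generalize sqrt3_bounds; unfold s0; lra. Qed.

Lemma two_s0_sq : 2 * s0 ^ 2 = 2 - sqrt 3.
Proof. assert (H := sqrt3_sq); unfold s0; nra. Qed.

Lemma cos_PI12 : cos (PI / 12) = (1 + sqrt 3) / (2 * sqrt 2).
Proof.
  replace (PI / 12) with (PI / 3 - PI / 4) by field.
  rewrite cos_minus, cos_PI3, sin_PI3, cos_PI4, sin_PI4; field; generalize sqrt2_pos; lra.
Qed.

Lemma sin_PI12 : sin (PI / 12) = (sqrt 3 - 1) / (2 * sqrt 2).
Proof.
  replace (PI / 12) with (PI / 3 - PI / 4) by field.
  rewrite sin_minus, cos_PI3, sin_PI3, cos_PI4, sin_PI4; field; generalize sqrt2_pos; lra.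
Qed.

Lemma cos_7PI12 : cos (7 * PI / 12) = (1 - sqrt 3) / (2 * sqrt 2).
Proof.
  replace (7 * PI / 12) with (PI / 3 + PI / 4) by field.
  rewrite cos_plus, cos_PI3, sin_PI3, cos_PI4, sin_PI4; field; generalize sqrt2_pos; lra.
Qed.

Lemma sin_7PI12 : sin (7 * PI / 12) = (1 + sqrt 3) / (2 * sqrt 2).
Proof.
  replace (7 * PI / 12) with (PI / 3 + PI / 4) by field.
  rewrite sin_plus, cos_PI3, sin_PI3, cos_PI4, sin_PI4; field; generalize sqrt2_pos; lra.
Qed.

Definition Y0 : C := Yp s0.

Lemma Y0_coord : Y0 = (s0, s0).
Proof. unfold Y0, Yp, Yd, RtoC, Cmult; simpl; f_equal; ring. Qed.

Lemma Y0_polar : Y0 = polar (sqrt 2 * s0) (PI / 4).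
Proof.
  rewrite Y0_coord; unfold polar; rewrite cos_PI4, sin_PI4; f_equal; field; generalize sqrt2_pos; lra.
Qed.

Lemma Y0_1_sub : (1 - Y0)%C = polar (sqrt 3 - 1) (- (PI / 6)).
Proof.
  rewrite Y0_coord; unfold polar, RtoC, Cminus, Cplus, Copp, s0; rewrite cos_neg, sin_neg, cos_PI6, sin_PI6; simpl.
  assert (H := sqrt3_sq); f_equal; nra.
Qed.

Lemma Y0_1_plus : (1 + Y0)%C = polar (sqrt 2) (PI / 12).
Proof.
  rewrite Y0_coord; unfold polar, RtoC, Cplus, s0; rewrite cos_PI12, sin_PI12; simpl.
  assert (P := sqrt2_pos); f_equal; field; lra.
Qed.

Lemma ln_half_sq (x y : R) : 0 < x -> x * x = y -> ln x = ln y / 2.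
Proof. intros H <-; rewrite ln_mult by exact H; field. Qed.

Lemma Clog_Y0 : Clog Y0 = (ln (2 - sqrt 3) / 2, PI / 4).
Proof.
  assert (P := sqrt2_pos); assert (S := s0_range); assert (HP := PI_RGT_0).
  rewrite Y0_polar, Clog_polar by (lra || nra); f_equal; apply ln_half_sq; [nra|].
  rewrite <- two_s0_sq; generalize sqrt2_sq; intros E; replace (sqrt 2 * s0 * (sqrt 2 * s0)) with ((sqrt 2 * sqrt 2) * s0 ^ 2) by ring.
  now rewrite E.
Qed.

Lemma Clog_Y0_1_sub : Clog (1 - Y0)%C = ((ln 2 + ln (2 - sqrt 3)) / 2, - (PI / 6)).
Proof.
  assert (P := sqrt3_bounds); assert (HP := PI_RGT_0); assert (E := sqrt3_sq).
  rewrite Y0_1_sub, Clog_polar by lra; f_equal; rewrite <- ln_mult by lra; apply ln_half_sq; [lra|]. nra.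
Qed.

Lemma Clog_Y0_1_plus : Clog (1 + Y0)%C = (ln 2 / 2, PI / 12).
Proof.
  assert (P := sqrt2_pos); assert (HP := PI_RGT_0).
  rewrite Y0_1_plus, Clog_polar by lra; f_equal; apply ln_half_sq; [lra|apply sqrt2_sq].
Qed.

Lemma Y0_w : ((1 - Y0) / (1 + Y0))%C = Cconj Y0.
Proof.
  assert (E := sqrt3_sq); assert (P := sqrt3_bounds).
  rewrite Y0_coord; unfold RtoC, Cdiv, Cinv, Cmult, Cminus, Cplus, Copp, Cconj, s0; simpl; f_equal; field_simplify_eq; nra.
Qed.

Lemma Y0_z1 : (Y0 / (Y0 - 1))%C = Cconj (polar (/ sqrt 2) (7 * PI / 12)).
Proof.
  assert (E := sqrt3_sq); assert (E2 := sqrt2_sq); assert (P := sqrt3_bounds); assert (P2 := sqrt2_pos).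
  transitivity ((1 - sqrt 3) / 4, - ((1 + sqrt 3) / 4)).
  - rewrite Y0_coord; unfold RtoC, Cdiv, Cinv, Cmult, Cminus, Cplus, Copp, s0; simpl; f_equal; field_simplify_eq; nra.
  - unfold polar, Cconj; simpl; rewrite cos_7PI12, sin_7PI12; f_equal; field [E2]; lra.
Qed.

Lemma Y0_z2 : (1 / (1 + Y0))%C = Cconj (polar (/ sqrt 2) (PI / 12)).
Proof.
  assert (E := sqrt3_sq); assert (E2 := sqrt2_sq); assert (P := sqrt3_bounds); assert (P2 := sqrt2_pos).
  transitivity ((1 + sqrt 3) / 4, - ((sqrt 3 - 1) / 4)).
  - rewrite Y0_coord; unfold RtoC, Cdiv, Cinv, Cmult, Cminus, Cplus, Copp, s0; simpl; f_equal; field_simplify_eq; nra.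
  - unfold polar, Cconj; simpl; rewrite cos_PI12, sin_PI12; f_equal; field [E2]; lra.
Qed.

Lemma atan_a : atan (2 - sqrt 3) = PI / 12.
Proof.
  assert (HP := PI_RGT_0); assert (P := sqrt2_pos); assert (E := sqrt3_sq); assert (B := sqrt3_bounds).
  rewrite <- (atan_tan (PI / 12)) by lra; f_equal.
  unfold tan; rewrite sin_PI12, cos_PI12; apply (Rmult_eq_reg_r (1 + sqrt 3)); [|lra].
  transitivity (sqrt 3 - 1); [nra|field; lra].
Qed.

(** The case [b = PI / 12] of [dilog_pair_real]: [2 sin (PI / 12)] is the modulus of [Y0], its
    square is [2 - sqrt 3], and [PI / 2 - 3 b = PI / 4] is the argument. *)
Lemma Re_L2_Y0 : Re (L 2 Y0) = Re (L 2 (RtoC (2 - sqrt 3))) / 2 + PI ^ 2 / 48.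
Proof.
  assert (HP := PI_RGT_0); assert (P := sqrt2_pos).
  generalize (dilog_pair_real (PI / 12) ltac:(lra)); rewrite sin_PI12.
  replace (PI / 2 - 3 * (PI / 12)) with (PI / 4) by field.
  replace (2 * ((sqrt 3 - 1) / (2 * sqrt 2))) with (sqrt 2 * s0).
  2:{ unfold s0; field [sqrt2_sq]; lra. }
  rewrite <- Y0_polar.
  replace (4 * ((sqrt 3 - 1) / (2 * sqrt 2)) ^ 2) with (2 - sqrt 3).
  2:{ rewrite <- two_s0_sq; unfold s0; field [sqrt2_sq]; lra. }
  intros H; lra.
Qed.

(** At [Y0] the Cayley formula relates [chi 2 Y0] to its own conjugate, so it evaluates
    [Re (chi 2 Y0)] by logarithms. *)
Lemma Re_L2_Y0_opp :
  Re (L 2 (- Y0)) = Re (L 2 Y0) - (3 * PI ^ 2 / 32 - ln (2 - sqrt 3) ^ 2 / 8).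
Proof.
  generalize (chi2_Cayley Y0 (Yp_lt_1 s0 s0_range) (Yp_Re_pos s0 s0_range)).
  rewrite Y0_w, chi2_1, Clog_Y0, Clog_Y0_1_sub, Clog_Y0_1_plus; unfold chi.
  replace (- Cconj Y0)%C with (Cconj (- Y0)) by (unfold Cconj, Copp; reflexivity).
  rewrite !L_conj; intros H; apply (f_equal Re) in H; revert H.
  destruct (L 2 Y0) as [p q], (L 2 (- Y0)) as [u v].
  unfold Cconj, RtoC, Cminus, Cmult, Copp, Cplus, Cinv, Re; simpl; intros H.
  field_simplify in H; lra.
Qed.

Lemma L_Li (s : nat) (z : C) : Cmod z <= 1 -> Li (S (S s)) z = L (S (S s)) z.
Proof. apply Li_Mp. Qed.

Lemma GG_polar : GG = Im (L 3 (polar (/ sqrt 2) (PI / 4))).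
Proof.
  assert (P := sqrt2_pos).
  assert (E : ((RtoC 1 + Ci) / RtoC 2)%C = polar (/ sqrt 2) (PI / 4)).
  { unfold polar, RtoC, Ci, Cdiv, Cinv, Cplus, Cmult; rewrite cos_PI4, sin_PI4; simpl; f_equal; field [sqrt2_sq]; lra. }
  unfold GG; rewrite E, L_Li; [reflexivity|].
  rewrite Cmod_polar by (left; now apply Rinv_0_lt_compat).
  rewrite <- Rinv_1; apply Rinv_le_contravar; [lra|]; generalize sqrt2_sq; nra.
Qed.

Lemma Im_Pp (a1 a2 b1 b2 c1 c2 : R) :
  Im (Pp (a1, a2) (b1, b2) (c1, c2)) =
  (a1 * (c1 * c2 + b1 * c2 + b2 * c1 - b1 * b2) + a2 * ((c1 ^ 2 - c2 ^ 2) / 2 + b1 * c1 - b2 * c2 - (b1 ^ 2 - b2 ^ 2) / 2)) / 2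
  + (3 * b1 ^ 2 * b2 - b2 ^ 3) / 6 - (3 * c1 ^ 2 * c2 - c2 ^ 3) / 6 + PI ^ 2 / 6 * c2 + PI ^ 2 / 8 * (b2 - c2).
Proof.
  unfold Pp; rewrite <- (RtoC_inv 2), <- (RtoC_inv 6) by lra.
  unfold RtoC, Cmult, Cminus, Copp, Cplus, Im; cbn [fst snd]; field.
Qed.

Theorem closed_form : Re (4 * Ci * Bc (Ci * RtoC (-1 * (2 - sqrt 3))))%C = rhs_value.
Proof.
  assert (HP := PI_RGT_0); assert (Ba := a_range).
  generalize (Re_Hp_eq_0 s0 s0_range); unfold Hp; fold Y0.
  rewrite L2_dup by (left; apply (Yp_lt_1 s0 s0_range)).
  rewrite Clog_Y0, Clog_Y0_1_sub, Clog_Y0_1_plus; unfold Up; rewrite Y0_w, Y0_z1, Y0_z2, two_s0_sq, atan_a.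
  unfold chi; replace (- Cconj Y0)%C with (Cconj (- Y0)) by (unfold Cconj, Copp; reflexivity).
  rewrite !L_conj.
  assert (H1 := Re_L2_Y0_opp); assert (H2 := Re_L2_Y0); assert (H3 := Im_L3_7_12).
  unfold rhs_value; rewrite GG_polar, L_Li by (rewrite Cmod_R, Rabs_pos_eq; lra).
  replace (ln (2 + sqrt 3)) with (- ln (2 - sqrt 3)).
  2:{ rewrite <- ln_Rinv by lra; f_equal; generalize sqrt3_sq; intros E; apply (Rmult_eq_reg_r (2 - sqrt 3)); [|lra].
      rewrite Rinv_l by lra; lra. }
  (* Once the special values are variables, the claim is linear in them and in the monomials in [PI]
     and logarithms. The [L 3] values at [Y0] and [- Y0] occur together with their conjugates and
     drop out of the imaginary part. *)
  generalize dependent (L 2 (- Y0)%C); intros [u1 v1].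
  generalize dependent (L 2 Y0); intros [u2 v2].
  generalize (L 3 (- Y0)%C) (L 3 Y0); intros [u3 v3] [u4 v4].
  generalize dependent (L 3 (polar (/ sqrt 2) (7 * PI / 12))); intros [u5 v5].
  generalize dependent (L 3 (polar (/ sqrt 2) (PI / 12))); intros [u6 v6].
  generalize dependent (L 3 (polar (/ sqrt 2) (PI / 4))); intros [u7 v7].
  generalize (Re (L 2 (RtoC (2 - sqrt 3)))) (Bc (Ci * RtoC (-1 * (2 - sqrt 3)))%C).
  assert (HPp := Im_Pp (ln (2 - sqrt 3) / 2) (PI / 4) ((ln 2 + ln (2 - sqrt 3)) / 2) (- (PI / 6)) (ln 2 / 2) (PI / 12)).
  match type of HPp with Im ?p = _ => generalize dependent p end; intros [p1 p2].
  generalize dependent (ln (2 - sqrt 3)); intros la.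
  generalize dependent (ln 2); intros l2 HPp r [x y] H3 H2 H1 H.
  rewrite <- (RtoC_inv 2) in H by lra.
  unfold Cconj, Ci, RtoC, Cminus, Cmult, Copp, Cplus, Re, Im in *; cbn [fst snd] in *.
  subst u1 u2 p2; lra.
Qed.

(** * Convergence of multiple polylogarithms on the unit circle *)

Lemma pow_eq_1_nonneg (x : R) (n : nat) : (0 < n)%nat -> 0 <= x -> x ^ n = 1 -> x = 1.
Proof.
  intros Hn Hx E; destruct (Rtotal_order x 1) as [H|[H|H]]; [|exact H|]; exfalso.
  - assert (x ^ n < 1 ^ n); [|rewrite pow1 in *; lra].
    destruct n as [|n]; [lia|]; clear Hn E; induction n as [|n IH]; [simpl; lra|].
    rewrite pow1 in *; rewrite <- tech_pow_Rmult.
    assert (0 <= x ^ S n) by (now apply pow_le); nra.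
  - generalize (Rlt_pow_R1 x n H Hn); lra.
Qed.

Lemma Cmod_root_1 (z : C) (n : nat) : (0 < n)%nat -> (z ^ n)%C = RtoC 1 -> Cmod z = 1.
Proof.
  intros Hn E; apply (pow_eq_1_nonneg _ n Hn (Cmod_ge_0 z)); rewrite <- Cmod_pow, E; apply Cmod_1.
Qed.

Lemma admissible_wf (k n : nat) (d : list (nat * C)) : (0 < n)%nat -> admissible k n d -> wf d.
Proof.
  intros Hn [H _]; apply List.Forall_forall; intros p Hp; destruct (H p Hp) as [H1 H2].
  split; [exact H1|]; rewrite (Cmod_root_1 _ n Hn H2); lra.
Qed.

Lemma mpl_trunc_sum_n (p : nat * C) (r : list (nat * C)) (n : nat) : wf (p :: r) ->
  mpl_trunc (p :: r) n = sum_n (cf (p :: r)) n.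
Proof.
  destruct p as [s z]; intros W; induction n as [|n IH].
  - rewrite sum_O, cf_0, mpl_trunc_0 by exact W; reflexivity.
  - rewrite sum_Sn, <- IH; apply mpl_trunc_S.
Qed.

(** Coefficients of [(1 - z x) Mp ((1, z) :: r) x], which are absolutely summable. *)
Definition ef (z : C) (r : list (nat * C)) (n : nat) : C :=
  (cf ((1%nat, z) :: r) n - z * match n with O => 0 | S m => cf ((1%nat, z) :: r) m end)%C.

(** Writing the truncated sum up to [n + 1] as that up to [n] plus one term, the difference of
    consecutive coefficients gains a factor [1 / n] and is [O(n^(-3/2))]. *)
Lemma ef_bound (z : C) (r : list (nat * C)) (n : nat) : wf ((1%nat, z) :: r) ->
  Cmod (ef z r (S (S n))) <= 2 * 2 ^ length r * (sqrt (INR (S n)) / INR (S n) ^ 2).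
Proof.
  intros W; destruct (wf_cons _ _ _ W) as [_ [Hz Wr]].
  set (K := 2 ^ length r); assert (HK : 0 < K) by (apply pow_lt; lra).
  assert (T : mpl_trunc r (S n) = (mpl_trunc r n + cf r (S n))%C).
  { destruct r as [|[s2 z2] r]; [simpl; ring|apply mpl_trunc_S]. }
  assert (Bc : Cmod (cf r (S n)) <= K * sqrt (INR (S n)) / INR (S n)).
  { destruct r as [|[s2 z2] r].
    - simpl cf; rewrite Cmod_0; apply Rmult_le_pos; [apply Rmult_le_pos; [lra|apply sqrt_pos]|].
      left; apply Rinv_0_lt_compat, lt_0_INR; lia.
    - eapply Rle_trans; [now apply cf_bound|].
      destruct (wf_cons _ _ _ Wr) as [Hs _].
      apply Rmult_le_compat; [apply Rmult_le_pos; [apply pow_le; lra|apply sqrt_pos]| | |].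
      + left; apply Rinv_0_lt_compat, pow_lt, lt_0_INR; lia.
      + apply Rmult_le_compat_r; [apply sqrt_pos|]; unfold K; simpl; generalize (pow_le 2 (length r)); lra.
      + apply Rinv_le_contravar; [apply lt_0_INR; lia|].
        rewrite <- (pow_1 (INR (S n))) at 1; apply Rle_pow; [apply (le_INR 1); lia|lia]. }
  assert (Bt : Cmod (mpl_trunc r n) <= K * sqrt (INR (S n))) by now apply mpl_trunc_bound.
  assert (Hp : Cmod (z ^ S (S n))%C <= 1).
  { rewrite Cmod_pow, <- (pow1 (S (S n))); apply pow_incr; auto using Cmod_ge_0. }
  assert (N1 : RtoC (INR (S n)) <> 0%C) by (apply RtoC_neq_0, not_0_INR; lia).
  assert (N2 : RtoC (INR (S (S n))) <> 0%C) by (apply RtoC_neq_0, not_0_INR; lia).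
  assert (E : ef z r (S (S n)) =
    (z ^ S (S n) * ((cf r (S n) - mpl_trunc r n / RtoC (INR (S n))) / RtoC (INR (S (S n)))))%C).
  { unfold ef, cf at 1 2; rewrite !pow_1; simpl pred; rewrite T, (Cpow_S z (S n)).
    rewrite (S_INR (S n)), RtoC_plus; rewrite (S_INR (S n)), RtoC_plus in N2.
    generalize dependent (RtoC (INR (S n))); intros u Hu Hu'; field; auto. }
  rewrite E, Cmod_mult, Cmod_div, Cmod_R, Rabs_pos_eq by (exact N2 || apply pos_INR).
  assert (P1 : 0 < INR (S n)) by (apply lt_0_INR; lia).
  assert (P2 : INR (S n) <= INR (S (S n))) by (rewrite (S_INR (S n)); lra).
  assert (B3 : Cmod (cf r (S n) - mpl_trunc r n / RtoC (INR (S n)))%C <= 2 * (K * sqrt (INR (S n)) / INR (S n))).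
  { eapply Rle_trans; [apply Cmod_triangle|]; rewrite Cmod_opp, Cmod_div, Cmod_R, Rabs_pos_eq by (exact N1 || lra).
    assert (Cmod (mpl_trunc r n) / INR (S n) <= K * sqrt (INR (S n)) / INR (S n)).
    { apply Rmult_le_compat_r; [left; now apply Rinv_0_lt_compat|exact Bt]. }
    lra. }
  apply Rle_trans with (1 * (2 * (K * sqrt (INR (S n)) / INR (S n)) / INR (S n))).
  - apply Rmult_le_compat; auto using Cmod_ge_0.
    + apply Rmult_le_pos; [apply Cmod_ge_0|left; apply Rinv_0_lt_compat; lra].
    + apply Rmult_le_compat; auto using Cmod_ge_0; [left; apply Rinv_0_lt_compat; lra|].
      apply Rinv_le_contravar; lra.
  - right; field; lra.
Qed.

Lemma ex_series_ef_bound (z : C) (r : list (nat * C)) : wf ((1%nat, z) :: r) ->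
  exists b, (forall n, Cmod (ef z r n) <= b n) /\ ex_series b.
Proof.
  intros W.
  exists (fun n => match n with O => Cmod (ef z r 0) | 1%nat => Cmod (ef z r 1)
    | S (S k) => 2 * 2 ^ length r * (sqrt (INR (S k)) / INR (S k) ^ 2) end); split.
  - intros [|[|n]]; [apply Rle_refl|apply Rle_refl|now apply ef_bound].
  - apply ex_series_incr_1, ex_series_incr_1, (@ex_series_scal_l R_AbsRing), ex_series_pow_3_2.
Qed.

Lemma sum_n_ef (z : C) (r : list (nat * C)) (n : nat) :
  sum_n (ef z r) (S n) = ((1 - z) * sum_n (cf ((1%nat, z) :: r)) (S n) + z * cf ((1%nat, z) :: r) (S n))%C.
Proof.
  induction n as [|n IH].
  - rewrite !sum_Sn, !sum_O; unfold ef, plus; simpl; ring.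
  - rewrite sum_Sn, IH, (sum_Sn _ (S n)); unfold ef, plus; simpl AbelianMonoid.plus.
    change (((1 - z) * sum_n (cf ((1%nat, z) :: r)) (S n) + z * cf ((1%nat, z) :: r) (S n) +
      (cf ((1%nat, z) :: r) (S (S n)) - z * cf ((1%nat, z) :: r) (S n)))%C =
      ((1 - z) * (sum_n (cf ((1%nat, z) :: r)) (S n) + cf ((1%nat, z) :: r) (S (S n))) + z * cf ((1%nat, z) :: r) (S (S n)))%C).
    ring.
Qed.

Lemma cf_1_lim_0 (z : C) (r : list (nat * C)) : wf ((1%nat, z) :: r) ->
  filterlim (fun n => cf ((1%nat, z) :: r) (S n)) eventually (locally (RtoC 0)).
Proof.
  intros W; apply filterlim_Cmod; [apply eventually_filter|]; intros eps.
  assert (H : is_lim_seq (fun n => 2 ^ length r * / sqrt (INR (S n))) 0).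
  { replace (Finite 0) with (Rbar_mult (2 ^ length r) 0) by (simpl; f_equal; ring).
    apply is_lim_seq_scal_l.
    replace (Finite 0) with (Rbar_inv p_infty) by reflexivity.
    apply is_lim_seq_inv; [|easy].
    apply (is_lim_seq_incr_1 (fun n => sqrt (INR n))).
    exact (filterlim_comp _ _ _ _ _ _ _ _ is_lim_seq_INR filterlim_sqrt_p). }
  generalize (proj1 (filterlim_locally_ball_norm (U := R_NormedModule) _ _) H eps).
  apply filter_imp; intros n Hn;
  change (Rabs (2 ^ length r * / sqrt (INR (S n)) + - 0) < eps) in Hn.
  replace (cf ((1%nat, z) :: r) (S n) - 0)%C with (cf ((1%nat, z) :: r) (S n)) by ring.
  eapply Rle_lt_trans; [now apply cf_bound|].
  apply Rabs_def2 in Hn; rewrite Ropp_0, Rplus_0_r in Hn.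
  eapply Rle_lt_trans; [|apply Hn]; right.
  assert (P : 0 < sqrt (INR (S n))) by (apply sqrt_lt_R0, lt_0_INR; lia).
  assert (E : sqrt (INR (S n)) * sqrt (INR (S n)) = INR (S n)) by apply sqrt_sqrt, pos_INR.
  rewrite pow_1; generalize dependent (sqrt (INR (S n))); intros q; intros; match goal with H : (q * q)%R = _ |- _ => rewrite <- H end; field; lra.
Qed.

Lemma Mp_ef (z x : C) (r : list (nat * C)) : wf ((1%nat, z) :: r) -> Cmod x < 1 ->
  ((1 - z * x) * Mp ((1%nat, z) :: r) x)%C = PS (ef z r) x.
Proof.
  intros W Hx; symmetry; apply is_Cseries_unique.
  replace ((1 - z * x) * Mp ((1%nat, z) :: r) x)%C with
    (Mp ((1%nat, z) :: r) x + - (z * x) * (Mp ((1%nat, z) :: r) x))%C by ring.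
  apply (is_Cseries_ext (fun n => cf ((1%nat, z) :: r) n * x ^ n +
    match n with O => 0 | S m => - (z * x) * (cf ((1%nat, z) :: r) m * x ^ m) end)%C).
  - intros [|n]; unfold ef; [ring|rewrite Cpow_S; ring].
  - apply is_Cseries_plus; [now apply Mp_correct|].
    rewrite <- (Cplus_0_l (- (z * x) * Mp ((1%nat, z) :: r) x)).
    apply (is_Cseries_incr_1 (fun n => match n with O => 0 | S m => - (z * x) * (cf ((1%nat, z) :: r) m * x ^ m) end)%C).
    apply is_Cseries_scal; now apply Mp_correct.
Qed.

Lemma filterlim_RtoC_at_left_1 : filterlim RtoC (at_left 1) (locally (RtoC 1)).
Proof. refine (dC_at_left RtoC 1 _ (dC_RtoC (fun s => s) 1 1 _)); apply (is_derive_id (K := R_AbsRing)). Qed.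

Lemma at_left_1_Cmod : at_left 1 (fun t => Cmod (RtoC t) <= 1).
Proof.
  apply (at_left_gt 0 1); [lra|]; intros t Ht; rewrite Cmod_R, Rabs_pos_eq; lra.
Qed.

(** If the leading exponent is at least 2, the series converges absolutely. If it is 1, then [z]
    differs from 1, and Abel summation divides the absolutely convergent series of [ef] by [1 - z].
    In both cases the same value is the limit of the truncated sums and the radial limit of [Mp]. *)
Lemma mpl_converges (d : list (nat * C)) : wf d -> d <> [] ->
  match d with [] => True | (s, z) :: _ => ~ (s = 1%nat /\ z = RtoC 1) end ->
  exists v, is_mpl d v /\ filterlim (fun t => Mp d (RtoC t)) (at_left 1) (locally v).
Proof.
  intros W Hd Hh; destruct d as [|[s z] r]; [easy|]; clear Hd.
  destruct (wf_cons _ _ _ W) as [Hs [Hz Wr]].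
  destruct s as [|[|s]]; [lia| |].
  - assert (Nz : (1 - z)%C <> 0%C).
    { intros E; apply Hh; split; [reflexivity|]; replace z with (1 - (1 - z))%C by ring; rewrite E; ring. }
    destruct (ex_series_ef_bound z r W) as [b [Hb Sb]].
    exists (PS (ef z r) 1 / (1 - z))%C; split.
    + unfold is_mpl.
      apply (filterlim_ext (fun n => sum_n (cf ((1%nat, z) :: r)) n)); [intros n; symmetry; now apply mpl_trunc_sum_n|].
      assert (HE : filterlim (fun n => sum_n (ef z r) (S n)) eventually (locally (PS (ef z r) 1))).
      { apply (filterlim_comp _ _ _ S (fun n => sum_n (ef z r) n) _ eventually); [apply (eventually_subseq S); intros; lia|].
        apply is_Cseries_iff; apply (is_Cseries_ext (fun n => ef z r n * 1 ^ n)%C); [intros n; rewrite Cpow_1_l; ring|].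
        apply (CSeries_correct _ b); [intros n; rewrite Cpow_1_l, Cmult_1_r; apply Hb|exact Sb]. }
      assert (HS : filterlim (fun n => sum_n (cf ((1%nat, z) :: r)) (S n)) eventually (locally (PS (ef z r) 1 / (1 - z))%C)).
      { apply (filterlim_ext (fun n => (sum_n (ef z r) (S n) - z * cf ((1%nat, z) :: r) (S n)) * / (1 - z))%C).
        - intros n; rewrite sum_n_ef; field; exact Nz.
        - apply (Clim_eq _ _ ((PS (ef z r) 1 - z * 0) * / (1 - z))%C); [field; exact Nz|].
          clim_mult; [|apply filterlim_const]; clim_minus; [exact HE|clim_mult; [apply filterlim_const|now apply cf_1_lim_0]]. }
      (* [HS] concerns the partial sums up to [S n], so the threshold moves by one. *)
      intros P HP; destruct (HS P HP) as [N HN]; exists (S N); intros [|n] Hn; [lia|apply HN; lia].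
    + apply (filterlim_ext_loc (fun t => PS (ef z r) (RtoC t) / (1 - z * RtoC t))%C).
      * apply (at_left_gt 0 1); [lra|]; intros t Ht.
        assert (Ht' : Cmod (RtoC t) < 1) by (rewrite Cmod_R, Rabs_pos_eq; lra).
        rewrite <- Mp_ef by assumption; field; now apply Cneq_Cmod_lt.
      * assert (HD : dC (fun t => / (1 - z * RtoC t))%C 1 (z / ((1 - z) * (1 - z)))%C).
        { assert (Nz' : (1 - z * RtoC 1)%C <> 0%C) by (replace (1 - z * RtoC 1)%C with (1 - z)%C by ring; exact Nz).
          apply (dC_ext (fun t => 1 / (1 - z * RtoC t))%C).
          { intros t; unfold Cdiv; ring. }
          eapply dC_eq; [|apply dC_div; [exact Nz'|apply dC_const|apply dC_minus; [apply dC_const|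
            apply dC_scal, (dC_RtoC (fun s => s)), (is_derive_id (K := R_AbsRing))]]].
          cbv beta; unfold one; simpl; rewrite Cmult_1_r; field; exact Nz. }
        unfold Cdiv; clim_mult.
        -- apply (PS_closed_disc _ b); auto using at_left_1_Cmod, Cmod_1_le, filterlim_RtoC_at_left_1.
           typeclasses eauto.
        -- apply (Clim_eq _ _ (/ (1 - z * RtoC 1))%C); [f_equal; ring|exact (dC_at_left _ _ _ HD)].
  - destruct (ex_series_cf_bound s z r W) as [b [Hb Sb]].
    exists (Mp ((S (S s), z) :: r) 1); split.
    + unfold is_mpl.
      apply (filterlim_ext (fun n => sum_n (cf ((S (S s), z) :: r)) n)); [intros n; symmetry; now apply mpl_trunc_sum_n|].
      apply is_Cseries_iff; apply (is_Cseries_ext (fun n => cf ((S (S s), z) :: r) n * 1 ^ n)%C); [intros n; rewrite Cpow_1_l; ring|].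
      apply (CSeries_correct _ b); [intros n; rewrite Cpow_1_l, Cmult_1_r; apply Hb|exact Sb].
    + apply Mp_closed_disc; auto using at_left_1_Cmod, Cmod_1_le, filterlim_RtoC_at_left_1; typeclasses eauto.
Qed.

(** * The algebra of cyclotomic multiple zeta values *)

Definition lsum {T : Type} (f : T -> C) (l : list T) : C := fold_right (fun t acc => f t + acc)%C 0%C l.

Lemma lsum_app {T : Type} (f : T -> C) (l m : list T) : lsum f (l ++ m) = (lsum f l + lsum f m)%C.
Proof. induction l as [|t l IH]; simpl; [ring|rewrite IH; ring]. Qed.

Lemma lsum_map {S T : Type} (g : S -> T) (f : T -> C) (l : list S) : lsum f (map g l) = lsum (fun s => f (g s)) l.
Proof. induction l as [|t l IH]; simpl; [reflexivity|now rewrite IH]. Qed.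

Lemma lsum_plus {T : Type} (f g : T -> C) (l : list T) : lsum (fun t => f t + g t)%C l = (lsum f l + lsum g l)%C.
Proof. induction l as [|t l IH]; simpl; [ring|rewrite IH; ring]. Qed.

Lemma lsum_scal {T : Type} (k : C) (f : T -> C) (l : list T) : lsum (fun t => k * f t)%C l = (k * lsum f l)%C.
Proof. induction l as [|t l IH]; simpl; [ring|rewrite IH; ring]. Qed.

Lemma lsum_ext {T : Type} (f g : T -> C) (l : list T) : (forall t, f t = g t) -> lsum f l = lsum g l.
Proof. intros E; induction l as [|t l IH]; simpl; [reflexivity|now rewrite IH, E]. Qed.

Lemma lsum_0 {T : Type} (l : list T) : lsum (fun _ => RtoC 0) l = RtoC 0.
Proof. induction l as [|t l IH]; simpl; [reflexivity|rewrite IH; ring]. Qed.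

Definition pmul (p q : nat * C) : nat * C := ((fst p + fst q)%nat, (snd p * snd q)%C).

(** Each call shortens one list or both; the inner [fix] makes the recursion structural. The three
    blocks correspond to the largest index belonging to [a], to [b], or to both at once. *)
Fixpoint stuffle (a : list (nat * C)) : list (nat * C) -> list (list (nat * C)) :=
  match a with
  | [] => fun b => [b]
  | p :: a' => fix aux b :=
      match b with
      | [] => [p :: a']
      | q :: b' => map (cons p) (stuffle a' b) ++ map (cons q) (aux b') ++ map (cons (pmul p q)) (stuffle a' b')
      end
  end.

Lemma stuffle_cons (p q : nat * C) (a b : list (nat * C)) :
  stuffle (p :: a) (q :: b) =
  map (cons p) (stuffle a (q :: b)) ++ map (cons q) (stuffle (p :: a) b) ++ map (cons (pmul p q)) (stuffle a b).
Proof. reflexivity. Qed.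

Definition wgt (p : nat * C) (n : nat) : C := (snd p ^ n / RtoC (INR n ^ fst p))%C.

Lemma mpl_trunc_step (p : nat * C) (a : list (nat * C)) (n : nat) :
  mpl_trunc (p :: a) (S n) = (mpl_trunc (p :: a) n + wgt p (S n) * mpl_trunc a n)%C.
Proof. destruct p as [s z]; reflexivity. Qed.

Lemma wgt_pmul (p q : nat * C) (n : nat) : wgt (pmul p q) (S n) = (wgt p (S n) * wgt q (S n))%C.
Proof.
  unfold wgt, pmul; simpl fst; simpl snd.
  rewrite pow_add, RtoC_mult, Cpow_mult_l.
  assert (H : forall k, RtoC (INR (S n) ^ k) <> 0%C).
  { intros k; apply RtoC_neq_0, pow_nonzero, not_0_INR; lia. }
  field; auto.
Qed.

Lemma lsum_cons_step (p : nat * C) (l : list (list (nat * C))) (n : nat) :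
  lsum (fun c => mpl_trunc (p :: c) (S n)) l =
  (lsum (fun c => mpl_trunc (p :: c) n) l + wgt p (S n) * lsum (fun c => mpl_trunc c n) l)%C.
Proof. rewrite <- lsum_scal, <- lsum_plus; apply lsum_ext; intros c; apply mpl_trunc_step. Qed.

(** Stated for finite sums, so no convergence enters. The increment of a product from [n] to [S n]
    has three terms, matching the three blocks of [stuffle_cons]; hence the third induction, on
    [n]. *)
Lemma stuffle_trunc (a b : list (nat * C)) (n : nat) :
  (mpl_trunc a n * mpl_trunc b n)%C = lsum (fun c => mpl_trunc c n) (stuffle a b).
Proof.
  revert b n; induction a as [|p a IHa]; intros b n; [simpl; ring|].
  revert n; induction b as [|q b IHb]; intros n; [change (mpl_trunc (p :: a) n * 1 = mpl_trunc (p :: a) n + 0)%C; generalize (mpl_trunc (p :: a) n); intros; ring|].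
  induction n as [|n IHn].
  - rewrite !mpl_trunc_0, stuffle_cons, !lsum_app, !lsum_map.
    assert (E : forall (r : nat * C) l, lsum (fun s => mpl_trunc (r :: s) 0) l = RtoC 0).
    { intros r l; rewrite (lsum_ext _ (fun _ => RtoC 0)) by (intros; apply mpl_trunc_0); apply lsum_0. }
    rewrite !E; ring.
  - rewrite stuffle_cons, !lsum_app, !lsum_map in *.
    rewrite !lsum_cons_step, !mpl_trunc_step, wgt_pmul, <- !IHa, <- IHb.
    transitivity (mpl_trunc (p :: a) n * mpl_trunc (q :: b) n
      + wgt p (S n) * (mpl_trunc a n * mpl_trunc (q :: b) n)
      + wgt q (S n) * (mpl_trunc (p :: a) n * mpl_trunc b n)
      + wgt p (S n) * wgt q (S n) * (mpl_trunc a n * mpl_trunc b n))%C; [ring|rewrite IHn; ring].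
Qed.

Definition good (N : nat) (p : nat * C) : Prop := (0 < fst p)%nat /\ (snd p ^ N)%C = RtoC 1.
Definition wt (d : list (nat * C)) : nat := fold_right (fun p acc => (fst p + acc)%nat) O d.
Definition head_ok (d : list (nat * C)) : Prop :=
  match d with [] => True | (s1, z1) :: _ => ~ (s1 = 1%nat /\ z1 = RtoC 1) end.

Lemma admissible_iff (k N : nat) (d : list (nat * C)) :
  admissible k N d <-> List.Forall (good N) d /\ wt d = k /\ head_ok d.
Proof. unfold admissible; rewrite List.Forall_forall; reflexivity. Qed.

Lemma good_pmul (N : nat) (p q : nat * C) : good N p -> good N q -> good N (pmul p q).
Proof.
  intros [H1 H2] [H3 H4]; split; simpl; [lia|]; rewrite Cpow_mult_l, H2, H4; ring.
Qed.

Lemma stuffle_good (N : nat) (a b c : list (nat * C)) :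
  List.Forall (good N) a -> List.Forall (good N) b -> In c (stuffle a b) ->
  List.Forall (good N) c /\ wt c = (wt a + wt b)%nat.
Proof.
  revert b c; induction a as [|p a IHa]; intros b c Ha Hb Hc.
  { destruct Hc as [<-|[]]; split; [exact Hb|reflexivity]. }
  revert c Hc; induction b as [|q b IHb]; intros c Hc.
  { destruct Hc as [<-|[]]; split; [exact Ha|simpl; lia]. }
  inversion_clear Ha as [|? ? Hp Ha']; inversion_clear Hb as [|? ? Hq Hb'].
  rewrite stuffle_cons, !in_app_iff, !in_map_iff in Hc.
  destruct Hc as [[c' [<- Hc]]|[[c' [<- Hc]]|[c' [<- Hc]]]].
  - destruct (IHa (q :: b) c' Ha' ltac:(now constructor) Hc) as [H1 H2].
    split; [now constructor|]; simpl in *; lia.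
  - destruct (IHb Hb' c' Hc) as [H1 H2].
    split; [now constructor|]; simpl in *; lia.
  - destruct (IHa b c' Ha' Hb' Hc) as [H1 H2].
    split; [constructor; [now apply good_pmul|exact H1]|]; simpl in *; lia.
Qed.

(** The new head is one of the old heads or their merger, and a merged exponent is at least 2. *)
Lemma stuffle_head_ok (N : nat) (a b c : list (nat * C)) :
  List.Forall (good N) a -> List.Forall (good N) b -> head_ok a -> head_ok b -> In c (stuffle a b) -> head_ok c.
Proof.
  intros Ga Gb Ha Hb Hc; destruct a as [|p a]; [destruct Hc as [<-|[]]; exact Hb|].
  destruct b as [|q b]; [destruct Hc as [<-|[]]; exact Ha|].
  inversion_clear Ga as [|? ? [Hp _] _]; inversion_clear Gb as [|? ? [Hq _] _].
  rewrite stuffle_cons, !in_app_iff, !in_map_iff in Hc.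
  destruct p as [s z], q as [s' z']; simpl in *.
  destruct Hc as [[c' [<- Hc]]|[[c' [<- Hc]]|[c' [<- Hc]]]]; simpl; [exact Ha|exact Hb|lia].
Qed.

Lemma stuffle_admissible (k l N : nat) (a b c : list (nat * C)) :
  admissible k N a -> admissible l N b -> In c (stuffle a b) -> admissible (k + l) N c.
Proof.
  rewrite !admissible_iff; intros [G1 [<- H1]] [G2 [<- H2]] Hc.
  destruct (stuffle_good N a b c G1 G2 Hc) as [H3 H4].
  split; [exact H3|split; [exact H4|]]; exact (stuffle_head_ok N a b c G1 G2 H1 H2 Hc).
Qed.

Lemma admissible_converges (k N : nat) (d : list (nat * C)) : (0 < N)%nat -> admissible k N d ->
  exists v, is_mpl d v.
Proof.
  intros HN Hd; destruct d as [|p d].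
  - exists (RtoC 1); exact (filterlim_const _).
  - destruct (mpl_converges (p :: d) (admissible_wf k N _ HN Hd)) as [v [Hv _]]; [easy|now apply Hd|].
    now exists v.
Qed.

Section CMZV.
Variable N : nat.
Hypothesis HN : (0 < N)%nat.

Definition cterm (t : Q * list (nat * C) * C) : C := (RtoC (Q2R (fst (fst t))) * snd t)%C.

Lemma in_CMZV_iff (k : nat) (x : C) : in_CMZV k N x <->
  exists l, (forall t, In t l -> admissible k N (snd (fst t)) /\ is_mpl (snd (fst t)) (snd t)) /\ x = lsum cterm l.
Proof. reflexivity. Qed.

Lemma in_CMZV_0 (k : nat) : in_CMZV k N (RtoC 0).
Proof. exists []; split; [easy|reflexivity]. Qed.

Lemma in_CMZV_gen (k : nat) (d : list (nat * C)) (v : C) : admissible k N d -> is_mpl d v -> in_CMZV k N v.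
Proof.
  intros H1 H2; exists [(1%Q, d, v)]; split.
  - intros t [<-|[]]; now split.
  - simpl; replace (Q2R 1) with 1 by (unfold Q2R; simpl; field); ring.
Qed.

Lemma in_CMZV_plus (k : nat) (x y : C) : in_CMZV k N x -> in_CMZV k N y -> in_CMZV k N (x + y)%C.
Proof.
  rewrite !in_CMZV_iff; intros [l [Hl ->]] [m [Hm ->]]; exists (l ++ m); split.
  - intros t; rewrite in_app_iff; intros [H|H]; auto.
  - symmetry; apply lsum_app.
Qed.

Lemma in_CMZV_scal (k : nat) (q : Q) (x : C) : in_CMZV k N x -> in_CMZV k N (RtoC (Q2R q) * x)%C.
Proof.
  rewrite !in_CMZV_iff; intros [l [Hl ->]].
  exists (map (fun t => ((q * fst (fst t))%Q, snd (fst t), snd t)) l); split.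
  - intros t; rewrite in_map_iff; intros [u [<- Hu]]; simpl; auto.
  - rewrite lsum_map, <- lsum_scal; apply lsum_ext; intros t; unfold cterm; simpl.
    rewrite Q2R_mult, RtoC_mult; ring.
Qed.

(** Every term of the quasi-shuffle product is admissible and so converges by itself. The identity
    of truncated sums can therefore be passed to the limit term by term, without rearranging
    conditionally convergent series. *)
Lemma in_CMZV_mult_gen (k l : nat) (d e : list (nat * C)) (v w : C) :
  admissible k N d -> is_mpl d v -> admissible l N e -> is_mpl e w -> in_CMZV (k + l) N (v * w)%C.
Proof.
  intros Hd Hv He Hw.
  assert (H : forall cs, (forall c, In c cs -> admissible (k + l) N c) ->
    exists x, in_CMZV (k + l) N x /\ filterlim (fun n => lsum (fun c => mpl_trunc c n) cs) eventually (locally x)).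
  { induction cs as [|c cs IH]; intros Hcs.
    - exists (RtoC 0); split; [apply in_CMZV_0|exact (filterlim_const _)].
    - destruct IH as [x [Hx Lx]]; [intros; apply Hcs; now right|].
      assert (Hc : admissible (k + l) N c) by (apply Hcs; now left).
      destruct (admissible_converges _ N c HN Hc) as [u Hu].
      exists (u + x)%C; split; [apply in_CMZV_plus; [now apply (in_CMZV_gen _ c)|exact Hx]|].
      apply Clim_plus; [apply eventually_filter|exact Hu|exact Lx]. }
  destruct (H (stuffle d e)) as [x [Hx Lx]]; [intros c; now apply stuffle_admissible|].
  replace (v * w)%C with x; [exact Hx|].
  apply (Clim_unique eventually (fun n => mpl_trunc d n * mpl_trunc e n)%C); [apply eventually_filter| |].
  - eapply filterlim_ext; [|exact Lx]; intros n; symmetry; apply stuffle_trunc.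
  - apply Clim_mult; [apply eventually_filter|exact Hv|exact Hw].
Qed.

Lemma in_CMZV_mult (k l : nat) (x y : C) : in_CMZV k N x -> in_CMZV l N y -> in_CMZV (k + l) N (x * y)%C.
Proof.
  rewrite (in_CMZV_iff k), (in_CMZV_iff l); intros [xs [Hx ->]] [ys [Hy ->]].
  induction xs as [|[[q d] v] xs IHx].
  - simpl; rewrite Cmult_0_l; apply in_CMZV_0.
  - simpl; rewrite Cmult_plus_distr_r; apply in_CMZV_plus; [|apply IHx; intros; apply Hx; now right].
    destruct (Hx (q, d, v) (or_introl eq_refl)) as [Hd Hv]; simpl in Hd, Hv.
    unfold cterm at 1; simpl; rewrite <- Cmult_assoc; apply in_CMZV_scal; clear Hx IHx.
    induction ys as [|[[q' e] w] ys IHy].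
    + simpl; rewrite Cmult_0_r; apply in_CMZV_0.
    + simpl; rewrite Cmult_plus_distr_l; apply in_CMZV_plus; [|apply IHy; intros; apply Hy; now right].
      destruct (Hy (q', e, w) (or_introl eq_refl)) as [He Hw]; simpl in He, Hw.
      unfold cterm; simpl; replace (v * (RtoC (Q2R q') * w))%C with (RtoC (Q2R q') * (v * w))%C by ring.
      apply in_CMZV_scal; now apply (in_CMZV_mult_gen k l d e).
Qed.

Definition dconj (d : list (nat * C)) : list (nat * C) := map (fun p => (fst p, Cconj (snd p))) d.

Lemma Cconj_plus (a b : C) : Cconj (a + b)%C = (Cconj a + Cconj b)%C.
Proof. unfold Cconj, Cplus; simpl; f_equal; ring. Qed.

Lemma Cconj_R (x : R) : Cconj (RtoC x) = RtoC x.
Proof. unfold Cconj, RtoC; simpl; f_equal; ring. Qed.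

Lemma wgt_conj (s : nat) (z : C) (n : nat) : wgt (s, Cconj z) n = Cconj (wgt (s, z) n).
Proof.
  unfold wgt, Cdiv; simpl fst; simpl snd; rewrite Cmult_conj, Cpow_conj; f_equal.
  unfold Cconj, Cinv, RtoC; simpl; f_equal; unfold Rdiv; ring.
Qed.

Lemma mpl_trunc_conj (d : list (nat * C)) (n : nat) : mpl_trunc (dconj d) n = Cconj (mpl_trunc d n).
Proof.
  revert n; induction d as [|[s z] d IH]; intros n; [symmetry; apply Cconj_R|].
  induction n as [|n IHn]; [rewrite !mpl_trunc_0; symmetry; apply Cconj_R|].
  unfold dconj; simpl map; fold (dconj d); rewrite !mpl_trunc_step, Cconj_plus, Cmult_conj, <- IH, <- wgt_conj, <- IHn.
  reflexivity.
Qed.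

(** Conjugation permutes the [N]-th roots of unity, fixes 1 and the rational coefficients. It is
    what extracts imaginary parts within the space. *)
Lemma in_CMZV_conj (k : nat) (x : C) : in_CMZV k N x -> in_CMZV k N (Cconj x).
Proof.
  rewrite !in_CMZV_iff; intros [l [Hl ->]].
  exists (map (fun t => (fst (fst t), dconj (snd (fst t)), Cconj (snd t))) l); split.
  - intros t; rewrite in_map_iff; intros [[[q d] v] [<- Hu]]; simpl.
    destruct (Hl _ Hu) as [Hd Hv]; simpl in Hd, Hv; split.
    + rewrite admissible_iff in *; destruct Hd as [G [W H]]; split; [|split].
      * clear - G; induction G as [|[s z] d [H1 H2] _ IH]; constructor; [split; [exact H1|]|exact IH].
        simpl in *; rewrite <- Cpow_conj, H2; apply Cconj_R.
      * rewrite <- W; clear; induction d as [|[s z] d IH]; simpl in *; [reflexivity|now rewrite IH].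
      * destruct d as [|[s z] d]; [exact I|]; simpl in *; intros [E1 E2]; apply H; split; [exact E1|].
        rewrite <- (Cconj_conj z), E2; apply Cconj_R.
    + unfold is_mpl in *; apply (filterlim_ext (fun n => Cconj (mpl_trunc d n))); [intros n; symmetry; apply mpl_trunc_conj|].
      apply filterlim_C_iff in Hv; [|apply eventually_filter]; apply filterlim_C_iff; [apply eventually_filter|].
      split; [apply Hv|exact (filterlim_comp _ _ _ _ _ _ _ _ (proj2 Hv) (filterlim_opp (V := R_NormedModule) _))].
  - rewrite lsum_map; clear; induction l as [|[[q d] v] l IH]; simpl; [apply Cconj_R|].
    rewrite Cconj_plus, IH; unfold cterm; simpl; now rewrite Cmult_conj, Cconj_R.
Qed.

End CMZV.

(** * Membership *)

(** Along a ray both sides have the derivative of half a square, the inner logarithm having the same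
    argument [z x] as the outer one. It reduces the double logarithms produced by weight 3 to
    products of logarithms. *)
Lemma Mp_1_1 (z x : C) : Cmod z <= 1 -> Cmod x < 1 ->
  Mp [(1%nat, z); (1%nat, RtoC 1)] x = (/ 2 * (L 1 (z * x) * L 1 (z * x)))%C.
Proof.
  intros Hz Hx.
  assert (W : wf [(1%nat, z); (1%nat, RtoC 1)]) by (apply wf_2; auto using Cmod_1_le).
  assert (W1 : wf [(1%nat, z)]) by (apply wf_1; auto).
  assert (Hr : forall s, 0 <= s <= 1 -> Cmod (RtoC s * x)%C < 1).
  { intros s Hs; eapply Rle_lt_trans; [now apply Cmod_ray|exact Hx]. }
  set (f := fun s => (Mp [(1%nat, z); (1%nat, RtoC 1)] (RtoC s * x) -
    / 2 * (Mp [(1%nat, z)] (RtoC s * x) * Mp [(1%nat, z)] (RtoC s * x)))%C).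
  assert (D : forall t, 0 <= t <= 1 -> dC f t 0%C).
  { intros t Ht; unfold f.
    eapply dC_eq; [|apply dC_minus; [apply (dC_Mp_1_cons _ _ _ _ (fun s => RtoC s * x)%C); [exact W|now apply Hr|apply dC_ray]|
      apply dC_scal, dC_mult; (apply (dC_Mp_1_nil _ (fun s => RtoC s * x)%C); [exact Hz|now apply Hr|apply dC_ray])]].
    cbv beta; replace (z * 1)%C with z by ring; field; now apply Cneq_Cmod_lt, Hr. }
  assert (E : f 1 = f 0).
  { apply (ray_const f); [intros t Ht; apply D; lra| |].
    - apply (dC_at_right _ _ _ (D 0 ltac:(lra))).
    - apply (dC_at_left _ _ _ (D 1 ltac:(lra))). }
  unfold f in E; rewrite Cmult_0_l, Cmult_1_l, !Mp_0, Mp_single in E by assumption.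
  replace (Mp [(1%nat, z); (1%nat, RtoC 1)] x) with
   ((Mp [(1%nat, z); (1%nat, RtoC 1)] x - / 2 * (L 1 (z * x) * L 1 (z * x))) + / 2 * (L 1 (z * x) * L 1 (z * x)))%C by ring.
  rewrite E; ring.
Qed.

(** For [s = 1] this is a primitive of [log ((1 + u) / (1 - u))] against the logarithmic derivative
    of [1 - u^2]; for [s = 2], its further integral against [du / u]. *)
Definition Nf (s : nat) (u : C) : C :=
  (Mp [(s, RtoC 1); (1%nat, RtoC (-1))] u + Mp [(s, RtoC (-1)); (1%nat, RtoC 1)] u
   - Mp [(s, RtoC 1); (1%nat, RtoC 1)] u - Mp [(s, RtoC (-1)); (1%nat, RtoC (-1))] u)%C.

(** A function whose derivative agrees with that of [Bc ((1 - u) / (1 + u))]. *)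
Definition Ff (u : C) : C :=
  (RtoC (PI ^ 2 / 8) * (Clog (1 - u) + Clog (1 + u) - Clog u) + 2 * chi 3 u - chi 2 u * (Clog (1 - u) + Clog (1 + u))
   + (Mp [(2%nat, RtoC (-1)); (1%nat, RtoC 1)] u - Mp [(2%nat, RtoC 1); (1%nat, RtoC 1)] u)
   + / 2 * (Clog u * Nf 1 u) - / 2 * Nf 2 u - Clog u * chi 2 u)%C.

Section Derivative.
Variables (x : R -> C) (t : R) (x' : C).
Hypothesis Hx : Cmod (x t) < 1.
Hypothesis Hre : 0 < Re (x t).
Hypothesis D : dC x t x'.

Let u := x t.
Let B := Clog (1 - u)%C.
Let C' := Clog (1 + u)%C.

Lemma L1_opp (y : C) : Cmod y < 1 -> L 1 (- y) = (- Clog (1 + y))%C.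
Proof.
  intros H; rewrite L1_Clog by (now rewrite Cmod_opp); do 2 f_equal; ring.
Qed.

Lemma dC_Mp_11 (z1 z2 : C) : Cmod z1 <= 1 -> Cmod z2 <= 1 ->
  dC (fun s => Mp [(1%nat, z1); (1%nat, z2)] (x s)) t (L 1 (z1 * z2 * u) * (z1 * x' / (1 - z1 * u)))%C.
Proof.
  intros H1 H2; rewrite <- Mp_single; apply dC_Mp_1_cons; [apply wf_2; auto|exact Hx|exact D].
Qed.

Lemma dC_Mp_21 (z1 z2 : C) : Cmod z1 <= 1 -> Cmod z2 <= 1 ->
  dC (fun s => Mp [(2%nat, z1); (1%nat, z2)] (x s)) t (Mp [(1%nat, z1); (1%nat, z2)] u * (x' / u))%C.
Proof.
  intros H1 H2; apply dC_Mp_SS; [apply wf_2; auto|exact Hx|now apply Re_pos_neq|exact D].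
Qed.

Lemma dC_Nf_1 : dC (fun s => Nf 1 (x s)) t ((C' - B) * (x' / (1 + u) - x' / (1 - u)))%C.
Proof.
  assert (H1 := Cmod_1_le); assert (H2 := Cmod_m1_le).
  unfold Nf; eapply dC_eq; [|apply dC_minus; [apply dC_minus; [apply dC_plus|]|]; now apply dC_Mp_11].
  replace (RtoC 1 * RtoC (-1) * u)%C with (- u)%C by ring.
  replace (RtoC (-1) * RtoC 1 * u)%C with (- u)%C by ring.
  replace (RtoC 1 * RtoC 1 * u)%C with u by ring.
  replace (RtoC (-1) * RtoC (-1) * u)%C with u by ring.
  rewrite L1_opp, L1_Clog by exact Hx; fold B C'.
  assert (N1 := Cneq_1_sub u Hx); assert (N2 := Cneq_1_plus u Hx).
  replace (1 - RtoC (-1) * u)%C with (1 + u)%C by ring.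
  replace (1 - RtoC 1 * u)%C with (1 - u)%C by ring.
  replace (RtoC (-1) * x')%C with (- x')%C by ring.
  field; auto.
Qed.

Lemma dC_Nf_2 : dC (fun s => Nf 2 (x s)) t (Nf 1 u * (x' / u))%C.
Proof.
  assert (H1 := Cmod_1_le); assert (H2 := Cmod_m1_le).
  unfold Nf; eapply dC_eq; [|apply dC_minus; [apply dC_minus; [apply dC_plus|]|]; now apply dC_Mp_21].
  ring.
Qed.

Lemma dC_Bc_Ff : dC (fun s => Bc ((1 - x s) / (1 + x s)) - Ff (x s))%C t 0%C.
Proof.
  assert (N1 := Cneq_1_sub u Hx); assert (N2 := Cneq_1_plus u Hx).
  assert (N0 : u <> 0%C) by now apply Re_pos_neq.
  assert (H1 := Cmod_1_le); assert (H2 := Cmod_m1_le).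
  assert (Da : dC (fun s => Clog (x s)) t (x' / u)%C) by now apply dC_Clog.
  assert (Db : dC (fun s => Clog (1 - x s)%C) t (- (x' / (1 - u)))%C).
  { eapply dC_eq; [|apply (dC_Clog (fun s => 1 - x s)%C); [now apply Re_gt_1_sub|apply dC_minus; [apply dC_const|exact D]]].
    cbv beta; fold u; field; exact N1. }
  assert (Dc : dC (fun s => Clog (1 + x s)%C) t (x' / (1 + u))%C).
  { eapply dC_eq; [|apply (dC_Clog (fun s => 1 + x s)%C); [change (0 < 1 + Re (x t)); lra|apply dC_plus; [apply dC_const|exact D]]].
    cbv beta; fold u; field; exact N2. }
  eapply dC_eq; [|apply dC_minus].
  2:{ apply (dC_Bc (fun s => (1 - x s) / (1 + x s))%C); [now apply Cayley_lt_1| |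
       apply dC_div; [exact N2|apply dC_minus; [apply dC_const|exact D]|apply dC_plus; [apply dC_const|exact D]]].
      fold u; intros E; apply N1; transitivity ((1 - u) / (1 + u) * (1 + u))%C; [field; exact N2|rewrite E; ring]. }
  2:{ unfold Ff; apply dC_minus; [apply dC_minus; [apply dC_plus; [apply dC_plus; [apply dC_minus; [apply dC_plus|]|]|]|]|].
      - apply dC_scal, dC_minus; [apply dC_plus; [exact Db|exact Dc]|exact Da].
      - apply dC_scal; apply dC_chi3; [exact Hx|exact N0|exact D].
      - apply dC_mult; [apply dC_chi2; [exact Hx|exact N0|exact D]|apply dC_plus; [exact Db|exact Dc]].
      - apply dC_minus; now apply dC_Mp_21.
      - apply dC_scal, dC_mult; [exact Da|apply dC_Nf_1].
      - apply dC_scal, dC_Nf_2.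
      - apply dC_mult; [exact Da|apply dC_chi2; [exact Hx|exact N0|exact D]]. }
  cbv beta; fold u; fold B C'.
  rewrite chi2_Cayley, chi2_1, !Mp_1_1 by assumption; fold B C'.
  replace (RtoC (-1) * u)%C with (- u)%C by ring.
  replace (RtoC 1 * u)%C with u by ring.
  rewrite L1_opp, L1_Clog by exact Hx; fold B C'.
  assert (N3 : ((1 + u) * (1 + u) - (1 - u) * (1 - u))%C <> 0%C).
  { replace ((1 + u) * (1 + u) - (1 - u) * (1 - u))%C with (RtoC 4 * u)%C by ring.
    apply Cmult_neq_0; [apply RtoC_neq_0; lra|exact N0]. }
  (* As [1 - w^2 = 4 u / (1 + u)^2], the quotient [w / (1 - w^2)] equals [(1 - u) (1 + u) / (4 u)];
     [e] is its logarithmic derivative. *)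
  match goal with |- (?c * ?e - _)%C = _ => replace e with (x' / (1 + u) - x' / (1 - u) - x' / u)%C end.
  2:{ field; auto. }
  replace (- (x' / (1 - u)) + x' / (1 + u))%C with (x' / (1 + u) - x' / (1 - u))%C by ring.
  (* The three forms, the logarithms, [chi 2 u] and [Nf 1 u] can now be treated as independent
     variables: the identity is polynomial in them. *)
  generalize (x' / (1 + u))%C (x' / (1 - u))%C (x' / u)%C (chi 2 u) (Clog u) B C' (RtoC (PI ^ 2 / 8)) (Nf 1 u).
  intros; field; apply RtoC_neq_0; lra.
Qed.

End Derivative.

(** * Reality on the real axis and transport along the arc *)

Lemma cf_conj (d : list (nat * C)) (n : nat) : cf (dconj d) n = Cconj (cf d n).
Proof.
  destruct d as [|[s z] r]; [symmetry; apply Cconj_R|]; simpl dconj; unfold cf.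
  rewrite Cmult_conj, <- mpl_trunc_conj; f_equal; apply (wgt_conj s z n).
Qed.

Lemma Mp_conj (d : list (nat * C)) (x : C) : Mp (dconj d) (Cconj x) = Cconj (Mp d x).
Proof.
  unfold Mp, PS; rewrite <- CSeries_conj; apply CSeries_ext; intros n.
  rewrite cf_conj, <- Cpow_conj, Cmult_conj; reflexivity.
Qed.

Lemma Im_Cconj_fix (z : C) : Cconj z = z -> Im z = 0.
Proof. destruct z as [u v]; intros E; apply (f_equal Im) in E; simpl in *; lra. Qed.

Lemma Im_Mp_R (d : list (nat * C)) (x : R) : dconj d = d -> Im (Mp d (RtoC x)) = 0.
Proof.
  intros E; apply Im_Cconj_fix; rewrite <- Mp_conj, E, Cconj_R; reflexivity.
Qed.

Lemma Im_0_plus (a b : C) : Im a = 0 -> Im b = 0 -> Im (a + b)%C = 0.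
Proof. destruct a, b; simpl; intros -> ->; ring. Qed.

Lemma Im_0_minus (a b : C) : Im a = 0 -> Im b = 0 -> Im (a - b)%C = 0.
Proof. destruct a, b; simpl; intros -> ->; ring. Qed.

Lemma Im_0_mult (a b : C) : Im a = 0 -> Im b = 0 -> Im (a * b)%C = 0.
Proof. destruct a, b; simpl; intros -> ->; ring. Qed.

Lemma Im_inv_2 : Im (/ 2)%C = 0.
Proof. simpl; unfold Rdiv; ring. Qed.

Lemma Im_Clog_R (x : R) : 0 < x -> Im (Clog (RtoC x)) = 0.
Proof. intros H; now rewrite Clog_R. Qed.

Lemma Im_chi_R (s : nat) (x : R) : Im (chi s (RtoC x)) = 0.
Proof.
  assert (H : forall y, Im (L s (RtoC y)) = 0).
  { intros y; apply Im_Cconj_fix; rewrite <- L_conj, Cconj_R; reflexivity. }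
  unfold chi; rewrite <- RtoC_opp; apply Im_0_mult; [apply Im_inv_2|apply Im_0_minus; apply H].
Qed.

Lemma dconj_R2 (s1 s2 : nat) (a b : R) : dconj [(s1, RtoC a); (s2, RtoC b)] = [(s1, RtoC a); (s2, RtoC b)].
Proof. unfold dconj; simpl; now rewrite !Cconj_R. Qed.

(** At a real point all ingredients have real coefficients and real arguments. Thus the constant by
    which [Bc] and [Ff] differ is real, and it need not be computed, only imaginary parts being
    used. *)
Lemma Im_Bc_sub_Ff_R (x : R) : 0 < x < 1 -> Im (Bc ((1 - RtoC x) / (1 + RtoC x)) - Ff (RtoC x))%C = 0.
Proof.
  intros Hx.
  assert (Hp : 1 + x <> 0) by lra.
  rewrite <- RtoC_minus, <- RtoC_plus, <- RtoC_div by exact Hp.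
  unfold Bc, Ff, Nf; rewrite <- RtoC_minus, <- RtoC_plus.
  repeat lazymatch goal with
    | |- Im (chi _ _) = 0 => apply Im_chi_R
    | |- Im (Mp _ _) = 0 => apply Im_Mp_R, dconj_R2
    | |- Im (Clog _) = 0 => apply Im_Clog_R; lra
    | |- Im (_ - _)%C = 0 => apply Im_0_minus
    | |- Im (_ + _)%C = 0 => apply Im_0_plus
    | |- Im (_ * _)%C = 0 => apply Im_0_mult
    | |- Im (RtoC _) = 0 => reflexivity
    | |- Im (/ _)%C = 0 => apply Im_inv_2
    end.
Qed.

Lemma cos_range_pos (t : R) : 0 <= t <= PI / 6 -> 0 < cos t.
Proof. intros H; generalize PI_RGT_0; intros; apply cos_gt_0; lra. Qed.

Lemma Im_Bc_Ff (r : R) : 0 < r < 1 ->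
  Im (Bc ((1 - polar r (PI / 6)) / (1 + polar r (PI / 6))))%C = Im (Ff (polar r (PI / 6))).
Proof.
  intros Hr; assert (HP := PI_RGT_0).
  set (f := fun t => (Bc ((1 - polar r t) / (1 + polar r t)) - Ff (polar r t))%C).
  assert (D : forall t, 0 <= t <= PI / 6 -> dC f t 0%C).
  { intros t Ht; unfold f; apply (dC_Bc_Ff (polar r) t (polar 1 t * ((0, r * 1)%R : C))%C).
    - rewrite Cmod_polar; lra.
    - simpl; generalize (cos_range_pos t Ht); nra.
    - apply (dC_polar (fun _ => r) (fun s => s)); [apply (is_derive_const r)|apply (is_derive_id (K := R_AbsRing))]. }
  assert (E : f 0 = f (PI / 6)).
  { apply (dC_0_limits f 0 (PI / 6)); [lra|intros t Ht; apply D; lra| |].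
    - apply (dC_at_right _ _ _ (D 0 ltac:(lra))).
    - apply (dC_at_left _ _ _ (D (PI / 6) ltac:(lra))). }
  assert (E0 : Im (f 0) = 0).
  { unfold f; replace (polar r 0) with (RtoC r) by (unfold polar, RtoC; rewrite cos_0, sin_0; f_equal; ring).
    now apply Im_Bc_sub_Ff_R. }
  rewrite E in E0; unfold f in E0.
  generalize dependent (Bc ((1 - polar r (PI / 6)) / (1 + polar r (PI / 6)))%C).
  generalize (Ff (polar r (PI / 6))); intros [? ?] [? ?]; simpl; lra.
Qed.

(** Radial limits rather than values at [r = 1]: the derivative identity holds inside the disc,
    where the power series converge absolutely, while series with leading exponent 1 converge only
    conditionally on the circle. The predicate is closed under sums and products, so membership of
    [Ff] is assembled from its parts. *)
Definition CMZV_limit (k : nat) (f : R -> C) : Prop :=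
  exists v, in_CMZV k 12 v /\ filterlim f (at_left 1) (locally v).

Lemma CMZV_limit_plus (k : nat) (f g : R -> C) :
  CMZV_limit k f -> CMZV_limit k g -> CMZV_limit k (fun r => f r + g r)%C.
Proof.
  intros [v [Hv Lv]] [w [Hw Lw]]; exists (v + w)%C; split; [now apply in_CMZV_plus|now clim_plus].
Qed.

Lemma CMZV_limit_scal (k : nat) (q : Q) (f : R -> C) :
  CMZV_limit k f -> CMZV_limit k (fun r => RtoC (Q2R q) * f r)%C.
Proof.
  intros [v [Hv Lv]]; exists (RtoC (Q2R q) * v)%C; split; [now apply in_CMZV_scal|].
  clim_mult; [apply filterlim_const|exact Lv].
Qed.

Lemma CMZV_limit_mult (k l : nat) (f g : R -> C) :
  CMZV_limit k f -> CMZV_limit l g -> CMZV_limit (k + l) (fun r => f r * g r)%C.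
Proof.
  intros [v [Hv Lv]] [w [Hw Lw]]; exists (v * w)%C; split; [apply in_CMZV_mult; auto; lia|now clim_mult].
Qed.

Lemma CMZV_limit_ext (k : nat) (f g : R -> C) : (forall r, 0 < r < 1 -> f r = g r) ->
  CMZV_limit k f -> CMZV_limit k g.
Proof.
  intros E [v [Hv Lv]]; exists v; split; [exact Hv|].
  apply (filterlim_ext_loc f); [apply (at_left_gt 0 1); [lra|exact E]|exact Lv].
Qed.

Lemma CMZV_limit_minus (k : nat) (f g : R -> C) :
  CMZV_limit k f -> CMZV_limit k g -> CMZV_limit k (fun r => f r - g r)%C.
Proof.
  intros Hf Hg; apply (CMZV_limit_ext k (fun r => f r + RtoC (Q2R (-1)) * g r)%C).
  - intros r _; replace (Q2R (-1)) with (-1) by (unfold Q2R; simpl; field); ring.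
  - apply CMZV_limit_plus, CMZV_limit_scal; assumption.
Qed.

Lemma CMZV_limit_Mp (s : nat) (z : C) (d : list (nat * C)) :
  admissible (wt ((s, z) :: d)) 12 ((s, z) :: d) ->
  CMZV_limit (wt ((s, z) :: d)) (fun r => Mp ((s, z) :: d) (RtoC r)).
Proof.
  intros H.
  destruct (mpl_converges ((s, z) :: d)) as [v [Hv Lv]]; [apply (admissible_wf _ 12 _ ltac:(lia) H)|easy|apply H|].
  exists v; split; [now apply (in_CMZV_gen 12 _ _ _ H)|exact Lv].
Qed.

(** * Twelfth roots of unity and the values of weight 1 and 2 *)

Lemma Ci_pow_12 : (Ci ^ 12)%C = RtoC 1.
Proof.
  assert (E : (Ci * Ci)%C = RtoC (-1)) by (unfold Ci, Cmult, RtoC; simpl; f_equal; ring).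
  transitivity ((Ci * Ci) * (Ci * Ci) * (Ci * Ci) * (Ci * Ci) * (Ci * Ci) * (Ci * Ci))%C.
  - rewrite !Cpow_S; change (Ci ^ 0)%C with (RtoC 1); ring.
  - rewrite E; ring.
Qed.

Lemma Copp_pow_12 (z : C) : ((- z) ^ 12)%C = (z ^ 12)%C.
Proof. rewrite !Cpow_S; change ((- z) ^ 0)%C with (RtoC 1); change (z ^ 0)%C with (RtoC 1); ring. Qed.

Lemma admissible_1 (s : nat) (z : C) : (0 < s)%nat -> (z ^ 12)%C = RtoC 1 -> z <> RtoC 1 ->
  admissible (wt [(s, z)]) 12 [(s, z)].
Proof.
  intros Hs Hz Hn; apply admissible_iff; repeat split; [now repeat constructor|intros [_ E]; auto].
Qed.

Lemma admissible_2 (s s' : nat) (z z' : C) : (0 < s)%nat -> (0 < s')%nat ->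
  (z ^ 12)%C = RtoC 1 -> (z' ^ 12)%C = RtoC 1 -> z <> RtoC 1 ->
  admissible (wt [(s, z); (s', z')]) 12 [(s, z); (s', z')].
Proof.
  intros Hs Hs' Hz Hz' Hn; apply admissible_iff; repeat split; [now repeat constructor|intros [_ E]; auto].
Qed.

(** [Li_1 (i r) - Li_1 (- i r) = 2 i atan r], and [r] tends to 1. Powers of [PI] enter the space
    only together with powers of [i]; [PI^2] comes from the square. *)
Lemma CMZV_iPI_2 : in_CMZV 1 12 (0, PI / 2).
Proof.
  assert (H : CMZV_limit 1 (fun r => Mp [(1%nat, Ci)] (RtoC r) - Mp [(1%nat, (- Ci)%C)] (RtoC r))%C).
  { apply CMZV_limit_minus; refine (CMZV_limit_Mp 1 _ [] (admissible_1 1 _ _ _ _)); try lia.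
    - apply Ci_pow_12.
    - intros E; apply (f_equal Im) in E; simpl in E; lra.
    - rewrite Copp_pow_12; apply Ci_pow_12.
    - intros E; apply (f_equal Im) in E; simpl in E; lra. }
  destruct H as [v [Hv Lv]].
  replace ((0, PI / 2) : C) with v; [exact Hv|].
  apply (Clim_unique (at_left 1) _ _ _ ltac:(typeclasses eauto) Lv).
  apply (filterlim_ext_loc (fun r => Ci * RtoC (2 * atan r))%C).
  - apply (at_left_gt 0 1); [lra|]; intros r Hr.
    assert (H1 : Cmod (Ci * RtoC r) < 1) by (apply Ci_R_lt_1; lra).
    rewrite !Mp_single; replace (- Ci * RtoC r)%C with (Ci * RtoC (- r))%C by (rewrite RtoC_opp; ring).
    rewrite !L1_Clog; [|rewrite RtoC_opp; replace (Ci * - RtoC r)%C with (- (Ci * RtoC r))%C by ring; now rewrite Cmod_opp|exact H1].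
    rewrite !Clog_1_sub_iR, atan_opp; replace ((- r) ^ 2) with (r ^ 2) by ring.
    unfold Ci, RtoC, Cmult, Cminus, Copp, Cplus; simpl; f_equal; ring.
  - apply (Clim_eq _ _ (Ci * RtoC (2 * atan 1))%C).
    { rewrite atan_1; unfold Ci, RtoC, Cmult; simpl; f_equal; field. }
    refine (dC_at_left (fun r => Ci * RtoC (2 * atan r))%C 1 (Ci * RtoC 1)%C _).
    apply dC_scal, (dC_RtoC (fun r => 2 * atan r)); auto_derive; auto; unfold Rsqr; field.
Qed.

Lemma CMZV_iPI_6 : in_CMZV 1 12 (0, PI / 6).
Proof.
  replace ((0, PI / 6) : C) with (RtoC (Q2R (1 # 3)) * (0, PI / 2)%R)%C.
  - apply in_CMZV_scal, CMZV_iPI_2.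
  - unfold Q2R, RtoC, Cmult; simpl; f_equal; field.
Qed.

Lemma CMZV_PI2 : in_CMZV 2 12 (RtoC (PI ^ 2 / 8)).
Proof.
  replace (RtoC (PI ^ 2 / 8)) with (RtoC (Q2R (-1 # 2)) * ((0, PI / 2)%R * (0, PI / 2)%R))%C.
  - apply in_CMZV_scal, (in_CMZV_mult 12 ltac:(lia) 1 1); apply CMZV_iPI_2.
  - unfold Q2R, RtoC, Cmult; simpl; f_equal; field.
Qed.

Definition zeta12 : C := polar 1 (PI / 6).

Lemma polar_mult (r s a b : R) : (polar r a * polar s b)%C = polar (r * s) (a + b).
Proof. unfold polar, Cmult; simpl; rewrite cos_plus, sin_plus; f_equal; ring. Qed.

Lemma zeta12_pow : (zeta12 ^ 12)%C = RtoC 1.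
Proof.
  rewrite !Cpow_S; unfold zeta12; change (polar 1 (PI / 6) ^ 0)%C with (RtoC 1).
  rewrite Cmult_1_r, !polar_mult.
  replace (PI / 6 + _) with (2 * PI) by field.
  unfold polar; rewrite cos_2PI, sin_2PI; unfold RtoC; f_equal; ring.
Qed.

Lemma polar_zeta12 (r : R) : polar r (PI / 6) = (zeta12 * RtoC r)%C.
Proof. unfold zeta12, polar, Cmult, RtoC; simpl; f_equal; ring. Qed.

(** Taken with [e = 1] and [e = -1], it ensures that the leading argument is never 1, so data with
    leading exponent 1 are admissible as well. *)
Lemma zeta12_ne (e : R) : (zeta12 * RtoC e)%C <> RtoC 1.
Proof.
  intros E; assert (H := E); apply (f_equal Im) in E; apply (f_equal Re) in H.
  revert E H; unfold zeta12, polar; simpl; rewrite sin_PI6, cos_PI6; intros;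
  generalize sqrt3_sq; nra.
Qed.

Lemma CMZV_limit_Mp_zeta (s : nat) (e : R) : (0 < s)%nat -> e = 1 \/ e = -1 ->
  CMZV_limit s (fun r => Mp [(s, RtoC e)] (polar r (PI / 6))).
Proof.
  intros Hs He.
  apply (CMZV_limit_ext s (fun r => Mp [(s, (RtoC e * zeta12)%C)] (RtoC r))).
  - intros r _; rewrite polar_zeta12; symmetry; apply Mp_scal.
  - replace s with (wt [(s, (RtoC e * zeta12)%C)]) at 1 by (simpl; lia).
    apply CMZV_limit_Mp, admissible_1; [exact Hs| |rewrite Cmult_comm; apply zeta12_ne].
    destruct He as [-> | ->].
    + rewrite Cmult_1_l; apply zeta12_pow.
    + replace (RtoC (-1) * zeta12)%C with (- zeta12)%C by ring; rewrite Copp_pow_12; apply zeta12_pow.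
Qed.

Lemma CMZV_limit_Mp_zeta2 (s : nat) (e e' : R) : (0 < s)%nat -> e = 1 \/ e = -1 -> e' = 1 \/ e' = -1 ->
  CMZV_limit (S s) (fun r => Mp [(s, RtoC e); (1%nat, RtoC e')] (polar r (PI / 6))).
Proof.
  intros Hs He He'.
  apply (CMZV_limit_ext (S s) (fun r => Mp [(s, (RtoC e * zeta12)%C); (1%nat, RtoC e')] (RtoC r))).
  - intros r _; rewrite polar_zeta12; symmetry; apply Mp_scal.
  - replace (S s) with (wt [(s, (RtoC e * zeta12)%C); (1%nat, RtoC e')]) by (simpl; lia).
    apply CMZV_limit_Mp, admissible_2; [exact Hs|lia| | |rewrite Cmult_comm; apply zeta12_ne].
    + destruct He as [-> | ->].
      * rewrite Cmult_1_l; apply zeta12_pow.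
      * replace (RtoC (-1) * zeta12)%C with (- zeta12)%C by ring; rewrite Copp_pow_12; apply zeta12_pow.
    + rewrite <- RtoC_pow; f_equal; destruct He' as [-> | ->]; ring.
Qed.

Lemma CMZV_limit_chi (s : nat) : (0 < s)%nat -> CMZV_limit s (fun r => chi s (polar r (PI / 6))).
Proof.
  intros Hs.
  apply (CMZV_limit_ext s (fun r => RtoC (Q2R (1 # 2)) *
    (Mp [(s, RtoC 1)] (polar r (PI / 6)) - Mp [(s, RtoC (-1))] (polar r (PI / 6))))%C).
  - intros r _; unfold chi; rewrite !Mp_single; f_equal.
    + unfold Q2R; simpl; rewrite <- RtoC_inv by lra; f_equal; field.
    + f_equal; [|f_equal]; f_equal; ring.
  - apply CMZV_limit_scal, CMZV_limit_minus; apply CMZV_limit_Mp_zeta; auto.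
Qed.

Lemma CMZV_limit_Clog_1_sub : CMZV_limit 1 (fun r => Clog (1 - polar r (PI / 6))%C).
Proof.
  apply (CMZV_limit_ext 1 (fun r => RtoC (Q2R (-1)) * Mp [(1%nat, RtoC 1)] (polar r (PI / 6)))%C).
  - intros r Hr; rewrite Mp_single, Cmult_1_l, L1_Clog by (rewrite Cmod_polar; lra).
    replace (Q2R (-1)) with (-1) by (unfold Q2R; simpl; field); ring.
  - apply CMZV_limit_scal, CMZV_limit_Mp_zeta; auto.
Qed.

Lemma CMZV_limit_Clog_1_plus : CMZV_limit 1 (fun r => Clog (1 + polar r (PI / 6))%C).
Proof.
  apply (CMZV_limit_ext 1 (fun r => RtoC (Q2R (-1)) * Mp [(1%nat, RtoC (-1))] (polar r (PI / 6)))%C).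
  - intros r Hr; rewrite Mp_single; replace (RtoC (-1) * polar r (PI / 6))%C with (- polar r (PI / 6))%C by ring.
    rewrite L1_opp by (rewrite Cmod_polar; lra).
    replace (Q2R (-1)) with (-1) by (unfold Q2R; simpl; field); ring.
  - apply CMZV_limit_scal, CMZV_limit_Mp_zeta; auto.
Qed.

Lemma CMZV_limit_Clog : CMZV_limit 1 (fun r => Clog (polar r (PI / 6))).
Proof.
  exists (0, PI / 6); split; [apply CMZV_iPI_6|].
  assert (HP := PI_RGT_0).
  apply (filterlim_ext_loc (fun r => RtoC (ln r) + (0, PI / 6)%R)%C).
  - apply (at_left_gt 0 1); [lra|]; intros r Hr; rewrite Clog_polar by lra.
    unfold RtoC, Cplus; simpl; f_equal; ring.
  - apply (Clim_eq _ _ (RtoC (ln 1) + (0, PI / 6)%R)%C).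
    { rewrite ln_1; ring. }
    clim_plus; [|apply filterlim_const].
    refine (dC_at_left (fun r => RtoC (ln r)) 1 (RtoC 1) _).
    apply (dC_RtoC ln); auto_derive; [lra|field].
Qed.

Lemma CMZV_limit_Nf (s : nat) : (0 < s)%nat -> CMZV_limit (S s) (fun r => Nf s (polar r (PI / 6))).
Proof.
  intros Hs; unfold Nf; apply CMZV_limit_minus; [apply CMZV_limit_minus; [apply CMZV_limit_plus|]|];
    apply CMZV_limit_Mp_zeta2; auto.
Qed.

Lemma CMZV_limit_const (k : nat) (v : C) : in_CMZV k 12 v -> CMZV_limit k (fun _ => v).
Proof. intros H; exists v; split; [exact H|apply filterlim_const]. Qed.

Lemma CMZV_limit_Ff : CMZV_limit 3 (fun r => Ff (polar r (PI / 6))).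
Proof.
  apply (CMZV_limit_ext 3 (fun r =>
    RtoC (PI ^ 2 / 8) * (Clog (1 - polar r (PI / 6)) + Clog (1 + polar r (PI / 6)) - Clog (polar r (PI / 6)))
    + RtoC (Q2R 2) * chi 3 (polar r (PI / 6))
    - chi 2 (polar r (PI / 6)) * (Clog (1 - polar r (PI / 6)) + Clog (1 + polar r (PI / 6)))
    + (Mp [(2%nat, RtoC (-1)); (1%nat, RtoC 1)] (polar r (PI / 6)) - Mp [(2%nat, RtoC 1); (1%nat, RtoC 1)] (polar r (PI / 6)))
    + RtoC (Q2R (1 # 2)) * (Clog (polar r (PI / 6)) * Nf 1 (polar r (PI / 6)))
    - RtoC (Q2R (1 # 2)) * Nf 2 (polar r (PI / 6))
    - Clog (polar r (PI / 6)) * chi 2 (polar r (PI / 6)))%C).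
  - intros r _; unfold Ff.
    replace (RtoC (Q2R (1 # 2))) with (/ 2)%C by (unfold Q2R; simpl; rewrite <- RtoC_inv by lra; f_equal; field).
    replace (Q2R 2) with 2 by (unfold Q2R; simpl; field); reflexivity.
  - assert (HB := CMZV_limit_Clog_1_sub); assert (HC := CMZV_limit_Clog_1_plus); assert (HA := CMZV_limit_Clog).
    apply CMZV_limit_minus; [apply CMZV_limit_minus; [apply CMZV_limit_plus; [apply CMZV_limit_plus;
      [apply CMZV_limit_minus; [apply CMZV_limit_plus|]|]|]|]|].
    + apply (CMZV_limit_mult 2 1 (fun _ => RtoC (PI ^ 2 / 8))); [apply CMZV_limit_const, CMZV_PI2|].
      apply CMZV_limit_minus; [apply CMZV_limit_plus|]; assumption.
    + apply CMZV_limit_scal, CMZV_limit_chi; lia.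
    + apply (CMZV_limit_mult 2 1); [apply CMZV_limit_chi; lia|apply CMZV_limit_plus; assumption].
    + apply CMZV_limit_minus; apply (CMZV_limit_Mp_zeta2 2); auto.
    + apply CMZV_limit_scal, (CMZV_limit_mult 1 2); [exact HA|apply CMZV_limit_Nf; lia].
    + apply CMZV_limit_scal, CMZV_limit_Nf; lia.
    + apply (CMZV_limit_mult 1 2); [exact HA|apply CMZV_limit_chi; lia].
Qed.

(** The value is [- i tan (PI / 12)]: the point at which the binomial series is evaluated is the
    Cayley image of a primitive 12th root of unity. *)
Lemma Cayley_zeta12 : ((1 - polar 1 (PI / 6)) / (1 + polar 1 (PI / 6)))%C = (Ci * RtoC (-1 * (2 - sqrt 3)))%C.
Proof.
  assert (N : (1 + polar 1 (PI / 6))%C <> 0%C).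
  { apply Re_pos_neq; unfold polar; simpl; rewrite cos_PI6; generalize sqrt3_bounds; lra. }
  transitivity ((Ci * RtoC (-1 * (2 - sqrt 3)) * (1 + polar 1 (PI / 6))) / (1 + polar 1 (PI / 6)))%C; [|field; exact N].
  f_equal; unfold polar, Ci, RtoC, Cmult, Cminus, Copp, Cplus; simpl; rewrite cos_PI6, sin_PI6.
  generalize sqrt3_sq; intros E; f_equal; nra.
Qed.

Lemma Im_Clim_unique (f g : R -> C) (a : R) (v w : C) :
  filterlim f (at_left a) (locally v) -> filterlim g (at_left a) (locally w) ->
  at_left a (fun r => Im (f r) = Im (g r)) -> Im v = Im w.
Proof.
  intros Lf Lg E.
  apply filterlim_C_iff in Lf; [|typeclasses eauto]; apply filterlim_C_iff in Lg; [|typeclasses eauto].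
  exact (filterlim_locally_unique (K := R_AbsRing) (V := R_NormedModule) (fun r => Im (g r)) (Im v) (Im w)
    (filterlim_ext_loc _ _ E (proj2 Lf)) (proj2 Lg)).
Qed.

(** On the side of [Bc] the limit point [- i (2 - sqrt 3)] is interior to the disc, so plain
    continuity suffices; only [Ff] approaches the unit circle. *)
Lemma Im_CMZV_limit (v : C) : filterlim (fun r => Ff (polar r (PI / 6))) (at_left 1) (locally v) ->
  Im (Bc (Ci * RtoC (-1 * (2 - sqrt 3)))%C) = Im v.
Proof.
  intros Lv.
  assert (Hc : 0 < cos (PI / 6)) by (rewrite cos_PI6; generalize sqrt3_bounds; lra).
  assert (N : (1 + polar 1 (PI / 6))%C <> 0%C) by (apply Re_pos_neq; unfold polar; simpl; lra).
  assert (D : dC (fun r => polar r (PI / 6)) 1 (polar 1 (PI / 6))).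
  { eapply dC_eq; [|apply (dC_ext (fun r => RtoC r * polar 1 (PI / 6))%C); [|apply dC_ray]]; [reflexivity|].
    intros r; unfold polar, RtoC, Cmult; simpl; f_equal; ring. }
  destruct (ex_dC_Bc (fun r => (1 - polar r (PI / 6)) / (1 + polar r (PI / 6)))%C 1 _
    (Cayley_lt_1 (polar 1 (PI / 6)) ltac:(unfold polar; simpl; lra))
    (dC_div _ _ _ _ _ N (dC_minus _ _ _ _ _ (dC_const 1 _) D) (dC_plus _ _ _ _ _ (dC_const 1 _) D))) as [l Dl].
  apply dC_at_left in Dl; rewrite Cayley_zeta12 in Dl.
  refine (Im_Clim_unique _ _ 1 _ _ Dl Lv _).
  apply (at_left_gt 0 1); [lra|]; exact Im_Bc_Ff.
Qed.

Theorem theorem1 :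
  is_series (fun n : nat => / (INR (2 * n + 1) ^ 3 * Binomial.C (2 * n) n)) rhs_value
  /\ in_iCMZV 3 12 (RtoC rhs_value).
Proof.
  rewrite <- closed_form; split; [apply binomial_series_Bc|].
  destruct CMZV_limit_Ff as [v [Hv Lv]].
  exists (RtoC (Q2R 2) * (v + RtoC (Q2R (-1)) * Cconj v))%C; split.
  - apply in_CMZV_scal, in_CMZV_plus; [exact Hv|apply in_CMZV_scal, in_CMZV_conj, Hv].
  - assert (E := Im_CMZV_limit v Lv).
    generalize dependent (Bc (Ci * RtoC (-1 * (2 - sqrt 3)))%C); intros b E.
    replace (Q2R 2) with 2 by (unfold Q2R; simpl; field).
    replace (Q2R (-1)) with (-1) by (unfold Q2R; simpl; field).
    destruct b as [b1 b2], v as [v1 v2]; simpl in E; subst b2.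
    unfold RtoC, Ci, Cconj, Cmult, Cplus; simpl; f_equal; ring.
Qed.
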